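(* Let $\Omega\subset\mathbb{R}^n$ be a bounded open set with Lipschitz boundary. For every measurable set $E\subset\mathbb{R}^n$, $$\Gamma(L^1_{\rm loc})\text{-}\lim_{\alpha\to1^-}|D^\alpha\chi_E|(\Omega)=P(E;\Omega).$$
   Context: Here $n\in\mathbb{N}$, $n\ge1$, and $P(E;\Omega)=|D\chi_E|(\Omega)\in[0,+\infty]$ is the standard De Giorgi perimeter of $E$ in $\Omega$. For $\alpha\in(0,1)$ let $\mu_{n,\alpha}:=2^\alpha\pi^{-n/2}\,\Gamma\big(\tfrac{n+\alpha+1}{2}\big)/\Gamma\big(\tfrac{1-\alpha}{2}\big)$, and for $\varphi\in C^\infty_c(\mathbb{R}^n;\mathbb{R}^n)$ let $$\mathrm{div}^\alpha\varphi(x):=\mu_{n,\alpha}\int_{\mathbb{R}^n}\frac{(y-x)\cdot(\varphi(y)-\varphi(x))}{|y-x|^{n+\alpha+1}}\,dy,\qquad x\in\mathbb{R}^n,$$ which belongs to $L^1(\mathbb{R}^n)\cap L^\infty(\mathbb{R}^n)$. For a measurable set $E\subset\mathbb{R}^n$, its fractional Caccioppoli $\alpha$-perimeter in $\Omega$ is $$|D^\alpha\chi_E|(\Omega):=\sup\Big\{\int_E\mathrm{div}^\alpha\varphi\,dx:\ \varphi\in C^\infty_c(\Omega;\mathbb{R}^n),\ \|\varphi\|_{L^\infty(\Omega;\mathbb{R}^n)}\le1\Big\}\in[0,+\infty].$$ The $\Gamma$-limit is taken for the functionals $E\mapsto|D^\alpha\chi_E|(\Omega)$ on the metric space of (characteristic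 functions of) measurable subsets of $\mathbb{R}^n$ endowed with $L^1_{\rm loc}(\mathbb{R}^n)$ convergence. Explicitly, the claim means: for every family $(E_\alpha)_{\alpha\in(0,1)}$ of measurable sets with $\chi_{E_\alpha}\to\chi_E$ in $L^1_{\rm loc}(\mathbb{R}^n)$ as $\alpha\to1^-$ one has $P(E;\Omega)\le\liminf_{\alpha\to1^-}|D^\alpha\chi_{E_\alpha}|(\Omega)$, and there exists such a family with $\limsup_{\alpha\to1^-}|D^\alpha\chi_{E_\alpha}|(\Omega)\le P(E;\Omega)$. *)

(* Defs.v *)
From HB Require Import structures.
From mathcomp Require Import all_boot all_order all_algebra.
From mathcomp Require Import all_classical all_reals all_analysis.

Set Implicit Arguments.
Unset Strict Implicit.
Unset Printing Implicit Defensive.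

Import Order.TTheory GRing.Theory Num.Theory.
Import numFieldNormedType.Exports.

Local Open Scope classical_set_scope.
Local Open Scope ring_scope.

(* 'rV[R]_n carries the sigma-algebra generated by the coordinates, i.e. the
   Borel sigma-algebra. *)
Section borel_rV.
Context (R : realType) (n : nat).

Let coor : 'I_n -> 'rV[R]_n -> measurableTypeR R := fun i x => x 0 i.

Let borel0 : g_sigma_preimage coor set0.
Proof. exact: sigma_algebra0. Qed.

Let borelC A : g_sigma_preimage coor A -> g_sigma_preimage coor (~` A).
Proof. exact: sigma_algebraC. Qed.

Let borel_bigcup (F : (set 'rV[R]_n)^nat) :
  (forall i, g_sigma_preimage coor (F i)) ->
  g_sigma_preimage coor (\bigcup_i F i).
Proof. exact: sigma_algebra_bigcup. Qed.

HB.instance Definition _ := @isMeasurable.Build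
  (measure_tuple_display default_measure_display) 'rV[R]_n
  (g_sigma_preimage coor) borel0 borelC borel_bigcup.

Lemma measurable_coor (i : 'I_n) :
  measurable_fun [set: 'rV[R]_n] (coor i).
Proof.
move=> _ Y mY; rewrite setTI; apply: sub_sigma_algebra => /=.
rewrite -bigcup_seq/=; exists i => /=; first by rewrite mem_index_enum.
by exists Y => //; rewrite setTI.
Qed.

Lemma measurable_to_rV d (T : measurableType d) (f : T -> 'rV[R]_n) :
  (forall i, measurable_fun [set: T] (coor i \o f)) ->
  measurable_fun [set: T] f.
Proof.
move=> mf _ A mA; rewrite setTI; move: A mA.
apply: smallest_sub => /=.
  split => [|B mB|F mF].
  - by rewrite /= preimage_set0.
  - by rewrite setTD -preimage_setC; exact: measurableC.
  - by rewrite preimage_bigcup; exact: bigcupT_measurable.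
move=> A; rewrite -bigcup_seq/= => -[i _ [B mB <-]].
by have := mf i measurableT B mB; rewrite !setTI.
Qed.

End borel_rV.

(* The canonical sigma-finite structure on products is shadowed in the library
   by the one for subprobabilities. *)
Lemma product_measure_sigma_finiteT d1 d2 (T1 : measurableType d1)
    (T2 : measurableType d2) (R : realType)
    (m1 : {sigma_finite_measure set T1 -> \bar R})
    (m2 : {sigma_finite_measure set T2 -> \bar R}) :
  sigma_finite setT (m1 \x m2)%E.
Proof.
by case: (lebesgue_integral_fubini.measure_function_Measure_isSigmaFinite__to__measure_function_isSigmaFinite m1 m2).
Qed.

Section lebesgue_rV_step.
Context (R : realType) (n : nat).

Definition cons_rV (p : measurableTypeR R * 'rV[R]_n) : 'rV[R]_n.+1 :=
  row_mx (const_mx p.1 : 'rV_1) p.2.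

Definition uncons_rV (x : 'rV[R]_n.+1) : measurableTypeR R * 'rV[R]_n :=
  (x 0 ord0, \row_j x 0 (lift ord0 j)).

Lemma cons_rV_coor0 p : cons_rV p 0 ord0 = p.1.
Proof.
rewrite /cons_rV (_ : ord0 = lshift n (ord0 : 'I_1)); last exact: val_inj.
by rewrite (row_mxEl (const_mx p.1 : 'rV_1)) mxE.
Qed.

Lemma cons_rV_coorS p j : cons_rV p 0 (lift ord0 j) = p.2 0 j.
Proof.
rewrite /cons_rV (_ : lift ord0 j = rshift 1 j); last exact: val_inj.
by rewrite (row_mxEr (const_mx p.1 : 'rV_1)).
Qed.

Lemma cons_rVK : cancel cons_rV uncons_rV.
Proof.
move=> p; rewrite /uncons_rV cons_rV_coor0 [RHS]surjective_pairing.
by congr pair; apply/rowP => j; rewrite mxE cons_rV_coorS.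
Qed.

Lemma measurable_cons_rV : measurable_fun [set: _] cons_rV.
Proof.
apply: measurable_to_rV => i; case: (unliftP ord0 i) => [j ->|->].
  rewrite (_ : _ \o _ = (fun x : 'rV[R]_n => x 0 j : measurableTypeR R) \o snd).
    by apply: measurableT_comp; [exact: measurable_coor|exact: measurable_snd].
  by apply/funext => p /=; rewrite cons_rV_coorS.
rewrite (_ : _ \o _ = fst); first exact: measurable_fst.
by apply/funext => p /=; rewrite cons_rV_coor0.
Qed.

Lemma measurable_uncons_rV : measurable_fun [set: _] uncons_rV.
Proof.
apply/measurable_fun_pairP; split; first exact: measurable_coor.
apply: measurable_to_rV => j.
rewrite (_ : _ \o _ =
    fun x : 'rV[R]_n.+1 => x 0 (lift ord0 j) : measurableTypeR R).
  exact: measurable_coor.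
by apply/funext => x /=; rewrite mxE.
Qed.

Variable mu : {sigma_finite_measure set 'rV[R]_n -> \bar R}.

Definition lebesgue_rV_step : set 'rV[R]_n.+1 -> \bar R :=
  pushforward (@lebesgue_measure R \x mu)%E cons_rV.

HB.instance Definition _ := Measure.copy lebesgue_rV_step
  (measure_function_pushforward__canonical__measure_function_Measure
    (@lebesgue_measure R \x mu)%E measurable_cons_rV).

Let lebesgue_rV_step_sigma_finite : sigma_finite setT lebesgue_rV_step.
Proof.
have [F FT mF] : sigma_finite setT (@lebesgue_measure R \x mu)%E.
  exact: (product_measure_sigma_finiteT (@lebesgue_measure R)).
exists (fun k => uncons_rV @^-1` F k).
  by rewrite -preimage_bigcup -FT preimage_setT.
move=> k; have [mFk Fkoo] := mF k; split.
  by rewrite -[X in measurable X]setTI; exact: measurable_uncons_rV.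
rewrite /lebesgue_rV_step /pushforward -comp_preimage.
by rewrite (_ : uncons_rV \o cons_rV = id)//; apply/funext; exact: cons_rVK.
Qed.

HB.instance Definition _ := @Measure_isSigmaFinite.Build _ _ _
  lebesgue_rV_step lebesgue_rV_step_sigma_finite.

End lebesgue_rV_step.

(* n-fold product of the Lebesgue measure on R, on Borel sets. *)
Fixpoint lebesgue_borel (R : realType) (n : nat) :
    {sigma_finite_measure set 'rV[R]_n -> \bar R} :=
  match n with
  | 0%N => \d_(0 : 'rV[R]_0)
  | m.+1 => lebesgue_rV_step (lebesgue_borel R m)
  end.

(* Its completion: the measurable sets of [lebesgue_type R n] are the Lebesgue
   measurable subsets of R^n. *)
Definition lebesgue_type (R : realType) (n : nat) :=
  caratheodory_type (mu_ext (lebesgue_borel R n)).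

HB.instance Definition _ R n := Measurable.on (lebesgue_type R n).

Definition lebesgue (R : realType) (n : nat) :
    {measure set (lebesgue_type R n) -> \bar R} :=
  @completed_measure_extension _ _ _ (lebesgue_borel R n).

Section euclidean.
Context {R : realType} {n : nat}.
Implicit Types x y : 'rV[R]_n.

Definition dotp x y : R := \sum_(i < n) x 0 i * y 0 i.

(* The library norm on 'rV[R]_n is the sup norm. *)
Definition enorm x : R := Num.sqrt (dotp x x).

End euclidean.

Section smooth.
Context {R : realType} {m n : nat}.
Implicit Types (f : 'rV[R]_m -> 'rV[R]_n) (Omega : set 'rV[R]_m).

Fixpoint Ck (k : nat) f : Prop :=
  match k with
  | 0%N => continuous f
  | k'.+1 => continuous f /\
      forall i : 'I_m, (forall x, derivable f x (delta_mx 0 i)) /\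
                       Ck k' ('D_(delta_mx 0 i) f)
  end.

Definition smooth f := forall k, Ck k f.

Definition Cc_infty Omega f :=
  [/\ smooth f, compact (closure [set x | f x != 0]) &
      closure [set x | f x != 0] `<=` Omega].

End smooth.

Definition test_field (R : realType) (n : nat) (Omega : set 'rV[R]_n)
    (phi : 'rV[R]_n -> 'rV[R]_n) : Prop :=
  Cc_infty Omega phi /\
  ('N[lebesgue R n]_+oo [EFin \o ((fun x => enorm (phi x)) \_ Omega)] <= 1)%E.

Definition Gamma (R : realType) (s : R) : R :=
  \int[@lebesgue_measure R]_(t in `]0, +oo[) (t `^ (s - 1) * expR (- t)).

Section perimeters.
Context {R : realType} {n : nat}.
Implicit Types (phi : 'rV[R]_n -> 'rV[R]_n) (E Omega : set 'rV[R]_n)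
  (alpha : R).

Definition div phi (x : 'rV[R]_n) : R :=
  \sum_(i < n) ('D_(delta_mx 0 i) phi x) 0 i.

Definition perimeter E Omega : \bar R :=
  ereal_sup [set (\int[lebesgue R n]_(x in E) (div phi x)%:E)%E
            | phi in test_field Omega].

Definition frac_const alpha : R :=
  2 `^ alpha * pi `^ (- (n%:R / 2)) * Gamma ((n%:R + alpha + 1) / 2)
  / Gamma ((1 - alpha) / 2).

Definition frac_div alpha phi (x : 'rV[R]_n) : R :=
  frac_const alpha *
  \int[lebesgue R n]_y
    (dotp (y - x) (phi y - phi x) / enorm (y - x) `^ (n%:R + alpha + 1)).

Definition frac_perimeter alpha E Omega : \bar R :=
  ereal_sup [set (\int[lebesgue R n]_(x in E) (frac_div alpha phi x)%:E)%E
            | phi in test_field Omega].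

End perimeters.

(* Near each boundary point and up to an orthogonal change of coordinates,
   Omega is the strict epigraph of a Lipschitz function of the first n
   coordinates. *)
Definition lipschitz_boundary (R : realType) (n : nat)
    (Omega : set 'rV[R]_n.+1) : Prop :=
  forall x, (closure Omega `\` interior Omega) x ->
  exists (A : 'M[R]_n.+1) (g : 'rV[R]_n -> R),
    [/\ A *m A^T = 1%:M, lipschitz g &
        \forall y \near x,
          Omega y <-> g (col' ord_max (y *m A)) < (y *m A) 0 ord_max].

Section gamma_limit.
Context {R : realType} {n : nat}.
Implicit Types (E : set 'rV[R]_n) (F : R -> set 'rV[R]_n).

Definition lebesgue_measurable E : Prop :=
  measurable (E : set (lebesgue_type R n)).

(* Families are indexed by all of R, but only the indices in ]0, 1[ matter. *)
Definition measurable_family F : Prop :=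
  forall alpha, 0 < alpha < 1 -> lebesgue_measurable (F alpha).

Definition L1loc_cvg F E : Prop :=
  forall K : set 'rV[R]_n, compact K ->
  (\int[lebesgue R n]_(x in K) `|\1_(F alpha) x - \1_E x|%:E)%E
    @[alpha --> 1^'-] --> 0%E.

Definition is_Gamma_limit (J : R -> set 'rV[R]_n -> \bar R) E (l : \bar R) :
    Prop :=
  (forall F, measurable_family F -> L1loc_cvg F E ->
     (l <= limf_einf (fun alpha => J alpha (F alpha)) 1^'-)%E) /\
  (exists F, [/\ measurable_family F, L1loc_cvg F E &
     (limf_esup (fun alpha => J alpha (F alpha)) 1^'- <= l)%E]).

End gamma_limit.

(* Main.v *)
(* Write |z|^(-n-alpha-1) as a Gamma integral of Gaussians exp(-s|z|^2).
   Integrating by parts in each Gaussian turns the pairing of the fractional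
   divergence with u (typically an indicator) into
     int u div^alpha phi = A int_0^oo s^(-a-1) H(s) ds,   a = (1 - alpha)/2,
   where H(s) is the average of h(z) = int u(x) div phi(x + z) dx against the
   normalized Gaussian, A -> 0 and A/a -> 1 as alpha -> 1.
   Since H(s) = O(sqrt s) near 0 and H(s) - h(0) = O(1/sqrt s) at infinity,
   uniformly in u, int u div^alpha phi is close to int u div phi uniformly in
   u, whence the liminf inequality.
   If F has perimeter at most P in an open U containing the closure of Omega,
   the small translates of a test field of Omega are test fields of U, so the
   part of the Gaussian near 0 contributes at most P to H(s) and the rest is
   O(1/sqrt s): the fractional perimeters of F in Omega have limsup at most P.
   It remains to approximate E by sets F_t with perimeter at most (1 + Ct) P(E)
   in a neighbourhood of the closure of Omega.  They are preimages of E under a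
   composition of the inverses of finitely many maps y - t zeta(y) v, zeta being
   a bump in a boundary chart and v its inward axis; these inverses send the
   closure of Omega into Omega.  A diagonal choice t = t(alpha) concludes. *)

Require Import Defs.
From HB Require Import structures.
From mathcomp Require Import all_boot all_order all_algebra.
From mathcomp Require Import all_classical all_reals all_analysis.
From mathcomp Require Import measurable_realfun ess_sup_inf.
From mathcomp Require Import ring lra.

Set Implicit Arguments.
Unset Strict Implicit.
Unset Printing Implicit Defensive.

Import Order.TTheory GRing.Theory Num.Theory.
Import numFieldNormedType.Exports.

Local Open Scope classical_set_scope.
Local Open Scope ring_scope.

(** * Borel sets and Lebesgue measure on row vectors *)

(** The constant family E is in general no recovery family: the fractional divergence is nonlocal,
    so its control by a perimeter needs a margin around the closure of Omega, while E may carry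
    perimeter on the boundary of Omega, or infinite perimeter outside, that P(E; Omega) does not
    see. This forces the inward displacement of the closure, and the Lipschitz boundary enters only
    there. The Gaussians replace polar coordinates: their integrals factor over the coordinates, so
    the integrability of the kernel, the moments and the constant all come from one-dimensional
    integrals, and the dimension cancels from A = 2^(alpha-1) / Gamma(a). That A/a tends to 1 is the
    limit a Gamma(a) -> 1 at the simple pole of Gamma. Each displacement moves points along one
    fixed axis. Inverting it is then a scalar equation, its Jacobian is 1 - t D_v zeta, and the
    change of variables reduces to the vanishing integral of a compactly supported directional
    derivative. The price is an iteration over the charts. *)

Section rV_norm.
Context {R : realType} {n : nat}.
Implicit Types x y : 'rV[R]_n.

Lemma coor_le_norm x i : `|x 0 i| <= `|x|.
Proof.
rewrite [leRHS]/Num.norm /= mx_normrE.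
by apply/bigmax_geP; right => /=; exists (0, i).
Qed.

Lemma norm_rV_le x (e : R) : 0 <= e -> (forall i, `|x 0 i| <= e) -> `|x| <= e.
Proof.
move=> e0 xe; rewrite [leLHS]/Num.norm /= mx_normrE.
by apply/bigmax_leP; split => // -[i j] _ /=; rewrite (ord1 i).
Qed.

Lemma norm_rV_lt x (e : R) : 0 < e -> (forall i, `|x 0 i| < e) -> `|x| < e.
Proof.
move=> e0 xe; rewrite [ltLHS]/Num.norm /= mx_normrE.
by apply/bigmax_ltP; split => // -[i j] _ /=; rewrite (ord1 i).
Qed.

Lemma continuous_coor i : continuous (fun x => x 0 i).
Proof. exact: coord_continuous. Qed.

Lemma open_norm_lt x (A : set 'rV[R]_n) : open A -> A x ->
  exists2 e : R, 0 < e & forall y, `|y - x| < e -> A y.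
Proof.
move=> oA Ax; have /nbhs_ballP[e /= e0 xA] := open_nbhs_nbhs (conj oA Ax).
exists e => // y yx; apply: xA.
by rewrite mx_norm_ball /ball_ /= -opprB normrN.
Qed.

Lemma near_norm_lt x (P : set 'rV[R]_n) : (\forall y \near x, P y) <->
  exists2 e : R, 0 < e & forall y, `|y - x| < e -> P y.
Proof.
split=> [/nbhs_ballP[e /= e0 xA]|[e e0 xP]].
  exists e => // y yx; apply: xA.
  by rewrite mx_norm_ball /ball_ /= -opprB normrN.
apply/nbhs_ballP; exists e => //= y.
by rewrite mx_norm_ball /ball_ /= -opprB normrN; exact: xP.
Qed.

End rV_norm.

Section borel_rV_open.
Context {R : realType}.

Lemma rat_approx (x r : R) : 0 < r -> exists q, `|x - ratr q| < r.
Proof.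
move=> r0; have xr : x - r < x + r by lra.
have [q] := rat_in_itvoo xr.
by rewrite in_itv /= => /andP[q1 q2]; exists q; rewrite ltr_norml; lra.
Qed.

(** Sup-norm balls with rational centres and radii 1/(m+1) form a countable base of the topology,
    and each is a finite intersection of coordinate preimages, hence lies in the sigma-algebra
    generated by the coordinates. *)
Lemma rV_open_measurable n (A : set 'rV[R]_n) : open A -> measurable A.
Proof.
move=> oA.
pose B (p : 'rV[rat]_n * nat) : set 'rV[R]_n :=
  [set y | forall i, `|y 0 i - ratr (p.1 0 i)| < p.2.+1%:R^-1].
have mB p : measurable (B p).
  rewrite (_ : B p = \bigcap_(i in [set: 'I_n])
      ((fun x : 'rV[R]_n => x 0 i : measurableTypeR R) @^-1`
        [set t | `|t - ratr (p.1 0 i)| < p.2.+1%:R^-1])); last first.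
    by apply/seteqP; split => [y yB i _|y yB i]; [exact: yB|exact: (yB i I)].
  apply: fin_bigcap_measurable; first exact: finite_finset.
  move=> i _; rewrite -[X in measurable X]setTI; apply: measurable_coor => //.
  rewrite (_ : [set t | _] = ball (ratr (p.1 0 i) : R) p.2.+1%:R^-1).
    by apply: open_measurable; exact: ball_open.
  by apply/seteqP; split=> t; rewrite /ball /= /ball_ /= distrC.
rewrite (_ : A = \bigcup_(p in [set p | B p `<=` A]) B p); last first.
  apply/seteqP; split => [x Ax|x [p pA px]]; last exact: pA.
  have [e e0 xA] := open_norm_lt oA Ax.
  (* Half of [e], since both x and y will lie within 1/(m+1) of the rational centre. *)
  have [m me] : exists m : nat, m.+1%:R^-1 < e / 2.
    have [m _ /(_ _ (leqnn _)) mP] := near_infty_natSinv_lt (PosNum (divr_gt0 e0 (ltr0Sn R 1))).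
    by exists m.
  have m0 : 0 < m.+1%:R^-1 :> R by rewrite invr_gt0.
  pose q_ex i := cid (rat_approx (x 0 i) m0).
  exists (\row_i sval (q_ex i), m) => /=.
    move=> y yB; apply: xA; apply: norm_rV_lt => // i; rewrite !mxE.
    have := yB i; rewrite /= mxE; have := svalP (q_ex i).
    move: (ratr (sval (q_ex i)) : R) => q; move: (m.+1%:R^-1 : R) me => r.
    by rewrite !ltr_norml; lra.
  by move=> i; rewrite /= mxE; exact: (svalP (q_ex i)).
rewrite bigcup_mkcond; apply: countable_bigcupT_measurable.
  exact: countableP.
by move=> p; case: ifP.
Qed.

Lemma rV_continuous_measurable n (f : 'rV[R]_n -> R) :
  continuous f -> measurable_fun [set: 'rV[R]_n] (f : _ -> measurableTypeR R).
Proof.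
move=> cf; apply: (measurability _ (RGenOInfty.measurableE R)) => //.
move=> _ [_ [x ->] <-]; rewrite setTI; apply: rV_open_measurable.
by move/continuousP : cf; apply; exact: interval_open.
Qed.

End borel_rV_open.

Section pushforward_integral.
Local Open Scope ereal_scope.

(** The integral is by definition the difference of the integrals of the positive and negative
    parts, so the nonnegative case gives all measurable functions. *)
Lemma measurable_integral_pushforward d1 d2 (X : measurableType d1)
    (Y : measurableType d2) (R : realType) (phi : X -> Y)
    (mphi : measurable_fun [set: X] phi) (mu : {measure set X -> \bar R})
    (f : Y -> \bar R) : measurable_fun setT f ->
  \int[pushforward mu phi]_y f y = \int[mu]_x f (phi x).
Proof.
move=> mf; rewrite [LHS]integralE [RHS]integralE; congr (_ - _).
  rewrite (ge0_integral_pushforward mphi)//; last exact: measurable_funepos.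
  by rewrite preimage_setT; apply: eq_integral => x _; rewrite /= !funeposE.
rewrite (ge0_integral_pushforward mphi)//; last exact: measurable_funeneg.
by rewrite preimage_setT; apply: eq_integral => x _; rewrite /= !funenegE.
Qed.

End pushforward_integral.

Section boxes.
Context {R : realType}.

Definition obox n (a b : 'rV[R]_n) : set 'rV[R]_n :=
  [set x | forall i, a 0 i < x 0 i < b 0 i].

Lemma open_coor_gt n (i : 'I_n) (c : R) : open [set x : 'rV[R]_n | c < x 0 i].
Proof.
rewrite (_ : [set _ | _] = (fun x : 'rV[R]_n => x 0 i) @^-1` [set t | c < t])//.
by apply: open_comp => //; move=> + _; exact: continuous_coor.
Qed.

Lemma open_coor_lt n (i : 'I_n) (c : R) : open [set x : 'rV[R]_n | x 0 i < c].
Proof.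
rewrite (_ : [set _ | _] = (fun x : 'rV[R]_n => x 0 i) @^-1` [set t | t < c])//.
by apply: open_comp => //; move=> + _; exact: continuous_coor.
Qed.

Lemma obox_bigcap n (a b : 'rV[R]_n) : obox a b = \bigcap_(i in [set: 'I_n])
  ([set x | a 0 i < x 0 i] `&` [set x | x 0 i < b 0 i]).
Proof.
apply/seteqP; split => [x xab i _|x xab i]; first by split; case/andP: (xab i).
by have [/= -> ->] := xab i I.
Qed.

Lemma measurable_obox n (a b : 'rV[R]_n) : measurable (obox a b).
Proof.
rewrite obox_bigcap; apply: fin_bigcap_measurable; first exact: finite_finset.
move=> i _; apply: rV_open_measurable.
by apply: openI; [exact: open_coor_gt|exact: open_coor_lt].
Qed.

(** The first coordinate splits off through [cons_rV] as a factor of the product measure.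
    [Num.max 0] accounts for the boxes with a reversed side, which are empty. *)
Lemma lebesgue_borel_obox n (a b : 'rV[R]_n) : lebesgue_borel R n (obox a b) =
  (\prod_(i < n) Num.max 0 (b 0 i - a 0 i))%:E.
Proof.
elim: n a b => [|n IH] a b.
  by rewrite /= big_ord0 diracE mem_set// => -[].
rewrite big_ord_recl /= /lebesgue_rV_step /pushforward.
rewrite (_ : _ @^-1` _ = `]a 0 ord0, b 0 ord0[%classic `*`
    obox (\row_i a 0 (lift ord0 i)) (\row_i b 0 (lift ord0 i))); last first.
  apply/seteqP; split => [p pab|p [p1 p2] i]; rewrite /=.
    split => /=; first by have := pab ord0; rewrite cons_rV_coor0 in_itv.
    by move=> i; have := pab (lift ord0 i); rewrite cons_rV_coorS !mxE.
  case: (unliftP ord0 i) => [j ->|->].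
    by have := p2 j; rewrite cons_rV_coorS !mxE.
  by rewrite cons_rV_coor0; move: p1; rewrite /= in_itv.
rewrite product_measure1E//; last exact: measurable_obox.
rewrite [X in (_ * X)%E](IH _ _) EFinM; congr (_ * _)%E; last first.
  by congr EFin; apply: eq_bigr => i _; rewrite !mxE.
apply: etrans (lebesgue_measure_itv _) _; rewrite /= lte_fin; case: ltP => ab.
  by rewrite EFinN -EFinD max_r// subr_ge0 ltW.
by rewrite max_l// subr_le0.
Qed.

Lemma oboxI n (a b c d : 'rV[R]_n) : obox a b `&` obox c d =
  obox (\row_i Num.max (a 0 i) (c 0 i)) (\row_i Num.min (b 0 i) (d 0 i)).
Proof.
apply/seteqP; split => [x [xab xcd] i|x H]; rewrite ?mxE.
  by rewrite gt_max lt_min; move: (xab i) (xcd i) => /andP[-> ->] /andP[-> ->].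
by split => i; have := H i; rewrite !mxE gt_max lt_min => /andP[/andP[? ?] /andP[? ?]];
  apply/andP.
Qed.

Definition cube n (k : R) : set 'rV[R]_n := obox (const_mx (- k)) (const_mx k).

Lemma cubeP n (k : R) (x : 'rV[R]_n) : 0 < k -> cube k x <-> `|x| < k.
Proof.
move=> k0; split => [xk|xk i].
  by apply: norm_rV_lt => // i; have := xk i; rewrite !mxE ltr_norml.
by rewrite !mxE -ltr_norml (le_lt_trans (coor_le_norm _ _)).
Qed.

Lemma bigcup_cube n : \bigcup_k cube (n := n) k.+1%:R = setT.
Proof.
apply/seteqP; split => // x _.
exists (Num.truncn `|x|) => //; apply/cubeP; rewrite ?ltr0Sn//.
by rewrite truncnS_gt.
Qed.

Lemma measurable_rV_oboxes n : @measurable _ 'rV[R]_n =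
  <<s [set obox p.1 p.2 | p in [set: 'rV[R]_n * 'rV[R]_n]] >>.
Proof.
apply/seteqP; split; last first.
  apply: smallest_sub; first exact: sigma_algebra_measurable.
  by move=> _ [p _ <-]; exact: measurable_obox.
pose G := [set obox p.1 p.2 | p in [set: 'rV[R]_n * 'rV[R]_n]].
apply: smallest_sub; first exact: smallest_sigma_algebra.
move=> A; rewrite -bigcup_seq/= => -[i _ [B mB <-]]; rewrite setTI.
suff : measurable_fun [set: g_sigma_algebraType G]
    ((fun x : 'rV[R]_n => x 0 i) : _ -> measurableTypeR R).
  by move=> /(_ measurableT B mB); rewrite setTI.
apply: (measurability _ (RGenOInfty.measurableE R)) => //.
move=> _ [_ [c ->] <-]; rewrite setTI.
(* The half-space x_i > c is the union of the boxes with i-th side (c, k) and all other sides (-k,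
   k). *)
rewrite (_ : _ @^-1` _ = \bigcup_k obox
    (\row_j if j == i then c else - k%:R) (const_mx k%:R : 'rV[R]_n)).
  by apply: bigcupT_measurable => k; apply: sub_sigma_algebra; eexists (_, _).
apply/seteqP; split => [x /=|x [k _ /(_ i)] /=]; last first.
  by rewrite !mxE eqxx in_itv/= andbT => /andP[].
rewrite in_itv/= andbT => xc.
exists (Num.truncn `|x|).+1 => // j; have xj := coor_le_norm x j.
have := truncnS_gt `|x|; move: xj; rewrite ler_norml !mxE => /andP[x1 x2] x3.
by case: eqP x1 x2 => [->|_] x1 x2; apply/andP; split => //; lra.
Qed.

(** Boxes are stable under intersection, generate the Borel sets, and the cubes among them exhaust
    the space. Translations, reflections and the displacements along an axis are all treated by
    comparing two measures on boxes. *)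
Lemma rV_measure_unique n (m1 m2 : {measure set 'rV[R]_n -> \bar R}) :
  (forall a b, m1 (obox a b) = m2 (obox a b)) ->
  (forall a b, m1 (obox a b) < +oo)%E ->
  forall A, measurable A -> m1 A = m2 A.
Proof.
move=> m12 m1oo A; apply: (measure_unique _ _ (measurable_rV_oboxes n)).
- by move=> _ _ [p _ <-] [q _ <-]; rewrite oboxI; eexists (_, _).
- by move=> k; exists (const_mx (- k.+1%:R), const_mx k.+1%:R).
- exact: bigcup_cube.
- by move=> _ [p _ <-]; exact: m12.
- by move=> k; exact: m1oo.
Qed.

Lemma lebesgue_borel_obox_lty n (a b : 'rV[R]_n) :
  (lebesgue_borel R n (obox a b) < +oo)%E.
Proof. by rewrite lebesgue_borel_obox ltry. Qed.

End boxes.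

Section invariance.
Context {R : realType} {n : nat}.
Local Notation lam := (lebesgue_borel R n).

Lemma measurable_shift (c : 'rV[R]_n) :
  measurable_fun [set: 'rV[R]_n] (fun x : 'rV[R]_n => x + c).
Proof.
apply: measurable_to_rV => i; apply: rV_continuous_measurable => x.
rewrite (_ : _ \o _ = fun y : 'rV[R]_n => y 0 i + c 0 i); last first.
  by apply/funext => y /=; rewrite mxE.
exact: (cvgD (@continuous_coor R n i x) (cvg_cst _)).
Qed.

Lemma measurable_opp_rV :
  measurable_fun [set: 'rV[R]_n] (fun x : 'rV[R]_n => - x).
Proof.
apply: measurable_to_rV => i; apply: rV_continuous_measurable => x.
rewrite (_ : _ \o _ = fun y : 'rV[R]_n => - (y 0 i)); last first.
  by apply/funext => y /=; rewrite mxE.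
exact: (cvgN (@continuous_coor R n i x)).
Qed.

Lemma lebesgue_borel_shift (c : 'rV[R]_n) (A : set 'rV[R]_n) : measurable A ->
  pushforward lam (fun x => x + c) A = lam A.
Proof.
move=> mA.
pose mu := measure_function_pushforward__canonical__measure_function_Measure
  lam (measurable_shift c).
suff E a b : mu (obox a b) = lam (obox a b).
  apply: (rV_measure_unique (m1 := mu)) => // a b.
  by rewrite E; exact: lebesgue_borel_obox_lty.
rewrite /mu /= /pushforward (_ : _ @^-1` _ = obox (a - c) (b - c)).
  rewrite !lebesgue_borel_obox; congr EFin; apply: eq_bigr => i _.
  by congr Num.max; rewrite !mxE; ring.
by apply/seteqP; split => x H i; have := H i; rewrite !mxE ltrBlDr ltrBrDr.
Qed.

Lemma lebesgue_borel_opp (A : set 'rV[R]_n) : measurable A ->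
  pushforward lam (fun x : 'rV[R]_n => - x) A = lam A.
Proof.
move=> mA.
pose mu := measure_function_pushforward__canonical__measure_function_Measure
  lam measurable_opp_rV.
suff E a b : mu (obox a b) = lam (obox a b).
  apply: (rV_measure_unique (m1 := mu)) => // a b.
  by rewrite E; exact: lebesgue_borel_obox_lty.
rewrite /mu /= /pushforward (_ : _ @^-1` _ = obox (- b) (- a)).
  rewrite !lebesgue_borel_obox; congr EFin; apply: eq_bigr => i _.
  by rewrite !mxE opprK addrC.
by apply/seteqP; split => x H i; have := H i; rewrite !mxE ltrNl ltrNr andbC.
Qed.

Local Open Scope ereal_scope.

Lemma integral_shift (c : 'rV[R]_n) (f : 'rV[R]_n -> \bar R) :
  measurable_fun setT f -> \int[lam]_x f (x + c)%R = \int[lam]_x f x.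
Proof.
move=> mf.
rewrite -(measurable_integral_pushforward (measurable_shift c) lam mf).
apply: eq_measure_integral => [|mphi A mA _]; first exact: measurable_shift.
exact: lebesgue_borel_shift.
Qed.

Lemma integral_opp (f : 'rV[R]_n -> \bar R) :
  measurable_fun setT f -> \int[lam]_x f (- x)%R = \int[lam]_x f x.
Proof.
move=> mf.
rewrite -(measurable_integral_pushforward measurable_opp_rV lam mf).
apply: eq_measure_integral => [|mphi A mA _]; first exact: measurable_opp_rV.
exact: lebesgue_borel_opp.
Qed.

End invariance.

(** * From Lebesgue measurable sets to Borel sets *)

Section completion.
Context {R : realType} {n : nat}.
Local Notation lam := (lebesgue_borel R n).
Local Notation L := (lebesgue R n).
Local Open Scope ereal_scope.

Lemma borel_lebesgue_measurable (A : set 'rV[R]_n) :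
  measurable A -> lebesgue_measurable A.
Proof. by move=> mA; exact: caratheodory_measurable_mu_ext. Qed.

Lemma lebesgue_borelE (A : set 'rV[R]_n) : measurable A -> L A = lam A.
Proof. by move=> mA; exact: measurable_mu_extE. Qed.

Lemma lebesgue_measurable_fun d (T : measurableType d) (f : 'rV[R]_n -> T) :
  measurable_fun setT f ->
  measurable_fun setT (f : lebesgue_type R n -> T).
Proof.
move=> mf _ Y mY; have := mf measurableT Y mY; rewrite !setTI.
exact: borel_lebesgue_measurable.
Qed.

Lemma integral_lebesgue_borel (f : 'rV[R]_n -> \bar R) :
  measurable_fun setT f -> \int[L]_x f x = \int[lam]_x f x.
Proof.
move=> mf.
have mid : measurable_fun [set: lebesgue_type R n]
    (id : lebesgue_type R n -> 'rV[R]_n).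
  exact: (lebesgue_measurable_fun (@measurable_id _ _ setT)).
rewrite -[LHS](measurable_integral_pushforward mid L mf).
by apply: eq_measure_integral => A mA _; exact: lebesgue_borelE.
Qed.

(** The outer measure is an infimum over countable Borel covers; intersecting covers that are
    optimal up to 1/(k+1) gives an optimal one. *)
Lemma outer_borel_cover (E : set 'rV[R]_n) : (mu_ext lam E < +oo) ->
  exists B, [/\ measurable B, E `<=` B & lam B = mu_ext lam E].
Proof.
move=> Eoo.
have Efin : mu_ext lam E \is a fin_num by rewrite ge0_fin_numE// mu_ext_ge0.
have cov (k : nat) : exists B, [/\ measurable B, E `<=` B &
    lam B < mu_ext lam E + (k.+1%:R^-1)%:E].
  have k0 : (0 < k.+1%:R^-1 :> R)%R by rewrite invr_gt0.
  have [_ [A [mA EA] <-] Ak] := lb_ereal_inf_adherent k0 Efin.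
  exists (\bigcup_i A i); split => //; first exact: bigcupT_measurable.
  apply: le_lt_trans Ak; apply: measure_sigma_subadditive => //.
  exact: bigcupT_measurable.
pose C k := sval (cid (cov k)).
have mC k : measurable (C k) by rewrite /C; case: cid => ? [].
have EC k : E `<=` C k by rewrite /C; case: cid => ? [].
have CE k : lam (C k) < mu_ext lam E + (k.+1%:R^-1)%:E.
  by rewrite /C; case: cid => ? [].
exists (\bigcap_k C k); split.
- exact: bigcapT_measurable.
- exact: sub_bigcap.
apply/eqP; rewrite eq_le; apply/andP; split.
  apply/lee_addgt0Pr => e e0.
  have [m _ /(_ _ (leqnn _)) /= mP] := near_infty_natSinv_lt (PosNum e0).
  apply: (@le_trans _ _ (lam (C m))).
    by apply: le_measure; rewrite ?inE//;
      [exact: bigcapT_measurable|exact: bigcap_inf].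
  apply: (@le_trans _ _ (mu_ext lam E + (m.+1%:R^-1)%:E)).
    by rewrite ltW// CE.
  by rewrite leeD2l// lee_fin ltW.
have mB : measurable (\bigcap_k C k) by exact: bigcapT_measurable.
by rewrite -lebesgue_borelE//; apply: le_outer_measure; exact: sub_bigcap.
Qed.

Lemma lebesgue_borel_approx_fin (E : set 'rV[R]_n) : lebesgue_measurable E ->
  L E < +oo ->
  exists B, [/\ measurable B, E `<=` B & L.-negligible (B `\` E)].
Proof.
move=> mE Eoo; have [B [mB EB BE]] := outer_borel_cover Eoo.
exists B; split => //.
have mBl : measurable (B : set (lebesgue_type R n)).
  exact: borel_lebesgue_measurable.
have mD : measurable ((B `\` E) : set (lebesgue_type R n)) by exact: measurableD.
apply/negligibleP => //.
have LB : L B = L E by rewrite lebesgue_borelE.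
have LBoo : L B < +oo by rewrite LB.
transitivity (L B - L (B `&` E)).
  exact: measureD.
by rewrite setIidr// LB subee// ge0_fin_numE.
Qed.

(** Fubini and the measurability of continuous functions live on the Borel product, while perimeters
    are defined with the completed measure; this lemma is the bridge. E is cut by cubes because
    finite measure is needed to subtract L E from L B. *)
Lemma lebesgue_borel_approx (E : set 'rV[R]_n) : lebesgue_measurable E ->
  exists B, [/\ measurable B, E `<=` B & L.-negligible (B `\` E)].
Proof.
move=> mE.
have fin k : exists B, [/\ measurable B, E `&` cube k.+1%:R `<=` B &
    L.-negligible (B `\` (E `&` cube k.+1%:R))].
  have mc : measurable ((cube k.+1%:R) : set (lebesgue_type R n)).
    by apply: borel_lebesgue_measurable; exact: measurable_obox.
  apply: lebesgue_borel_approx_fin; first exact: measurableI.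
  apply: (@le_lt_trans _ _ (L (cube k.+1%:R))).
    by apply: le_measure; rewrite ?inE//; [exact: measurableI].
  rewrite lebesgue_borelE; last exact: measurable_obox.
  exact: lebesgue_borel_obox_lty.
pose C k := sval (cid (fin k)).
exists (\bigcup_k C k); split.
- by apply: bigcupT_measurable => k; rewrite /C; case: cid => ? [].
- move=> x Ex; have : [set: 'rV[R]_n] x by [].
  rewrite -bigcup_cube => -[k _ xk]; exists k => //.
  by rewrite /C; case: cid => /= ? [_ + _]; apply.
apply: (@negligibleS _ _ _ L (\bigcup_k (C k `\` (E `&` cube k.+1%:R)))).
  move=> x [[k _ Ckx] nEx]; exists k => //; split => // -[]//.
apply: negligible_bigcup => k.
by rewrite /C; case: cid => ? [].
Qed.

Lemma ae_eq_restrict (E B : set 'rV[R]_n) (f : 'rV[R]_n -> \bar R) :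
  lebesgue_measurable E -> measurable B -> E `<=` B -> 
  L.-negligible (B `\` E) ->
  measurable_fun setT f -> \int[L]_(x in E) f x = \int[lam]_(x in B) f x.
Proof.
move=> mE mB EB nBE mf.
have mBl : measurable (B : set (lebesgue_type R n)).
  exact: borel_lebesgue_measurable.
have mfl := lebesgue_measurable_fun mf.
have mfB : measurable_fun setT (f \_ B).
  by apply/(measurable_restrictT _ mB); exact: measurable_funTS.
rewrite integral_mkcond [RHS]integral_mkcond -integral_lebesgue_borel//.
have mfE : measurable_fun setT (f \_ E : lebesgue_type R n -> \bar R).
  by apply/(measurable_restrictT _ mE); exact: measurable_funTS.
apply: (ae_eq_integral _ _ measurableT mfE (lebesgue_measurable_fun mfB)).
case: nBE => N [mN N0 BEN]; exists N; split => // x /= /not_implyP[_ xBE].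
apply: BEN; split; apply: contrapT => xB; apply: xBE; rewrite !patchE.
  by rewrite !memNset// => /EB.
by move/contrapT : xB => xE; rewrite !mem_set//; exact: EB.
Qed.

End completion.

(** * Functions of class C^k *)

Section directional.
Context {R : realType} {V : normedModType R}.
Implicit Types (f : V -> R) (y v : V).

Lemma is_derive_line f y v (s d : R) :
  is_derive (y + s *: v) v f d -> is_derive s 1 (fun t => f (y + t *: v)) d.
Proof.
move=> [fd <-]; set g := (fun t => f (y + t *: v)).
have E : (fun h : R => h^-1 *: ((g \o shift s) (h *: (1 : R)) - g s)) =
    (fun h : R => h^-1 *: ((f \o shift (y + s *: v)) (h *: v) - f (y + s *: v))).
  apply/funext => h; rewrite /= /g /shift /=; congr (_ *: (f _ - _)).
  by rewrite [h *: _]mulr1 scalerDl addrCA.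
by apply: DeriveDef; [rewrite /derivable E|rewrite /derive E].
Qed.

(** One form for all signs of [t]: the intermediate point is located only by |c| <= |t|, which is
    all that the estimates use. *)
Lemma mean_value_dir f v (y : V) (t : R) :
  (forall x, derivable f x v) ->
  exists2 c : R, `|c| <= `|t| & f (y + t *: v) - f y = t * 'D_v f (y + c *: v).
Proof.
move=> fv.
have fl (s : R) : is_derive s 1 (fun t => f (y + t *: v)) ('D_v f (y + s *: v)).
  by apply: is_derive_line; exact: derivableP.
have cf a b : {within `[a, b], continuous (fun t : R => f (y + t *: v))}.
  apply: derivable_within_continuous => s _.
  by have := fl s => -[].
have [t0|t0|->] := ltrgt0P t; last first.
- by exists 0; rewrite ?normr0// scale0r addr0 subrr mul0r.
- have [c] := MVT t0 (fun s _ => fl s) (cf _ _).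
  rewrite in_itv/= => /andP[c1 c2]; rewrite scale0r addr0 sub0r => E.
  exists c; first by rewrite ltr0_norm// lerN2 ltW.
  by apply: oppr_inj; rewrite opprB E mulrN mulrC.
have [c] := MVT t0 (fun s _ => fl s) (cf _ _).
rewrite in_itv/= => /andP[c1 c2]; rewrite scale0r addr0 subr0 => E.
by exists c; rewrite 1?mulrC// gtr0_norm// ltW.
Qed.

End directional.

Section continuous_rV.
Context {R : realType} {m : nat}.
Implicit Types f g : 'rV[R]_m -> R.

Lemma rV_contP (V : normedModType R) (f : 'rV[R]_m -> V) :
  continuous f <-> forall x (e : R), 0 < e ->
    exists2 d : R, 0 < d & forall y, `|y - x| < d -> `|f x - f y| < e.
Proof.
split=> [cf x e e0|H x]; have FF : Filter (nbhs x) := nbhs_filter (x : 'rV[R]_m).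
  by have /cvgrPdist_lt/(_ e e0)/near_norm_lt := cf x.
by apply/cvgrPdist_lt => e e0; apply/near_norm_lt; exact: H.
Qed.

Lemma rV_near_forall (I : finType) (P : I -> 'rV[R]_m -> Prop) (x : 'rV[R]_m) :
  (forall i, exists2 d : R, 0 < d & forall y, `|y - x| < d -> P i y) ->
  exists2 d : R, 0 < d & forall y, `|y - x| < d -> forall i, P i y.
Proof.
move=> H; apply/near_norm_lt.
have FF : Filter (nbhs x) := nbhs_filter (x : 'rV[R]_m).
by apply: (@filter_forall _ _ _ _ FF) => i; apply/near_norm_lt; exact: H.
Qed.

Lemma rV_contC (c : R) : continuous (fun _ : 'rV[R]_m => c).
Proof. exact: cst_continuous. Qed.

Lemma rV_contD f g : continuous f -> continuous g ->
  continuous (fun x => f x + g x).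
Proof. by move=> cf cg x; exact: (cvgD (cf x) (cg x)). Qed.

Lemma rV_contN f : continuous f -> continuous (fun x => - f x).
Proof. by move=> cf x; exact: (cvgN (cf x)). Qed.

Lemma rV_contM f g : continuous f -> continuous g ->
  continuous (fun x => f x * g x).
Proof. by move=> cf cg x; exact: (cvgM (cf x) (cg x)). Qed.

Lemma rV_cont_sum (I : Type) (r : seq I) (P : pred I) (F : I -> 'rV[R]_m -> R) :
  (forall i, continuous (F i)) -> continuous (fun x => \sum_(i <- r | P i) F i x).
Proof.
move=> CF; elim: r => [|i r IH].
  by under eq_fun do rewrite big_nil; exact: rV_contC.
under eq_fun do rewrite big_cons.
by case: (P i) => //; exact: rV_contD.
Qed.

Lemma rV_cont_comp (h : R -> R) f : continuous h -> continuous f ->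
  continuous (fun x => h (f x)).
Proof. by move=> ch cf x; exact: (continuous_comp (cf x) (ch (f x))). Qed.

Lemma rV_cont_arg p (T : 'rV[R]_p -> 'rV[R]_m) f : continuous T -> continuous f ->
  continuous (fun x => f (T x)).
Proof. by move=> cT cf x; exact: (continuous_comp (cT x) (cf (T x))). Qed.

Lemma rV_cont_shift (c : 'rV[R]_m) : continuous (fun y : 'rV[R]_m => y + c).
Proof.
apply/rV_contP => x e e0; exists e => // y yx.
by rewrite opprD addrACA subrr addr0 distrC.
Qed.

End continuous_rV.

Section linear_rV.
Context {R : realType} {m : nat}.

Definition lin_rV (a : 'I_m -> R) (h : 'rV[R]_m) : R := \sum_i h 0 i * a i.

Lemma lin_rV_is_linear a : linear (lin_rV a).
Proof.
move=> c x y; rewrite /lin_rV scaler_sumr -big_split /=.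
by apply: eq_bigr => i _; rewrite !mxE mulrDl scalerAl.
Qed.

HB.instance Definition _ a :=
  GRing.isLinear.Build R 'rV[R]_m R _ (lin_rV a) (lin_rV_is_linear a).

Lemma continuous_lin_rV a : continuous (lin_rV a).
Proof.
apply: rV_cont_sum => i; apply: rV_contM; last exact: rV_contC.
exact: continuous_coor.
Qed.

End linear_rV.

Section scalar_Ck.
Context {R : realType} {m : nat}.
Implicit Types (f g : 'rV[R]_m -> R).
Local Notation e_ i := (delta_mx 0 i : 'rV[R]_m).

(** Scalar version of [Ck], on which sums, products and compositions are handled; [Ck_coorP]
    transfers the results to row-valued maps. *)
Fixpoint Cks (k : nat) f : Prop :=
  match k with
  | 0%N => continuous f
  | k'.+1 => continuous f /\
      forall i : 'I_m, (forall x, derivable f x (e_ i)) /\ Cks k' ('D_(e_ i) f)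
  end.

Lemma Cks_continuous k f : Cks k f -> continuous f.
Proof. by case: k => // k []. Qed.

(** Derivatives are supplied here as explicit functions [g], so that the closure properties follow
    by induction from the rules for [is_derive]. *)
Lemma CksSP k f : Cks k.+1 f <-> continuous f /\ forall i,
  exists2 g, (forall x, is_derive x (e_ i) f (g x)) & Cks k g.
Proof.
split=> [[cf H]|[cf H]]; split => // i.
  have [fi Ci] := H i; exists ('D_(e_ i) f) => // x; exact: derivableP.
have [g fg Cg] := H i; split => [x|]; first by have := fg x => -[].
by rewrite (_ : 'D_(e_ i) f = g)//; apply/funext => x; exact: derive_val.
Qed.

Lemma CksW k f : Cks k.+1 f -> Cks k f.
Proof.
elim: k f => [|k IH] f; first by case.
move=> [cf H]; split => // i; have [fi Ci] := H i; split => //; exact: IH.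
Qed.

Lemma CksS1 k f : Cks k.+1 f -> Cks 1 f.
Proof. by elim: k => // k IH /CksW. Qed.

Lemma Cks_derive k f i : Cks k.+1 f -> Cks k ('D_(e_ i) f).
Proof. by move=> [_ /(_ i)[]]. Qed.

Lemma Cks_derivable k f i x : Cks k.+1 f -> derivable f x (e_ i).
Proof. by move=> [_ /(_ i)[]]. Qed.

Lemma Cks_cst k (c : R) : Cks k (cst c).
Proof.
elim: k c => [|k IH] c; first exact: rV_contC.
apply/CksSP; split; first exact: rV_contC.
by move=> i; exists (cst 0) => // x; exact: is_derive_cst.
Qed.

Lemma CksD k f g : Cks k f -> Cks k g -> Cks k (f \+ g).
Proof.
elim: k f g => [|k IH] f g; first exact: rV_contD.
move=> /CksSP[cf Hf] /CksSP[cg Hg]; apply/CksSP; split.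
  exact: rV_contD.
move=> i; have [f' ff' Cf'] := Hf i; have [g' gg' Cg'] := Hg i.
exists (f' \+ g'); last exact: IH.
by move=> x; apply: is_deriveD.
Qed.

Lemma CksM k f g : Cks k f -> Cks k g -> Cks k (f \* g).
Proof.
elim: k f g => [|k IH] f g; first exact: rV_contM.
move=> Cf Cg; have /CksSP[cf Hf] := Cf; have /CksSP[cg Hg] := Cg.
apply/CksSP; split.
  exact: rV_contM.
move=> i; have [f' ff' Cf'] := Hf i; have [g' gg' Cg'] := Hg i.
exists ((f \* g') \+ (g \* f')).
  by move=> x; apply: is_deriveM.
by apply: CksD; apply: IH => //; exact: CksW.
Qed.

Lemma CksZ k (c : R) f : Cks k f -> Cks k (fun x => c * f x).
Proof. exact: CksM (Cks_cst k c). Qed.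

Lemma Cks_sum k (I : Type) (r : seq I) (P : pred I) (F : I -> 'rV[R]_m -> R) :
  (forall i, Cks k (F i)) -> Cks k (fun x => \sum_(i <- r | P i) F i x).
Proof.
move=> CF; elim: r => [|i r IH].
  under eq_fun do rewrite big_nil; exact: Cks_cst.
under eq_fun do rewrite big_cons.
by case: (P i) => //; exact: CksD.
Qed.

Lemma is_derive_coor x (v : 'rV[R]_m) j :
  is_derive x v (fun y : 'rV[R]_m => y 0 j) (v 0 j).
Proof.
have E : (fun h : R => h^-1 *: (((fun y : 'rV[R]_m => y 0 j) \o shift x) (h *: v) - x 0 j))
    @ 0^' --> v 0 j.
  apply/cvgrPdist_lt => e e0; near=> h.
  rewrite /= !mxE addrK [_ *: _]mulrA mulVf ?mul1r ?subrr ?normr0//.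
  by near: h; exact: nbhs_dnbhs_neq.
by apply: DeriveDef; [apply/cvg_ex; eexists; exact: E|exact/cvg_lim].
Unshelve. all: by end_near. Qed.

Lemma Cks_coor k j : Cks k (fun y : 'rV[R]_m => y 0 j).
Proof.
case: k => [|k]; first exact: continuous_coor.
apply/CksSP; split; first exact: continuous_coor.
move=> i; exists (cst ((e_ i) 0 j)); last exact: Cks_cst.
by move=> x; exact: is_derive_coor.
Qed.

Lemma is_derive_shift_arg f (c x v : 'rV[R]_m) d :
  is_derive (x + c) v f d -> is_derive x v (fun y => f (y + c)) d.
Proof.
move=> [fd <-]; set g := (fun y => f (y + c)).
have E : (fun h : R => h^-1 *: ((g \o shift x) (h *: v) - g x)) =
    (fun h : R => h^-1 *: ((f \o shift (x + c)) (h *: v) - f (x + c))).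
  by apply/funext => h; rewrite /= /g /shift /= addrA.
by apply: DeriveDef; [rewrite /derivable E|rewrite /derive E].
Qed.

Lemma continuous_shift_arg f (c : 'rV[R]_m) :
  continuous f -> continuous (fun y : 'rV[R]_m => f (y + c)).
Proof. by move=> cf; apply: (rV_cont_arg _ cf); exact: rV_cont_shift. Qed.

Lemma Cks_shift k f (c : 'rV[R]_m) : Cks k f -> Cks k (fun y : 'rV[R]_m => f (y + c)).
Proof.
elim: k f => [|k IH] f; first exact: continuous_shift_arg.
move=> /CksSP[cf Hf]; apply/CksSP; split; first exact: continuous_shift_arg.
move=> i; have [f' ff' Cf'] := Hf i; exists (fun y => f' (y + c)); last exact: IH.
by move=> x; exact: is_derive_shift_arg.
Qed.

(** Vertices of the staircase from 0 to h along the coordinate directions, used to telescope an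
    increment. *)
Definition trunc_rV (h : 'rV[R]_m) (k : nat) : 'rV[R]_m :=
  \row_i (if (i < k)%N then h 0 i else 0).

Lemma trunc_rVS h (i : 'I_m) : trunc_rV h i.+1 = trunc_rV h i + h 0 i *: e_ i.
Proof.
apply/rowP => j; rewrite !mxE eqxx /= ltnS leq_eqVlt.
have [->|ji] := eqVneq j i; first by rewrite ltnn eqxx mulr1 add0r.
by rewrite val_eqE (negbTE ji) /= mulr0 addr0.
Qed.

(** Along the staircase each coordinate increment is h_i times a partial derivative at a point no
    farther from x than h, and by continuity such derivatives are close to those at x. *)
Lemma C1_diff f (x : 'rV[R]_m) : Cks 1 f ->
  differentiable f x /\ 'd f x = lin_rV (fun i => 'D_(e_ i) f x) :> (_ -> _).
Proof.
move=> Cf.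
pose a := fun i => 'D_(e_ i) f x.
suff E (e : R) : 0 < e -> \forall h \near (0 : 'rV[R]_m),
    `|f (h + x) - (f x + lin_rV a h)| <= e * `|h|.
  have dE : 'd f x = lin_rV a :> (_ -> _).
    by apply: diff_unique; [exact: continuous_lin_rV|apply/eqaddoP].
  split; last exact: dE.
  apply/diff_locallyP; rewrite dE; split; first exact: continuous_lin_rV.
  by apply/eqaddoP.
move=> e0.
(* There are [m] increments, each contributing at most [e'] |h|; [m.+1] also covers m = 0. *)
pose e' := e / m.+1%:R.
have e'0 : 0 < e' by rewrite divr_gt0.
have [r r0 Hr] : exists2 r : R, 0 < r & forall y, `|y - x| < r ->
    forall i, `|'D_(e_ i) f x - 'D_(e_ i) f y| < e'.
  apply: rV_near_forall => i.
  by have /rV_contP := Cks_continuous (Cks_derive i Cf); apply.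
apply/near_norm_lt; exists r => // h; rewrite subr0 => hr.
have fh : f (h + x) - f x =
    \sum_(i < m) (f (x + trunc_rV h i.+1) - f (x + trunc_rV h i)).
  rewrite -(big_mkord xpredT (fun i => f (x + trunc_rV h i.+1) - f (x + trunc_rV h i))).
  rewrite telescope_sumr//.
  have -> : trunc_rV h m = h by apply/rowP => j; rewrite mxE ltn_ord.
  have -> : trunc_rV h 0 = 0 by apply/rowP => j; rewrite !mxE.
  by rewrite addr0 [x + h]addrC.
rewrite opprD addrA [X in X - _]fh /lin_rV -sumrB.
apply: le_trans (ler_norm_sum _ _ _) _.
apply: (@le_trans _ _ (\sum_(i < m) e' * `|h|)).
  apply: ler_sum => i _.
  rewrite trunc_rVS addrA.
  have fd y : derivable f y (e_ i) by exact: Cks_derivable Cf.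
  have [c ch ->] := mean_value_dir (x + trunc_rV h i) (h 0 i) fd.
  rewrite -mulrBr normrM mulrC ler_pM//; last exact: coor_le_norm.
  rewrite distrC ltW//; apply: Hr.
  rewrite -[_ + trunc_rV _ _ + _]addrA addrAC subrr add0r.
  apply: le_lt_trans hr; apply: norm_rV_le => // j.
  rewrite !mxE eqxx /=.
  have [->|ji] := eqVneq j i.
    by rewrite ltnn add0r mulr1 (le_trans ch)// coor_le_norm.
  by rewrite mulr0 addr0; case: ifP => _; rewrite ?normr0// coor_le_norm.
rewrite sumr_const card_ord -mulr_natl mulrA ler_wpM2r// /e'.
rewrite mulrCA -[leRHS]mulr1 ler_wpM2l// ?(ltW e0)// ler_pdivrMr// mul1r.
by rewrite ler_nat.
Qed.

Lemma C1_derivable f x v : Cks 1 f -> derivable f x v.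
Proof. by move=> /(C1_diff x)[/diff_derivable + _]; apply. Qed.

Lemma C1_deriveE f x v : Cks 1 f ->
  'D_v f x = \sum_i v 0 i * 'D_(e_ i) f x.
Proof. by move=> /(C1_diff x)[fx E]; rewrite deriveE// E. Qed.

Lemma Cks_deriv_dir k f v : Cks k.+1 f -> Cks k ('D_v f).
Proof.
move=> Cf; rewrite (_ : 'D_v f = fun x => \sum_i v 0 i * 'D_(e_ i) f x).
  by apply: Cks_sum => i; apply: CksZ; exact: Cks_derive.
by apply/funext => x; apply: C1_deriveE; exact: CksS1 Cf.
Qed.

Definition shear (z : 'rV[R]_m -> R) (v y : 'rV[R]_m) := y + z y *: v.

Lemma is_derive_shear_comp f z v y w : Cks 1 f -> Cks 1 z ->
  is_derive y w (fun y => f (shear z v y))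
    ('D_w f (shear z v y) + 'D_w z y * 'D_v f (shear z v y)).
Proof.
move=> Cf Cz.
have [dz Ez] := C1_diff y Cz; have [df Ef] := C1_diff (shear z v y) Cf.
have dT : differentiable (shear z v) y.
  apply: differentiableD => //.
  exact: differentiableZl.
apply: DeriveDef; first exact: diff_derivable (differentiable_comp dT df).
rewrite deriveE; last exact: (differentiable_comp dT df).
rewrite diff_comp//= -(deriveE w dT).
have -> : 'D_w (shear z v) y = w + 'D_w z y *: v.
  rewrite derive_mx; last exact: diff_derivable.
  apply/rowP => j; rewrite !mxE.
  apply: derive_val.
  rewrite (_ : (fun t => _) = (fun t : 'rV[R]_m => t 0 j) \+ (z \* cst (v 0 j))).
    have h1 := is_derive_coor y w j.
    have h2 : is_derive y w z ('D_w z y).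
      by apply: derivableP; exact: C1_derivable.
    have h3 : is_derive y w (cst (v 0 j)) (0 : R) := is_derive_cst _ _ _.
    apply: is_derive_eq (is_deriveD h1 (is_deriveM h2 h3)) _.
    by rewrite scaler0 add0r [_ *: _]mulrC.
  by apply/funext => t; rewrite /shear !mxE.
by rewrite linearD linearZ/= -!deriveE.
Qed.

Lemma continuous_shear z v : continuous z -> continuous (shear z v).
Proof.
move=> /rV_contP cz; apply/rV_contP => x e e0.
pose e' := e / 2 / (1 + `|v|).
have v0 : 0 < 1 + `|v| by rewrite ltr_pwDl.
have e'0 : 0 < e' by rewrite !divr_gt0.
have [d d0 H] := cz x e' e'0.
exists (Num.min d (e / 2)); first by rewrite lt_min d0 divr_gt0.
move=> y; rewrite lt_min => /andP[yd ye].
rewrite /shear opprD addrACA -scalerBl (le_lt_trans (ler_normD _ _))//.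
rewrite [e]splitr ltr_leD//; first by rewrite distrC.
rewrite normrZ (@le_trans _ _ (e' * (1 + `|v|)))//.
  by rewrite ler_pM// ?ler_wpDl// ltW// H.
by rewrite /e' divfK// gt_eqF.
Qed.

(** A partial derivative of f o shear is a combination of derivatives of f, of one order less, again
    composed with the same shear. The induction therefore closes without a chain rule of order k. *)
Lemma Cks_shear_comp k f z v : (forall k, Cks k z) -> Cks k f ->
  Cks k (fun y => f (shear z v y)).
Proof.
move=> Cz; elim: k f => [|k IH] f Cf.
  by apply: rV_cont_arg => //; apply: continuous_shear; exact: (Cz 0%N).
apply/CksSP; split.
  apply: rV_cont_arg; last exact: (Cks_continuous Cf).
  by apply: continuous_shear; exact: (Cz 0%N).
move=> i; eexists.
  by move=> x; apply: is_derive_shear_comp; [exact: CksS1 Cf|exact: (Cz 1%N)].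
apply: CksD; first exact: IH (Cks_deriv_dir _ Cf).
by apply: CksM; [exact: Cks_deriv_dir|exact: IH (Cks_deriv_dir _ Cf)].
Qed.

End scalar_Ck.

Section Ck_coordinates.
Context {R : realType} {m n : nat}.
Implicit Types f : 'rV[R]_m -> 'rV[R]_n.

Lemma continuous_rVP (f : 'rV[R]_m -> 'rV[R]_n) :
  continuous f <-> forall j, continuous (fun x => f x 0 j).
Proof.
split=> [cf j x|cf].
  exact: (continuous_comp (cf x) (@continuous_coor R n j (f x))).
apply/rV_contP => x e e0.
have [d d0 H] := @rV_near_forall R m 'I_n
  (fun j y => `|f x 0 j - f y 0 j| < e) x (fun j => (rV_contP _).1 (cf j) x e e0).
exists d => // y yx; apply: norm_rV_lt => // j.
by rewrite !mxE; exact: H.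
Qed.

Lemma Ck_coorP k f : Ck k f <-> forall j, Cks k (fun x => f x 0 j).
Proof.
elim: k f => [|k IH] f /=; first exact: continuous_rVP.
split=> [[cf H] j|H].
  split; first by move/continuous_rVP : cf.
  move=> i; have [fi /IH Hi] := H i; split.
    by move=> x; have /derivable_mxP/(_ 0 j) := fi x.
  rewrite (_ : 'D_ _ _ = fun x => ('D_(delta_mx 0 i) f x) 0 j)//.
  by apply/funext => x; rewrite derive_mx// mxE.
split; first by apply/continuous_rVP => j; have [] := H j.
move=> i.
have fi x : derivable f x (delta_mx 0 i).
  apply/derivable_mxP => a j; rewrite (ord1 a).
  by have [_ /(_ i)[+ _]] := H j; apply.
split => //; apply/IH => j.
rewrite (_ : (fun x => _) = 'D_(delta_mx 0 i) (fun x => f x 0 j)).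
  by have [_ /(_ i)[_ +]] := H j; apply.
by apply/funext => x; rewrite derive_mx// mxE.
Qed.

Lemma smooth_coorP f : smooth f <-> forall j k, Cks k (fun x => f x 0 j).
Proof.
split=> [H j k|H k]; first by have /Ck_coorP := H k.
by apply/Ck_coorP => j.
Qed.

End Ck_coordinates.

(** * Integrals of compactly supported functions *)

Section Rintegral_facts.
Context d (T : measurableType d) (R : realType) (mu : {measure set T -> \bar R}).

Lemma EFin_Rintegral (D : set T) (f : T -> R) : measurable D ->
  mu.-integrable D (EFin \o f) ->
  (\int[mu]_(x in D) (f x)%:E)%E = (\int[mu]_(x in D) f x)%:E.
Proof. by move=> mD fi; rewrite /Rintegral fineK//; exact: integrable_fin_num. Qed.

Lemma Rintegral_le_abs (f g : T -> R) :
  mu.-integrable setT (EFin \o f) -> mu.-integrable setT (EFin \o g) ->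
  (forall x, `|f x| <= g x) -> `|\int[mu]_x f x| <= \int[mu]_x g x.
Proof.
move=> fi gi fg; apply: le_trans (le_normr_Rintegral _ fi) _ => //.
apply: le_Rintegral => //; exact: integrable_norm.
Qed.

Lemma Rintegral_dominated (q : nat -> T -> R) (f g : T -> R) :
  (forall k, measurable_fun setT (q k)) -> measurable_fun setT f ->
  (forall x, q k x @[k --> \oo] --> f x) ->
  mu.-integrable setT (EFin \o g) -> (forall k x, `|q k x| <= g x) ->
  mu.-integrable setT (EFin \o f) /\
  (\int[mu]_x q k x) @[k --> \oo] --> \int[mu]_x f x.
Proof.
move=> mq mf qf gi qg.
have qi k : mu.-integrable setT (EFin \o q k).
  apply: le_integrable gi => //; first exact/measurable_EFinP.
  by move=> x _ /=; rewrite lee_fin (le_trans (qg k x))// ler_norm.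
have [] := @dominated_convergence _ _ _ mu setT measurableT
  (fun k => EFin \o q k) (EFin \o f) (EFin \o g).
- by move=> k; exact/measurable_EFinP.
- exact/measurable_EFinP.
- by apply: aeW => x _; apply/cvg_EFin; [exact: nearW|exact: qf].
- by [].
- by apply: aeW => x k _ /=; rewrite lee_fin.
move=> fi _ H; split => //.
have : (fine (\int[mu]_x (q k x)%:E)%E) @[k --> \oo] --> fine (\int[mu]_x (f x)%:E)%E.
  by apply: fine_cvg; rewrite fineK; [exact: H|exact: integrable_fin_num].
exact.
Qed.

End Rintegral_facts.

Section bounded_support.
Context {R : realType} {n : nat}.
Local Notation lam := (lebesgue_borel R n).
Implicit Types (f : 'rV[R]_n -> R) (M C : R).

Definition bsupp M f := forall x, M <= `|x| -> f x = 0.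

Lemma closed_norm_le M : closed [set x : 'rV[R]_n | `|x| <= M].
Proof.
rewrite (_ : [set _ | _] = (fun x : 'rV[R]_n => `|x|) @^-1` [set t | t <= M])//.
by apply: closed_comp; [move=> x _; exact: norm_continuous|exact: closed_le].
Qed.

Lemma compact_norm_le M : compact [set x : 'rV[R]_n | `|x| <= M].
Proof.
apply: bounded_closed_compact; last exact: closed_norm_le.
exists M; split; first exact: num_real.
by move=> t Mt x /= /le_trans; apply; exact: ltW.
Qed.

Lemma bsupp_bounded M f : continuous f -> bsupp M f ->
  exists2 C : R, 0 <= C & forall x, `|f x| <= C.
Proof.
move=> cf Hf.
have : compact (f @` [set x | `|x| <= M]).
  apply: continuous_compact; last exact: compact_norm_le.
  exact: continuous_subspaceT.
move=> /compact_bounded[C [_ HC]].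
exists (Num.max 0 (C + 1)); first by rewrite le_max lexx.
move=> x; have [xM|Mx] := leP `|x| M; last by rewrite Hf ?(ltW Mx)// normr0 le_max lexx.
rewrite le_max; apply/orP; right.
by apply: (HC (C + 1)); [rewrite ltrDl|exists x].
Qed.

Lemma cube_lty (k : R) : (lam (cube k) < +oo)%E.
Proof. exact: lebesgue_borel_obox_lty. Qed.

Lemma bsupp_integrable M C f :
  measurable_fun setT f -> (forall x, `|f x| <= C) -> bsupp M f ->
  lam.-integrable setT (EFin \o f).
Proof.
move=> mf fC Hf; pose k := Num.max 1 M.
have k0 : 0 < k by rewrite lt_max ltr01.
have mc : measurable (cube k : set 'rV[R]_n) by exact: measurable_obox.
have fE : EFin \o f = (EFin \o f) \_ (cube k).
  apply/funext => x; rewrite patchE; case: ifPn => // /negP xk /=.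
  rewrite Hf//; rewrite leNgt; apply/negP => xM; apply: xk; apply/mem_set.
  by apply/cubeP => //; rewrite lt_max xM orbT.
rewrite fE; apply/(integrable_mkcond _ mc).
apply: measurable_bounded_integrable => //.
- exact: cube_lty.
- exact: measurable_funTS.
exists C; split; first exact: num_real.
by move=> t Ct x _ /=; rewrite (le_trans (fC x))// ltW.
Qed.

Lemma cc_integrable M f : continuous f -> bsupp M f ->
  lam.-integrable setT (EFin \o f).
Proof.
move=> cf Hf; have [C _ HC] := bsupp_bounded cf Hf.
by apply: bsupp_integrable HC Hf; exact: rV_continuous_measurable.
Qed.

Lemma bsupp_derive0 M f v x : bsupp M f -> M < `|x| -> 'D_v f x = 0.
Proof.
move=> Hf Mx; rewrite (@near_eq_derive _ _ _ f (cst 0)) ?derive_cst//.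
apply/near_norm_lt; exists (`|x| - M); first by rewrite subr_gt0.
move=> y yx; apply: Hf.
have : `|x| <= `|y| + `|y - x|.
  by rewrite -lerBlDl distrC lerB_dist.
lra.
Qed.

Lemma bsupp_derive M f v : bsupp M f -> bsupp (M + 1) ('D_v f).
Proof. by move=> Hf x Mx; apply: (bsupp_derive0 _ Hf); rewrite (lt_le_trans _ Mx)// ltrDl. Qed.

Lemma measurable_EFin_cont f : continuous f -> measurable_fun setT (EFin \o f).
Proof.
by move=> cf; apply/measurable_EFinP; exact: rV_continuous_measurable.
Qed.

Lemma Rintegral_shift (c : 'rV[R]_n) f : measurable_fun setT f ->
  \int[lam]_x f (x + c) = \int[lam]_x f x.
Proof.
move=> mf; rewrite /Rintegral.
by rewrite (integral_shift c (f := EFin \o f))//; exact/measurable_EFinP.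
Qed.

Lemma Rintegral_opp f : measurable_fun setT f ->
  \int[lam]_x f (- x) = \int[lam]_x f x.
Proof.
move=> mf; rewrite /Rintegral.
by rewrite (integral_opp (f := EFin \o f))//; exact/measurable_EFinP.
Qed.

Lemma derive_seq_cvg f v x : derivable f x v ->
  (k.+1%:R * (f (x + k.+1%:R^-1 *: v) - f x) : R) @[k --> \oo] --> 'D_v f x.
Proof.
move=> fd; apply/cvgrPdist_lt => e e0.
have /cvgrPdist_lt/(_ e e0) : h^-1 *: ((f \o shift x) (h *: v) - f x) @[h --> 0^'] --> 'D_v f x.
  exact: fd.
move=> [d /= d0 Hd]; near=> k.
have := Hd k.+1%:R^-1; rewrite /= invrK /shift/= [_ + x]addrC; apply.
  rewrite /ball_ /= sub0r normrN gtr0_norm ?invr_gt0//.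
  by near: k; apply: (near_infty_natSinv_lt (PosNum d0)).
by rewrite gt_eqF// invr_gt0.
Unshelve. all: by end_near. Qed.

(** By translation invariance every difference quotient has integral 0. The quotients converge to
    the derivative and, by the mean value theorem, are dominated by a multiple of the indicator of a
    cube. *)
Lemma integral_derive0 M f v : continuous f -> (forall x, derivable f x v) ->
  continuous ('D_v f) -> bsupp M f -> \int[lam]_x 'D_v f x = 0.
Proof.
move=> cf fd cD Hf.
have [C C0 HC] := bsupp_bounded cD (bsupp_derive v Hf).
(* The steps 1/(k+1) are at most 1, so the translated supports stay within this radius for all k. *)
pose M' := M + 1 + `|v|.
pose q (k : nat) x := k.+1%:R * (f (x + k.+1%:R^-1 *: v) - f x).
have cq k : continuous (q k).
  apply: rV_contM; first exact: rV_contC.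
  apply: rV_contD; last exact: rV_contN.
  by apply: continuous_shift_arg.
have k1 (k : nat) : 0 < (k.+1%:R^-1 : R) <= 1.
  by rewrite invr_gt0 ltr0Sn/= invf_le1// ler1n.
have qC k x : `|q k x| <= C.
  rewrite /q; have [c _ ->] := mean_value_dir x k.+1%:R^-1 fd.
  by rewrite mulrA divff ?mul1r.
have qM k : bsupp M' (q k).
  move=> x Mx; rewrite /q !Hf ?subrr ?mulr0//.
    by rewrite (le_trans _ Mx)// /M' -addrA lerDl addr_ge0.
  have : `|x| <= `|x + k.+1%:R^-1 *: v| + `|k.+1%:R^-1 *: v|.
    by rewrite -lerBlDl (le_trans (lerB_dist _ _))// opprD addNKr normrN.
  have : `|k.+1%:R^-1 *: v| <= `|v|.
    by rewrite normrZ gtr0_norm ?invr_gt0// ler_piMl//; case/andP: (k1 k).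
  by move: Mx; rewrite /M'; lra.
have q0 k : \int[lam]_x q k x = 0.
  have fi : lam.-integrable setT (EFin \o f) by exact: cc_integrable Hf.
  have fsi : lam.-integrable setT (EFin \o (fun x => f (x + k.+1%:R^-1 *: v))).
    apply: (@cc_integrable M'); first exact: continuous_shift_arg.
    move=> x Mx; apply/eqP; have := qM k x Mx; rewrite /q => /eqP.
    rewrite mulf_eq0 pnatr_eq0/= subr_eq0 => /eqP ->; apply/eqP; apply: Hf.
    by rewrite (le_trans _ Mx)// /M' -addrA lerDl addr_ge0.
  rewrite /q RintegralZl//; last first.
    by apply: (@integrableB _ _ _ _ _ measurableT (EFin \o _) (EFin \o f)).
  rewrite RintegralB// Rintegral_shift ?subrr ?mulr0//.
  exact: rV_continuous_measurable.
have M'0 : 0 < Num.max M' 0 + 1 by rewrite ltr_wpDl// le_max lexx orbT.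
pose g : 'rV[R]_n -> R := fun x => C * \1_(cube (Num.max M' 0 + 1)) x.
have gi : lam.-integrable setT (EFin \o g).
  apply: (@bsupp_integrable (Num.max M' 0 + 1) C).
  - by apply: measurable_funM => //; apply: measurable_indic; exact: measurable_obox.
  - move=> x; rewrite /g normrM (ger0_norm C0) ler_piMr// indicE.
    by case: (_ \in _); rewrite ?normr1 ?normr0.
  move=> x Mx; rewrite /g indicE memNset ?mulr0// => /cubeP -/(_ M'0).
  by rewrite ltNge Mx.
have qg k x : `|q k x| <= g x.
  rewrite /g indicE; case: (boolP (x \in _)) => [_|]; first by rewrite mulr1.
  move=> /negP xM; rewrite qM ?normr0 ?mulr0// leNgt; apply/negP => xM'; apply: xM.
  apply/mem_set/cubeP => //; rewrite (lt_le_trans xM')//.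
  by rewrite (@le_trans _ _ (Num.max M' 0)) ?le_max ?lexx// lerDl.
have [_] := Rintegral_dominated (fun k => rV_continuous_measurable (cq k))
  (rV_continuous_measurable cD) (fun x => derive_seq_cvg (fd x)) gi qg.
under eq_fun do rewrite q0.
by move=> H; have <- := cvg_lim (@Rhausdorff R) H; rewrite lim_cst.
Qed.

End bounded_support.

(** * Power integrals and the Gamma function *)

Section lebesgue_scaling.
Context {R : realType}.
Local Notation leb := (@lebesgue_measure R).

Lemma measurable_scale (c : R) :
  measurable_fun [set: measurableTypeR R] (fun t : measurableTypeR R => c * t : measurableTypeR R).
Proof. by apply: measurable_funM => //; exact: measurable_cst. Qed.

Local Open Scope ereal_scope.

(** The pushforward of Lebesgue measure by t -> c t, multiplied by c, agrees with Lebesgue measure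
    on half-open intervals, hence on Borel sets. *)
Lemma ge0_integral_scale (c : R) (f : R -> \bar R) : (0 < c)%R ->
  measurable_fun setT (f : measurableTypeR R -> _) -> (forall t, 0 <= f t) ->
  \int[leb]_t f (c * t)%R = c^-1%:E * \int[leb]_t f t.
Proof.
move=> c0 mf f0.
pose pf := measure_function_pushforward__canonical__measure_function_Measure
  leb (measurable_scale c).
have ci0 : (0 <= c)%R by exact: ltW.
pose mu : {measure set (measurableTypeR R) -> \bar R} := mscale (NngNum ci0) pf.
have muE A : measurable A -> leb A = mu A.
  apply: (lebesgue_measure_unique (mu := mu)) => _ [[a b] _ <-] /=.
  rewrite /mscale /= /pushforward.
  rewrite (_ : _ @^-1` _ = `]c^-1 * a, c^-1 * b]%classic)%R; last first.
    apply/seteqP; split => t; rewrite /= !in_itv/=.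
      by rewrite ltr_pdivrMl// ler_pdivlMl.
    by rewrite ltr_pdivrMl// ler_pdivlMl.
  rewrite [LHS](lebesgue_measure_itv `]a, b]) [in RHS](lebesgue_measure_itv `]c^-1 * a, c^-1 * b]%R)/=.
  rewrite !lte_fin ltr_pM2l ?invr_gt0//; case: ifPn => _; last by rewrite mule0.
  by rewrite -!EFinB -EFinM -mulrBr mulrA divff ?gt_eqF// mul1r.
rewrite -[LHS](ge0_integral_pushforward (measurable_scale c) leb measurableT mf)//.
have -> : \int[leb]_t f t = \int[mu]_t f t.
  by apply: eq_measure_integral => A mA _; exact: muE.
rewrite /mu ge0_integral_mscale// muleA -EFinM mulVf ?gt_eqF// mul1e.
by [].
Qed.

End lebesgue_scaling.

Section power_integrals.
Context {R : realType}.
Local Notation leb := (@lebesgue_measure R).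

Lemma powRD_gt0 (x r s : R) : 0 < x -> x `^ (r + s) = x `^ r * x `^ s.
Proof. by move=> x0; rewrite powRD// (gt_eqF x0) implybT. Qed.

Lemma integral_powR_itv (b x y : R) : b != 0 -> 0 < x -> x < y ->
  (\int[leb]_(t in `[x, y]) (t `^ (b - 1))%:E)%E = ((y `^ b - x `^ b) / b)%:E.
Proof.
move=> b0 x0 xy.
pose F t : R := b^-1 * t `^ b.
have dF (t : R) : 0 < t -> is_derive t 1 F (t `^ (b - 1)).
  move=> t0; have := is_deriveZ b^-1 (is_derive1_powR b t0).
  move=> H; apply: is_derive_eq H _.
  by rewrite [_ *: _]mulrA mulVf// mul1r.
have cF (t : R) : 0 < t -> {for t, continuous F}.
  move=> t0; apply: differentiable_continuous; apply/derivable1_diffP.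
  by have [] := dF _ t0.
have y0 := lt_trans x0 xy.
rewrite (continuous_FTC2 (F := F) xy).
- by rewrite -EFinB -mulrBr mulrC.
- apply: derivable_within_continuous => t; rewrite in_itv/= => /andP[xt _].
  by have [] := is_derive1_powR (b - 1) (lt_le_trans x0 xt).
- split => /=.
  + move=> t; rewrite in_itv/= => /andP[xt _].
    by have [] := dF _ (lt_trans x0 xt).
  + by apply: cvg_at_right_filter; exact: cF.
  + by apply: cvg_at_left_filter; exact: cF.
- move=> t; rewrite in_itv/= => /andP[xt _]; rewrite derive1E.
  by apply: derive_val; exact: dF (lt_trans x0 xt).
Qed.

Lemma measurable_powR_E (p : R) (D : set R) : measurable_fun D (fun t : R => (t `^ p)%:E).
Proof. by apply/measurable_EFinP; apply: measurable_funTS; exact: measurable_powR. Qed.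

Lemma natSV_powR_cvg0 (b : R) : 0 < b -> (k.+2%:R^-1 `^ b : R) @[k --> \oo] --> 0.
Proof.
move=> b0.
apply: ((cvg_at_rightP (fun a : R => a `^ b) 0 0).1 (powR_cvg0 b0)); split.
  by move=> k; rewrite invr_gt0.
by have H := @cvg_harmonic R; rewrite -cvg_shiftS in H; exact: H.
Qed.

Lemma natSV_powR_lim (b : R) : 0 < b ->
  ((1 - k.+2%:R^-1 `^ b) / b : R) @[k --> \oo] --> b^-1.
Proof.
move=> b0; have := cvgM (cvgB (cvg_cst (1 : R)) (natSV_powR_cvg0 b0)) (cvg_cst b^-1).
by rewrite subr0 mul1r => H; apply: H.
Qed.

Lemma natSV2_lt1 (k : nat) : 0 < (k.+2%:R^-1 : R) < 1.
Proof. by rewrite invr_gt0 ltr0Sn/= invf_lt1// ltr1n. Qed.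

Lemma integral_powR01 (b : R) : 0 < b ->
  (\int[leb]_(t in `]0%R, 1%R]) (t `^ (b - 1))%:E)%E = (b^-1)%:E.
Proof.
(* Starting at 1/(k+2) keeps the left endpoint strictly below 1 for k = 0 too, as
   [integral_powR_itv] demands. *)
move=> b0; pose F (k : nat) : set R := `[k.+2%:R^-1, 1]%classic.
have FU : `]0, 1]%classic = \bigcup_k F k.
  apply/seteqP; split => t.
    rewrite /= in_itv/= => /andP[t0 t1].
    have [m _ /(_ _ (leqnn _)) /= mP] := near_infty_natSinv_lt (PosNum t0).
    exists m => //; rewrite /F/= in_itv/= t1 andbT (le_trans _ (ltW mP))//.
    by rewrite lef_pV2 ?posrE// ler_nat.
  move=> [k _]; rewrite /F /= !in_itv/= => /andP[kt ->]; rewrite andbT.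
  by apply: lt_le_trans kt; have /andP[] := natSV2_lt1 k.
have := @ge0_nondecreasing_set_cvg_integral _ (measurableTypeR R) R F (fun t => (t `^ (b - 1))%:E) leb.
rewrite -FU => H.
have {}H : (\int[leb]_(x in F i) (x `^ (b - 1))%:E)%E @[i --> \oo] -->
    (\int[leb]_(t in `]0%R, 1%R]) (t `^ (b - 1))%:E)%E.
  apply: H.
  - apply/nondecreasing_seqP => k; apply/subsetPset => t; rewrite /F /= !in_itv/=.
    move=> /andP[kt ->]; rewrite andbT (le_trans _ kt)//.
    by rewrite lef_pV2 ?posrE// ler_nat.
  - by move=> k; exact: measurable_itv.
  - by move=> k; exact: measurable_powR_E.
  - by move=> k t _; rewrite lee_fin powR_ge0.
have E : (fun k => (\int[leb]_(x in F k) (x `^ (b - 1))%:E)%E) =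
    EFin \o (fun k : nat => (1 - k.+2%:R^-1 `^ b) / b).
  apply/funext => k /=; have /andP[k0 k1] := natSV2_lt1 k.
  by rewrite integral_powR_itv ?gt_eqF// powR1.
rewrite E in H.
rewrite -(cvg_lim _ H)//; apply: cvg_lim => //; apply/cvg_EFin; first exact: nearW.
exact: natSV_powR_lim.
Qed.

Lemma integral_powR1y (b : R) : 0 < b ->
  (\int[leb]_(t in `]1%R, +oo[) (t `^ (- b - 1))%:E)%E = (b^-1)%:E.
Proof.
move=> b0; rewrite integral_itv_obnd_cbnd; last first.
  exact: measurable_powR_E.
pose F (k : nat) : set R := `[1, k.+2%:R]%classic.
have FU : `[1, +oo[%classic = \bigcup_k F k.
  apply/seteqP; split => t.
    rewrite /= in_itv/= andbT => t1; exists (Num.truncn t) => //.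
    rewrite /F /= in_itv/= t1 ltW// (lt_trans (truncnS_gt t))// ltr_nat//.
  by move=> [k _]; rewrite /F /= !in_itv/= => /andP[->].
have := @ge0_nondecreasing_set_cvg_integral _ (measurableTypeR R) R F (fun t => (t `^ (- b - 1))%:E) leb.
rewrite -FU => H.
have {}H : (\int[leb]_(x in F i) (x `^ (- b - 1))%:E)%E @[i --> \oo] -->
    (\int[leb]_(t in `[1%R, +oo[) (t `^ (- b - 1))%:E)%E.
  apply: H.
  - apply/nondecreasing_seqP => k; apply/subsetPset => t; rewrite /F /= !in_itv/=.
    by move=> /andP[-> kt] /=; rewrite (le_trans kt)// ler_nat.
  - by move=> k; exact: measurable_itv.
  - by move=> k; exact: measurable_powR_E.
  - by move=> k t _; rewrite lee_fin powR_ge0.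
have E : (fun k => (\int[leb]_(x in F k) (x `^ (- b - 1))%:E)%E) =
    EFin \o (fun k : nat => (1 - k.+2%:R^-1 `^ b) / b).
  apply/funext => k /=.
  rewrite integral_powR_itv ?oppr_eq0 ?gt_eqF// ?ltr1n//.
  congr EFin; rewrite powR1 invrN mulrN -mulNr opprB; congr ((_ - _) / _).
  by rewrite -powR_inv1// -powRrM mulN1r.
rewrite E in H.
rewrite -(cvg_lim _ H)//; apply: cvg_lim => //; apply/cvg_EFin; first exact: nearW.
exact: natSV_powR_lim.
Qed.

Lemma itv0y_split (f : R -> \bar R) : measurable_fun setT f -> (forall t, (0 <= f t)%E) ->
  (\int[leb]_(t in `]0%R, +oo[) f t = \int[leb]_(t in `]0%R, 1%R]) f t +
   \int[leb]_(t in `]1%R, +oo[) f t)%E.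
Proof.
move=> mf f0.
have E : `]0%R, +oo[%classic = `]0, 1]%classic `|` `]1, +oo[%classic :> set R.
  by rewrite -itv_bndbnd_setU// bnd_simp.
rewrite E ge0_integral_setU//; first exact: measurable_funTS.
apply/disj_setPLR => t; rewrite /= !in_itv/= => /andP[_ t1].
by rewrite andbT ltNge t1.
Qed.

End power_integrals.

Section gamma.
Context {R : realType}.
Local Notation leb := (@lebesgue_measure R).

Lemma expR_ge_pow (t : R) (m : nat) : 0 <= t -> t ^+ m <= m`!%:R * expR t.
Proof.
move=> t0; case: m => [|m]; first by rewrite expr0 fact0 mul1r -expR0 ler_expR.
have := expR_ge1Dxn m t0; have m0 : 0 < (m.+1)`!%:R :> R by rewrite ltr0n fact_gt0.
move=> H; rewrite mulrC -ler_pdivrMr//; lra.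
Qed.

Definition gamma_fun (b t : R) : R := t `^ (b - 1) * expR (- t).

Lemma measurable_gamma_fun b : measurable_fun setT (gamma_fun b).
Proof.
apply: measurable_funM; first exact: measurable_powR.
by apply: measurableT_comp => //; exact: measurable_funN.
Qed.

Lemma gamma_fun_ge0 b t : 0 <= gamma_fun b t.
Proof. by rewrite mulr_ge0// ?powR_ge0// expR_ge0. Qed.

Lemma measurable_gamma_funE b (D : set R) :
  measurable_fun D (fun t => (gamma_fun b t)%:E).
Proof.
by apply/measurable_EFinP; apply: measurable_funTS; exact: measurable_gamma_fun.
Qed.

Lemma integral_gamma01_le (b : R) : 0 < b ->
  (\int[leb]_(t in `]0%R, 1%R]) (gamma_fun b t)%:E <= (b^-1)%:E)%E.
Proof.
move=> b0; rewrite -integral_powR01//; apply: ge0_le_integral => //.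
- by move=> t _; rewrite lee_fin gamma_fun_ge0.
- exact: measurable_gamma_funE.
- exact: measurable_powR_E.
move=> t; rewrite /= in_itv/= => /andP[t0 _]; rewrite lee_fin ler_piMr ?powR_ge0//.
by rewrite -expR0 ler_expR oppr_le0 ltW.
Qed.

(** From exp(-t) >= 1 - t, the second term integrating t^b. That term is moved to the other side so
    that all integrands stay nonnegative. *)
Lemma integral_gamma01_ge (b : R) : 0 < b ->
  ((b^-1 - (b + 1)^-1)%:E <= \int[leb]_(t in `]0%R, 1%R]) (gamma_fun b t)%:E)%E.
Proof.
move=> b0; have b10 : 0 < b + 1 by rewrite addr_gt0.
rewrite EFinB leeBlDr// -integral_powR01// -[X in (_ + X)%E]integral_powR01//.
rewrite -ge0_integralD//; last 4 first.
- by move=> t _; rewrite lee_fin gamma_fun_ge0.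
- exact: measurable_gamma_funE.
- by move=> t _; rewrite lee_fin powR_ge0.
- exact: measurable_powR_E.
apply: ge0_le_integral => //.
- by move=> t _; rewrite lee_fin powR_ge0.
- exact: measurable_powR_E.
- by apply: emeasurable_funD; [exact: measurable_gamma_funE|exact: measurable_powR_E].
move=> t; rewrite /= in_itv/= => /andP[t0 _]; rewrite -EFinD lee_fin /gamma_fun.
have -> : t `^ (b + 1 - 1) = t `^ (b - 1) * t.
  by rewrite addrK -[X in _ `^ X = _](subrK 1 b) (powRD_gt0 (b - 1) 1 t0) powRr1// ltW.
rewrite -mulrDr ler_peMr ?powR_ge0//.
have := expR_ge1Dx (- t); lra.
Qed.

(** Since t^m exp(-t) <= m! and b - 1 <= m - 2, the integrand is at most m! t^(-2), whose integral
    over ]1, +oo[ is 1. *)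
Lemma integral_gamma1y_le (b : R) (m : nat) : b + 1 <= m%:R ->
  (\int[leb]_(t in `]1%R, +oo[) (gamma_fun b t)%:E <= (m`!%:R)%:E)%E.
Proof.
move=> bm; have -> : (m`!%:R)%:E = (m`!%:R%:E *
    \int[leb]_(t in `]1%R, +oo[) (t `^ (- 1 - 1))%:E)%E :> \bar R.
  by rewrite integral_powR1y// invr1 mule1.
rewrite -ge0_integralZl_EFin//; last 2 first.
- by move=> t _; rewrite lee_fin powR_ge0.
- exact: measurable_powR_E.
apply: ge0_le_integral => //.
- by move=> t _; rewrite lee_fin gamma_fun_ge0.
- exact: measurable_gamma_funE.
- by apply: measurable_funeM; exact: measurable_powR_E.
move=> t; rewrite /= in_itv/= andbT => t1; rewrite -EFinM lee_fin /gamma_fun.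
have t0 : 0 < t by rewrite (lt_trans ltr01).
rewrite expRN ler_pdivrMr ?expR_gt0// mulrAC.
apply: (@le_trans _ _ (t ^+ m * t `^ (-1 - 1))).
  rewrite -powR_mulrn ?(ltW t0)// -powRD_gt0//.
  rewrite ler_powR ?(ltW t1)//; lra.
by rewrite ler_wpM2r ?powR_ge0// expR_ge_pow// ltW.
Qed.

Lemma Gamma_integral (b : R) : 0 < b ->
  (\int[leb]_(t in `]0%R, +oo[) (gamma_fun b t)%:E)%E = (Gamma b)%:E.
Proof.
move=> b0; rewrite /Gamma /Rintegral fineK//.
have f0 (t : R) : (0 <= (gamma_fun b t)%:E)%E by rewrite lee_fin gamma_fun_ge0.
rewrite ge0_fin_numE; last by apply: integral_ge0 => t _; exact: f0.
rewrite itv0y_split//; last exact: measurable_gamma_funE.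
rewrite lte_add_pinfty//.
  exact: le_lt_trans (integral_gamma01_le b0) (ltry _).
have bm : b + 1 <= (Num.truncn (b + 1)).+1%:R by rewrite ltW// truncnS_gt.
exact: le_lt_trans (integral_gamma1y_le bm) (ltry _).
Qed.

Lemma Gamma_gt0 (b : R) : 0 < b -> 0 < Gamma b.
Proof.
move=> b0; rewrite -lte_fin -Gamma_integral// itv0y_split; last 2 first.
- exact: measurable_gamma_funE.
- by move=> t; rewrite lee_fin gamma_fun_ge0.
rewrite (@lt_le_trans _ _ ((b^-1 - (b + 1)^-1)%:E + 0)%E)//.
  rewrite adde0 lte_fin subr_gt0 ltf_pV2 ?posrE ?ltrDl// addr_gt0//.
by apply: leeD; [exact: integral_gamma01_ge|apply: integral_ge0 => t _; rewrite lee_fin gamma_fun_ge0].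
Qed.

(** Quantitative form of a Gamma(a) -> 1. Splitting the integral at 1 gives 1/a - 1/(a+1) <=
    Gamma(a) <= 1/a + 2, where 2 is 2! from [integral_gamma1y_le] with m = 2, admissible because a
    <= 1. *)
Lemma Gamma_near0 (a : R) : 0 < a -> a <= 1 -> `|a * Gamma a - 1| <= 2 * a.
Proof.
move=> a0 a1.
have H1 : Gamma a <= a^-1 + 2.
  rewrite -lee_fin -Gamma_integral// itv0y_split; last 2 first.
  - exact: measurable_gamma_funE.
  - by move=> t; rewrite lee_fin gamma_fun_ge0.
  rewrite EFinD leeD ?integral_gamma01_le//.
  by apply: (@integral_gamma1y_le a 2); lra.
have H2 : a^-1 - (a + 1)^-1 <= Gamma a.
  rewrite -lee_fin -Gamma_integral// itv0y_split; last 2 first.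
  - exact: measurable_gamma_funE.
  - by move=> t; rewrite lee_fin gamma_fun_ge0.
  rewrite -[leLHS]adde0 leeD ?integral_gamma01_ge//.
  by apply: integral_ge0 => t _; rewrite lee_fin gamma_fun_ge0.
have {}H1 : a * Gamma a <= 1 + 2 * a.
  rewrite (le_trans (ler_wpM2l (ltW a0) H1))// mulrDr mulfV ?gt_eqF//; lra.
have {}H2 : 1 - a <= a * Gamma a.
  rewrite (le_trans _ (ler_wpM2l (ltW a0) H2))// mulrBr mulfV ?gt_eqF//.
  rewrite lerD2l lerN2 ler_piMr ?(ltW a0)// invf_le1; lra.
rewrite ler_norml; apply/andP; split; lra.
Qed.

(** The substitution t = s r. With r = |z|^2 it represents |z|^(-2b) as a superposition of
    Gaussians. *)
Lemma Gamma_scale (b r : R) : 0 < b -> 0 < r ->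
  (\int[leb]_(s in `]0%R, +oo[) (s `^ (b - 1) * expR (- (s * r)))%:E)%E =
  (Gamma b * r `^ (- b))%:E.
Proof.
move=> b0 r0.
pose f (t : R) : \bar R := ((fun t => (gamma_fun b t)%:E) \_ `]0%R, +oo[) t.
have mf : measurable_fun setT f.
  apply/(measurable_restrictT _ (measurable_itv _)).
  exact: measurable_gamma_funE.
have f0 t : (0 <= f t)%E.
  by rewrite /f patchE; case: ifP => // _; rewrite lee_fin gamma_fun_ge0.
have := ge0_integral_scale r0 mf f0.
rewrite /f -[X in (_ = _ * X)%E]integral_mkcond Gamma_integral// => E.
have -> : (\int[leb]_(s in `]0%R, +oo[) (s `^ (b - 1) * expR (- (s * r)))%:E)%E =
   ((r `^ (1 - b))%:E * \int[leb]_t f (r * t)%R)%E.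
  rewrite -ge0_integralZl_EFin ?powR_ge0//; last first.
    by apply: (measurableT_comp mf); exact: measurable_scale.
  rewrite [LHS]integral_mkcond.
  apply: (@eq_integral _ (measurableTypeR R) R leb setT) => t _; rewrite /f !patchE.
  have -> : (r * t \in `]0%R, +oo[%classic) = (t \in `]0%R, +oo[%classic).
    by apply/idP/idP; rewrite !inE /= !in_itv/= !andbT pmulr_rgt0.
  case: ifPn => [|_]; last by rewrite mule0.
  rewrite inE /= in_itv/= andbT => t0; rewrite -EFinM /gamma_fun; congr EFin.
  rewrite powRM ?(ltW r0) ?(ltW t0)// !mulrA -powRD_gt0//.
  by rewrite (_ : 1 - b + (b - 1) = 0) ?powRr0 ?mul1r 1?[r * t]mulrC//; ring.
rewrite E -!EFinM; congr EFin; rewrite mulrA mulrC; congr (_ * _).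
rewrite -[r^-1]powR_inv1 ?(ltW r0)// -powRD_gt0//.
by congr powR; ring.
Qed.

End gamma.

(** * Gaussian integrals *)

Section euclidean_norm.
Context {R : realType} {n : nat}.
Implicit Types x y : 'rV[R]_n.

Lemma dotp_ge0 x : 0 <= dotp x x.
Proof. by apply: sumr_ge0 => i _; rewrite -expr2 sqr_ge0. Qed.

Lemma enorm_ge0 x : 0 <= enorm x.
Proof. exact: sqrtr_ge0. Qed.

Lemma sqr_enorm x : enorm x ^+ 2 = dotp x x.
Proof. by rewrite sqr_sqrtr// dotp_ge0. Qed.

Lemma dotpC x y : dotp x y = dotp y x.
Proof. by apply: eq_bigr => i _; rewrite mulrC. Qed.

Lemma dotpDl x y z : dotp (x + y) z = dotp x z + dotp y z.
Proof. by rewrite -big_split; apply: eq_bigr => i _; rewrite mxE mulrDl. Qed.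

Lemma dotpZl (c : R) x y : dotp (c *: x) y = c * dotp x y.
Proof. by rewrite /dotp mulr_sumr; apply: eq_bigr => i _; rewrite mxE mulrA. Qed.

Lemma dotp0l y : dotp 0 y = 0.
Proof. by rewrite /dotp big1// => i _; rewrite mxE mul0r. Qed.

Lemma dotp_eq0 x : dotp x x = 0 -> x = 0.
Proof.
move=> /eqP; rewrite psumr_eq0; last by move=> i _; rewrite -expr2 sqr_ge0.
move=> /allP H; apply/rowP => i; rewrite mxE.
by have := H i (mem_index_enum i); rewrite /= mulf_eq0 orbb => /eqP.
Qed.

Lemma cauchy_schwarz x y : `|dotp x y| <= enorm x * enorm y.
Proof.
have [->|x0] := eqVneq x 0; first by rewrite dotp0l normr0 mulr_ge0// enorm_ge0.
have xx : 0 < dotp x x.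
  by rewrite lt_neqAle dotp_ge0 andbT eq_sym; apply: contra x0 => /eqP/dotp_eq0/eqP.
rewrite -[leLHS]ger0_norm// -ler_sqr ?nnegrE ?mulr_ge0 ?enorm_ge0//.
rewrite ger0_norm// real_normK ?num_real// exprMn !sqr_enorm.
have := dotp_ge0 (dotp x x *: y + (- dotp x y) *: x).
rewrite !(dotpDl, dotpZl) ![dotp _ (_ + _)]dotpC !(dotpDl, dotpZl) [dotp y x]dotpC.
rewrite (_ : _ + _ = dotp x x * (dotp x x * dotp y y - dotp x y ^+ 2)); last by ring.
by rewrite pmulr_rge0// subr_ge0.
Qed.

Lemma enormD x y : enorm (x + y) <= enorm x + enorm y.
Proof.
rewrite -ler_sqr ?nnegrE ?addr_ge0 ?enorm_ge0// sqrrD !sqr_enorm.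
rewrite dotpDl ![dotp _ (_ + _)]dotpC !dotpDl [dotp y x]dotpC.
have := cauchy_schwarz x y; rewrite ler_norml => /andP[_].
by rewrite mulr2n; lra.
Qed.

Lemma enormZ (c : R) x : enorm (c *: x) = `|c| * enorm x.
Proof.
rewrite /enorm dotpZl dotpC dotpZl mulrA -expr2 sqrtrM ?sqr_ge0//.
by rewrite sqrtr_sqr.
Qed.

Lemma enormN x : enorm (- x) = enorm x.
Proof. by rewrite -scaleN1r enormZ normrN normr1 mul1r. Qed.

Lemma coor_le_enorm x i : `|x 0 i| <= enorm x.
Proof.
rewrite -sqrtr_sqr ler_sqrt ?dotp_ge0// /dotp (bigD1 i)//= expr2 lerDl.
by apply: sumr_ge0 => j _; rewrite -expr2 sqr_ge0.
Qed.

Lemma norm_le_enorm x : `|x| <= enorm x.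
Proof. by apply: norm_rV_le; [exact: enorm_ge0|exact: coor_le_enorm]. Qed.

Lemma enorm_le_norm x : enorm x <= n%:R * `|x|.
Proof.
rewrite -ler_sqr ?nnegrE ?enorm_ge0// ?mulr_ge0//.
rewrite sqr_enorm exprMn /dotp (@le_trans _ _ (\sum_(i < n) `|x| ^+ 2))//.
  apply: ler_sum => i _; rewrite -expr2 -real_normK ?num_real//.
  by rewrite ler_sqr ?nnegrE// coor_le_norm.
rewrite sumr_const card_ord -[leLHS]mulr_natl ler_wpM2r ?sqr_ge0//.
by rewrite -natrX ler_nat; case: n => // m; rewrite expnS expn1 leq_pmulr.
Qed.

Lemma enorm0 : enorm (0 : 'rV[R]_n) = 0.
Proof. by rewrite /enorm dotp0l sqrtr0. Qed.

Lemma enorm_gt0 x : (0 < enorm x) = (x != 0).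
Proof.
apply/idP/idP; first by apply: contraTneq => ->; rewrite enorm0 ltxx.
by move=> x0; rewrite (lt_le_trans _ (norm_le_enorm x))// normr_gt0.
Qed.

Lemma continuous_dotp m (f g : 'rV[R]_m -> 'rV[R]_n) :
  continuous f -> continuous g -> continuous (fun x : 'rV[R]_m => dotp (f x) (g x)).
Proof.
move=> /continuous_rVP cf /continuous_rVP cg; rewrite /dotp.
by apply: rV_cont_sum => i; apply: rV_contM.
Qed.

Lemma rV_cont_id : continuous (fun x : 'rV[R]_n => x).
Proof. by apply/continuous_rVP => j; exact: continuous_coor. Qed.

Lemma continuous_sqr_enorm : continuous (fun x : 'rV[R]_n => dotp x x).
Proof. by apply: continuous_dotp; exact: rV_cont_id. Qed.

Lemma continuous_enorm : continuous (fun x : 'rV[R]_n => enorm x).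
Proof. by apply: rV_cont_comp; [exact: sqrt_continuous|exact: continuous_sqr_enorm]. Qed.

End euclidean_norm.

Section fubini_real.
Context d1 d2 (T1 : measurableType d1) (T2 : measurableType d2) (R : realType).
Variables (m1 : {sigma_finite_measure set T1 -> \bar R})
  (m2 : {sigma_finite_measure set T2 -> \bar R}).

(** The integrable function B dominates the L^1 norms of the slices in x, which gives integrability
    on the product by Tonelli. Integrability of all slices, not just almost all, lets the real inner
    integrals be identified with the extended ones everywhere. *)
Lemma Rintegral_Fubini (f : T1 * T2 -> R) (B : T2 -> R) :
  measurable_fun setT f ->
  (forall x, m2.-integrable setT (fun y => (f (x, y))%:E)) ->
  (forall y, m1.-integrable setT (fun x => (f (x, y))%:E)) ->
  m2.-integrable setT (EFin \o B) ->
  (forall y, \int[m1]_x `|f (x, y)| <= B y) ->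
  [/\ m1.-integrable setT (fun x => (\int[m2]_y f (x, y))%:E),
      m2.-integrable setT (fun y => (\int[m1]_x f (x, y))%:E) &
      \int[m1]_x \int[m2]_y f (x, y) = \int[m2]_y \int[m1]_x f (x, y)].
Proof.
move=> mf f1 f2 Bi fB.
have B0 y : 0 <= B y by rewrite (le_trans _ (fB y))//; exact: Rintegral_ge0.
have mfE : measurable_fun setT (EFin \o f) by exact/measurable_EFinP.
have iE : (m1 \x m2)%E.-integrable setT (EFin \o f).
  apply/integrable21ltyP => //; apply: (@le_lt_trans _ _ (\int[m2]_y (B y)%:E)%E).
    apply: ge0_le_integral => //.
    - by move=> y _; apply: integral_ge0 => x _; rewrite abse_ge0.
    - apply: (@measurable_fun_fubini_tonelli_G _ _ _ _ _ m1 (abse \o (EFin \o f))) => //.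
        exact: measurableT_comp.
      by move=> x; rewrite abse_ge0.
    - exact: measurable_int Bi.
    move=> y _ /=; rewrite (le_trans _ (_ : (\int[m1]_x `|f (x, y)|)%:E <= _)%E)//.
      by rewrite -EFin_Rintegral//; exact: integrable_abse (f2 y).
    by rewrite lee_fin.
  by rewrite EFin_Rintegral// ltry.
have GE : (fun y => (\int[m1]_x f (x, y))%:E) = (fun y => \int[m1]_x (f (x, y))%:E)%E.
  by apply/funext => y; apply/esym/EFin_Rintegral => //; exact: f2.
have FE : (fun x => (\int[m2]_y f (x, y))%:E) = (fun x => \int[m2]_y (f (x, y))%:E)%E.
  by apply/funext => x; apply/esym/EFin_Rintegral => //; exact: f1.
split; last first.
- rewrite /Rintegral.
  transitivity (fine (\int[m1]_x \int[m2]_y (f (x, y))%:E)%E).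
    by congr fine; apply: eq_integral => x _; apply/esym/EFin_Rintegral => //; exact: f1.
  rewrite (Fubini iE); congr fine; apply: eq_integral => y _ /=.
  by apply: EFin_Rintegral => //; exact: f2.
- rewrite GE; apply/integrableP; split; first exact: (measurable_fubini_G iE).
  have := Bi => /integrableP[_]; apply: le_lt_trans; apply: ge0_le_integral => //.
  + by apply: measurableT_comp => //; exact: (measurable_fubini_G iE).
  + by apply: measurableT_comp => //; exact: measurable_int Bi.
  move=> y _; rewrite EFin_Rintegral//= ?lee_fin; last exact: f2.
  rewrite (le_trans (le_normr_Rintegral _ (f2 y)))//.
  by rewrite (le_trans (fB y))// ler_norm.
rewrite FE; apply/integrableP; split; first exact: (measurable_fubini_F iE).
have /integrable12ltyP := iE => /(_ mfE); apply: le_lt_trans.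
apply: ge0_le_integral => //.
- by apply: measurableT_comp => //; exact: (measurable_fubini_F iE).
- apply: (@measurable_fun_fubini_tonelli_F _ _ _ _ _ m2 (abse \o (EFin \o f))) => //.
    exact: measurableT_comp.
  by move=> x; rewrite abse_ge0.
by move=> x _; apply: le_abse_integral => //; exact: measurable_int (f1 x).
Qed.

End fubini_real.

Section gaussian.
Context {R : realType}.
Local Notation leb := (@lebesgue_measure R).

Definition gauss n (s : R) (z : 'rV[R]_n) : R := expR (- (s * dotp z z)).

Lemma gauss_gt0 n s (z : 'rV[R]_n) : 0 < gauss s z.
Proof. exact: expR_gt0. Qed.

Lemma continuous_gauss n s : continuous (@gauss n s).
Proof.
apply: (rV_cont_comp (h := expR)); first exact: continuous_expR.
apply: rV_contN; apply: rV_contM; [exact: rV_contC|exact: continuous_sqr_enorm].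
Qed.

Lemma integral_gauss1 (s : R) : 0 < s ->
  (\int[leb]_t (expR (- (s * (t * t))))%:E)%E = (Num.sqrt (pi / s))%:E.
Proof.
move=> s0; have ss0 : 0 < Num.sqrt s by rewrite sqrtr_gt0.
have := @ge0_integral_scale R (Num.sqrt s) (fun t => (gauss_fun t)%:E) ss0.
rewrite integralT_gauss -EFinM => H.
transitivity (\int[leb]_t (gauss_fun (Num.sqrt s * t))%:E)%E.
  apply: eq_integral => t _; rewrite /gauss_fun exprMn sqr_sqrtr ?(ltW s0)//.
rewrite H; last 2 first.
- by apply/measurable_EFinP; exact: measurable_gauss_fun.
- by move=> t; rewrite lee_fin gauss_fun_ge0.
by rewrite mulrC sqrtrM ?pi_ge0// sqrtrV ?(ltW s0)//.
Qed.

Lemma integral_lebesgue_borelS n (f : 'rV[R]_n.+1 -> \bar R) :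
  measurable_fun setT f -> (forall x, (0 <= f x)%E) ->
  (\int[lebesgue_borel R n.+1]_x f x =
   \int[leb]_t \int[lebesgue_borel R n]_y f (cons_rV (t, y)))%E.
Proof.
move=> mf f0.
rewrite -(@fubini_tonelli1 _ _ (measurableTypeR R) 'rV[R]_n R leb
  (lebesgue_borel R n) (fun p => f (cons_rV p)))//; last first.
  by apply: (measurableT_comp mf); exact: measurable_cons_rV.
rewrite -(ge0_integral_pushforward (@measurable_cons_rV R n)
  (leb \x lebesgue_borel R n)%E measurableT mf)//.
Qed.

Lemma integral_gauss n (s : R) : 0 < s ->
  (\int[lebesgue_borel R n]_z (gauss s z)%:E)%E = (Num.sqrt (pi / s) ^+ n)%:E.
Proof.
move=> s0; elim: n => [|n IH].
  rewrite integral_dirac//; last first.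
    by apply: measurable_EFin_cont; exact: continuous_gauss.
  by rewrite diracE in_setT mul1e expr0 /gauss /dotp big_ord0 mulr0 oppr0 expR0.
rewrite integral_lebesgue_borelS; last 2 first.
- by apply: measurable_EFin_cont; exact: continuous_gauss.
- by move=> x; rewrite lee_fin ltW// gauss_gt0.
have E t (y : 'rV[R]_n) : (gauss s (cons_rV (t, y)))%:E =
    ((expR (- (s * (t * t))))%:E * (gauss s y)%:E)%E.
  rewrite -EFinM /gauss -expRD; congr (EFin (expR _)).
  rewrite /dotp big_ord_recl cons_rV_coor0 mulrDr opprD; congr (_ + - (_ * _)).
  by apply: eq_bigr => i _; rewrite cons_rV_coorS.
under eq_integral => t _.
  under eq_integral => y _ do rewrite E.
  rewrite ge0_integralZl_EFin ?expR_ge0//; last 2 first.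
  - by move=> y _; rewrite lee_fin ltW// gauss_gt0.
  - by apply: measurable_EFin_cont; exact: continuous_gauss.
  rewrite IH.
  over.
rewrite ge0_integralZr//=; last first.
  apply/measurable_EFinP; apply: measurableT_comp => //.
  by apply: measurable_funN; apply: measurable_funM => //; exact: measurable_funM.
by rewrite integral_gauss1// -EFinM exprS.
Qed.

Lemma integrable_gauss n (s : R) : 0 < s ->
  (lebesgue_borel R n).-integrable setT (EFin \o gauss s).
Proof.
move=> s0; apply/integrableP; split.
  by apply: measurable_EFin_cont; exact: continuous_gauss.
under eq_integral => z _ do rewrite /= ger0_norm ?(ltW (gauss_gt0 _ _))//.
by rewrite integral_gauss// ltry.
Qed.

Definition gmass n (s : R) := Num.sqrt (pi / s) ^+ n.

Lemma gmass_gt0 n s : 0 < s -> 0 < gmass n s.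
Proof. by move=> s0; rewrite exprn_gt0// sqrtr_gt0 divr_gt0// pi_gt0. Qed.

Lemma Rintegral_gauss n (s : R) : 0 < s ->
  \int[lebesgue_borel R n]_z gauss s z = gmass n s.
Proof. by move=> s0; rewrite /Rintegral integral_gauss. Qed.

(** The first factor comes from [pow_le_expR_sqr]; [Num.sqrt 2 ^+ n] is the ratio of the Gaussian
    masses at s/2 and at s. *)
Definition moment_const n (k : nat) : R :=
  (1 + 2 ^+ k * k`!%:R) * Num.sqrt 2 ^+ n.

Lemma moment_const_ge0 n k : 0 <= moment_const n k.
Proof. by rewrite mulr_ge0 ?exprn_ge0 ?sqrtr_ge0// addr_ge0// mulr_ge0. Qed.

(** u^k <= 1 + u^(2k), and u^(2k) = 2^k (u^2/2)^k <= 2^k k! exp(u^2/2). *)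
Lemma pow_le_expR_sqr (u : R) (k : nat) : 0 <= u ->
  u ^+ k <= (1 + 2 ^+ k * k`!%:R) * expR (u ^+ 2 / 2).
Proof.
move=> u0.
have u2 : 0 <= u ^+ 2 / 2 by rewrite divr_ge0// sqr_ge0.
have H := expR_ge_pow k u2.
have e1 : 1 <= expR (u ^+ 2 / 2) by rewrite (le_trans _ (expR_ge1Dx _))// lerDl.
have uk0 := exprn_ge0 k u0.
have : u ^+ k <= 1 + (u ^+ k) ^+ 2 by nra.
move/le_trans; apply; rewrite mulrDl mul1r lerD// -mulrA.
rewrite -exprM mulnC exprM -[X in X ^+ k](@divfK _ 2)// exprMn mulrC.
by rewrite ler_wpM2l// exprn_ge0.
Qed.

(** With u = sqrt(s) |z| in the previous bound, the power is paid for by half of the Gaussian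
    exponent. *)
Lemma enorm_pow_gauss_le n (k : nat) (s : R) (z : 'rV[R]_n) : 0 < s ->
  enorm z ^+ k * gauss s z <=
  (1 + 2 ^+ k * k`!%:R) / Num.sqrt s ^+ k * gauss (s / 2) z.
Proof.
move=> s0; have ss0 : 0 < Num.sqrt s by rewrite sqrtr_gt0.
have u0 : 0 <= Num.sqrt s * enorm z by rewrite mulr_ge0 ?enorm_ge0 ?ltW.
have := pow_le_expR_sqr k u0.
rewrite !exprMn sqr_sqrtr ?(ltW s0)// sqr_enorm mulrC -ler_pdivlMr ?exprn_gt0// => H.
apply: (le_trans (ler_wpM2r (ltW (gauss_gt0 _ _)) H)).
have E : expR (s * dotp z z / 2) * gauss s z = gauss (s / 2) z.
  by rewrite /gauss -expRD; congr expR; field.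
rewrite -E; move: (Num.sqrt s ^- k) (1 + _) (expR _) (gauss _ _) => a b c d.
by rewrite le_eqVlt; apply/orP; left; apply/eqP; ring.
Qed.

Lemma integrable_moment n (k : nat) (s : R) : 0 < s ->
  (lebesgue_borel R n).-integrable setT (EFin \o (fun z => enorm z ^+ k * gauss s z)).
Proof.
move=> s0; have s20 : 0 < s / 2 by rewrite divr_gt0.
have := integrable_gauss n s20.
move=> /(integrableZl measurableT ((1 + 2 ^+ k * k`!%:R) / Num.sqrt s ^+ k)).
apply: le_integrable => //.
  apply: measurable_EFin_cont; apply: rV_contM; last exact: continuous_gauss.
  apply: (rV_cont_comp (h := fun u => u ^+ k)); last exact: continuous_enorm.
  exact: exprn_continuous.
move=> z _ /=; rewrite lee_fin.
rewrite ger0_norm; last by rewrite mulr_ge0 ?exprn_ge0 ?enorm_ge0// ltW// gauss_gt0.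
by rewrite (le_trans (enorm_pow_gauss_le k z s0))// ler_norm.
Qed.

Lemma moment_le n (k : nat) (s : R) : 0 < s ->
  \int[lebesgue_borel R n]_z (enorm z ^+ k * gauss s z) <=
  moment_const n k / Num.sqrt s ^+ k * gmass n s.
Proof.
move=> s0; have s20 : 0 < s / 2 by rewrite divr_gt0.
pose c := (1 + 2 ^+ k * k`!%:R) / Num.sqrt s ^+ k.
have gi := integrable_gauss n s20.
apply: (@le_trans _ _ (\int[lebesgue_borel R n]_z (c * gauss (s / 2) z))).
  apply: le_Rintegral => //; first exact: integrable_moment.
    exact: (integrableZl measurableT c gi).
  by move=> z _; exact: enorm_pow_gauss_le.
rewrite RintegralZl// Rintegral_gauss// /c /moment_const.
rewrite (_ : gmass n (s / 2) = Num.sqrt 2 ^+ n * gmass n s); last first.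
  rewrite /gmass -exprMn -sqrtrM//; congr (Num.sqrt _ ^+ _); field.
  by rewrite gt_eqF.
move: (Num.sqrt s ^- k) (Num.sqrt 2 ^+ n) (1 + _) (gmass _ _) => a b d e.
by rewrite le_eqVlt; apply/orP; left; apply/eqP; ring.
Qed.

End gaussian.

(** * The fractional divergence as a superposition of Gaussian averages *)

Section increments.
Context {R : realType} {n : nat}.
Local Notation lam := (lebesgue_borel R n).
Local Notation e_ i := (delta_mx 0 i : 'rV[R]_n).
Implicit Types (f : 'rV[R]_n -> R).

Lemma measurable_pair_add :
  measurable_fun [set: 'rV[R]_n * 'rV[R]_n] (fun p => p.1 + p.2).
Proof.
apply: measurable_to_rV => i.
rewrite (_ : _ \o _ = (fun p : 'rV[R]_n * 'rV[R]_n => p.1 0 i + p.2 0 i)); last first.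
  by apply/funext => p /=; rewrite mxE.
apply: measurable_funD.
  exact: (measurableT_comp (measurable_coor i) measurable_fst).
exact: (measurableT_comp (measurable_coor i) measurable_snd).
Qed.

Lemma C1_increment M f : Cks 1 f -> bsupp M f ->
  exists2 C : R, 0 <= C & forall x z, `|f (x + z) - f x| <= C * enorm z.
Proof.
move=> Cf Hf.
have cD i : continuous ('D_(e_ i) f) by exact: Cks_continuous (Cks_derive i Cf).
have HD i := bsupp_bounded (cD i) (bsupp_derive (e_ i) Hf).
pose C i := s2val (cid2 (HD i)).
have C0 i : 0 <= C i by rewrite /C; case: cid2.
have DC i x : `|'D_(e_ i) f x| <= C i by rewrite /C; case: cid2.
exists (\sum_i C i); first exact: sumr_ge0.
move=> x z; have fz y : derivable f y z by exact: C1_derivable.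
have [c _] := mean_value_dir x 1 fz.
rewrite scale1r mul1r => ->; rewrite C1_deriveE// mulr_suml.
apply: le_trans (ler_norm_sum _ _ _) _; apply: ler_sum => i _.
by rewrite normrM mulrC ler_pM// coor_le_enorm.
Qed.

Lemma C1_increment_min M f : Cks 1 f -> bsupp M f ->
  exists2 C : R, 0 <= C &
    forall x z, `|f (x + z) - f x| <= C * Num.min 1 (enorm z).
Proof.
move=> Cf Hf; have [L L0 HL] := C1_increment Cf Hf.
have [S S0 HS] := bsupp_bounded (Cks_continuous Cf) Hf.
exists (L + 2 * S) => [|x z]; first by rewrite addr_ge0 ?mulr_ge0.
have [z1|z1] := leP 1 (enorm z).
  have := ler_normB (f (x + z)) (f x); have := HS x; have := HS (x + z); lra.
by rewrite (le_trans (HL x z))// ler_wpM2r ?enorm_ge0// lerDl mulr_ge0.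
Qed.

Lemma integrable_normr f : lam.-integrable setT (EFin \o f) ->
  lam.-integrable setT (EFin \o (fun x => `|f x|)).
Proof. by move=> fi; exact: integrable_norm fi. Qed.

Lemma bsupp_shift M f z : bsupp M f -> bsupp (M + `|z|) (fun x => f (x + z)).
Proof.
move=> Hf x Mx; apply: Hf.
have : `|x| <= `|x + z| + `|z|.
  by rewrite -lerBlDl (le_trans (lerB_dist _ _))// opprD addNKr normrN.
lra.
Qed.

Lemma integrable_shift_cc M f z : continuous f -> bsupp M f ->
  lam.-integrable setT (EFin \o (fun x => f (x + z))).
Proof.
move=> cf Hf; apply: (@cc_integrable R n (M + `|z|)).
  exact: continuous_shift_arg.
exact: bsupp_shift.
Qed.

Lemma integrable_diff_cc M f z : continuous f -> bsupp M f ->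
  lam.-integrable setT (EFin \o (fun x => f (x + z) - f x)).
Proof.
move=> cf Hf.
have := integrableB measurableT (integrable_shift_cc z cf Hf) (cc_integrable cf Hf).
exact.
Qed.

Lemma integrable_indic_cube (k : R) : 0 < k ->
  lam.-integrable setT (EFin \o (\1_(cube k) : 'rV[R]_n -> R)).
Proof.
move=> k0; apply: (@bsupp_integrable _ _ k 1).
- by apply: measurable_indic; exact: measurable_obox.
- by move=> x; rewrite indicE; case: (_ \in _); rewrite ?normr1 ?normr0.
- move=> x kx; rewrite indicE memNset// => /cubeP -/(_ k0).
  by rewrite ltNge kx.
Qed.

(** For |z| < 1 the increment is Lipschitz in z and supported in a fixed cube; for |z| >= 1 it has
    at most twice the L^1 norm of f. *)
Lemma C1_L1_increment M f : Cks 1 f -> bsupp M f ->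
  exists2 C : R, 0 <= C & forall z,
    \int[lam]_x `|f (x + z) - f x| <= C * Num.min 1 (enorm z).
Proof.
move=> Cf Hf; have cf := Cks_continuous Cf.
have [L L0 HL] := C1_increment Cf Hf.
(* A cube containing the supports of f and of its translates by |z| < 1. *)
pose k := Num.max M 0 + 2.
have k0 : 0 < k by rewrite /k ltr_wpDl// le_max lexx orbT.
pose V := fine (lam (cube k)).
have VE : (lam (cube k) = V%:E)%E.
  by rewrite /V fineK// ge0_fin_numE// cube_lty.
have V0 : 0 <= V by rewrite -lee_fin -VE.
pose I := \int[lam]_x `|f x|.
have I0 : 0 <= I by apply: Rintegral_ge0.
have fi := cc_integrable cf Hf.
exists (L * V + 2 * I) => [|z]; first by rewrite addr_ge0 ?mulr_ge0.
have fsi := integrable_shift_cc z cf Hf.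
have di := integrable_diff_cc z cf Hf.
have c0 : 0 <= L * V + 2 * I by rewrite addr_ge0 ?mulr_ge0.
have le2I : \int[lam]_x `|f (x + z) - f x| <= 2 * I.
  apply: (@le_trans _ _ (\int[lam]_x (`|f (x + z)| + `|f x|))).
    apply: le_Rintegral => //; first exact: integrable_normr di.
      have := integrableD measurableT (integrable_normr fsi) (integrable_normr fi).
      exact.
    by move=> x _; exact: ler_normB.
  rewrite RintegralD//; [|exact: integrable_normr fsi|exact: integrable_normr fi].
  rewrite (Rintegral_shift z (f := fun x => `|f x|)); first by rewrite /I; lra.
  apply: measurableT_comp => //; exact: rV_continuous_measurable.
have [z1|z1] := leP 1 (enorm z).
  by rewrite mulr1 (le_trans le2I)// lerDr mulr_ge0.
apply: (@le_trans _ _ (L * enorm z * V)); last first.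
  by rewrite mulrAC ler_wpM2r ?enorm_ge0// lerDl mulr_ge0.
apply: (@le_trans _ _ (\int[lam]_x (L * enorm z * \1_(cube k) x))).
  have ii := integrable_indic_cube k0.
  apply: le_Rintegral => //; first exact: integrable_normr di.
    have := integrableZl measurableT (L * enorm z) ii; exact.
  move=> x _; rewrite indicE; have [xk|xk] := boolP (x \in cube k).
    by rewrite mulr1.
  have kx : k <= `|x|.
    rewrite leNgt; apply/negP => xk'; move/negP: xk; apply; apply/mem_set.
    by apply/cubeP.
  have zk : `|z| < 1 := le_lt_trans (norm_le_enorm z) z1.
  have kM : M + 2 <= k by rewrite /k lerD2r le_max lexx.
  have fx : f x = 0 by apply: Hf; apply: le_trans kx; apply: le_trans kM; rewrite lerDl.
  have fxz : f (x + z) = 0.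
    apply: (bsupp_shift Hf).
    apply: le_trans kx; apply: le_trans kM.
    by rewrite lerD2l (le_trans (ltW zk))// ler1n.
  by rewrite mulr0 fx fxz subrr normr0.
rewrite RintegralZl//; last exact: integrable_indic_cube.
rewrite ler_wpM2l ?mulr_ge0 ?enorm_ge0// /Rintegral.
have mc : measurable (cube k : set 'rV[R]_n) by exact: measurable_obox.
by rewrite integral_indic// setIT.
Qed.

End increments.

Section riesz_weight.
Context {R : realType} {n : nat}.
Local Notation lam := (lebesgue_borel R n).
Local Notation leb := (@lebesgue_measure R).
Variables (al : R).
Hypothesis al01 : 0 < al < 1.

(* The kernel is |z|^(-2 betac) = Gamma(betac)^-1 int s^(betac-1) e^(-s|z|^2) ds;
   gapc is the parameter a = (1 - alpha)/2 that vanishes in the limit. *)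
Definition betac := (n%:R + al + 1) / 2.
Definition gapc := (1 - al) / 2.

Let b0 : 0 < betac.
Proof. by case/andP: al01 => a0 _; rewrite /betac divr_gt0// ltr_wpDl// addr_ge0// ltW. Qed.

Lemma gmass_powR (s : R) : 0 < s -> gmass n s = pi `^ (n%:R / 2) * s `^ (- (n%:R / 2)).
Proof.
move=> s0; rewrite /gmass -powR12_sqrt; last by rewrite divr_ge0 ?pi_ge0 ?ltW.
rewrite -powR_mulrn ?powR_ge0// -powRrM mulrC powRM ?pi_ge0 ?invr_ge0 ?ltW//.
rewrite [LHS]mulrC; congr (_ * _); first by congr powR; rewrite mulrC.
by rewrite -powR_inv1 ?ltW// -powRrM; congr powR; ring.
Qed.

(** Extended by 0 to s <= 0, so that the s-integrals run over the whole line and Fubini applies to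
    full spaces. *)
Definition sweight (s : R) : R := if 0 < s then s `^ (betac - 1) else 0.

Lemma sweight_ge0 s : 0 <= sweight s.
Proof. by rewrite /sweight; case: ifP => // _; exact: powR_ge0. Qed.

Lemma measurable_sweight : measurable_fun setT (sweight : measurableTypeR R -> measurableTypeR R).
Proof.
rewrite (_ : sweight = \1_(`]0, +oo[%classic : set R) \* (fun s => s `^ (betac - 1))).
  apply: measurable_funM; last exact: measurable_powR.
  by apply: measurable_indic; exact: measurable_itv.
apply/funext => s; rewrite /sweight /= indicE; case: (ltP 0 s) => s0.
  by rewrite mem_set ?mul1r//= in_itv/= s0.
by rewrite memNset ?mul0r//= in_itv/= ltNge s0.
Qed.

Lemma integral_sweight_gauss (z : 'rV[R]_n) : z != 0 ->
  (\int[leb]_s (sweight s * gauss s z)%:E)%E =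
  (Gamma betac / enorm z `^ (n%:R + al + 1))%:E.
Proof.
move=> z0; have ez : 0 < enorm z by rewrite enorm_gt0.
have zz : 0 < dotp z z by rewrite -sqr_enorm exprn_gt0.
transitivity (Gamma betac * dotp z z `^ (- betac))%:E; last first.
  congr (_ * _)%:E; rewrite -powRN -sqr_enorm -powR_mulrn ?enorm_ge0// -powRrM.
  by congr powR; rewrite /betac; field.
rewrite -Gamma_scale// [RHS]integral_mkcond.
apply: (@eq_integral _ (measurableTypeR R) R leb setT) => s _.
rewrite patchE /sweight /gauss; case: (ltP 0 s) => s0.
  by rewrite mem_set//= in_itv/= s0.
by rewrite memNset ?mul0r//= in_itv/= ltNge s0.
Qed.

(* Moduli of increments of C^1_c functions are O(min(1, |z|)), in L^1 and
   uniformly; wmin is this bound times the factor |z| of the kernel. *)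
Definition wmin (z : 'rV[R]_n) : R := enorm z * Num.min 1 (enorm z).

Lemma wmin_ge0 z : 0 <= wmin z.
Proof. by rewrite mulr_ge0 ?enorm_ge0// le_min ler01 enorm_ge0. Qed.

Lemma continuous_wmin : continuous wmin.
Proof.
apply: rV_contM; first exact: continuous_enorm.
move=> x; apply: (@continuous_min R _ (fun=> 1) (fun z => enorm z) x).
  exact: (@rV_contC R n 1 x).
exact: (@continuous_enorm R n x).
Qed.

(** Majorant of [sweight s] times the Gaussian integral of [wmin]. The two terms of the minimum come
    from the moments of order 1 and 2, as [wmin z] is at most |z| and at most |z|^2. *)
Definition sbound (s : R) : R :=
  sweight s * (Num.max (moment_const n 1) (moment_const n 2) *
  Num.min (Num.sqrt s)^-1 s^-1 * gmass n s).

Lemma wmin_gauss_le (s : R) : 0 < s ->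
  lam.-integrable setT (EFin \o (fun z => wmin z * gauss s z)) /\
  \int[lam]_z (wmin z * gauss s z) <=
  Num.max (moment_const n 1) (moment_const n 2) *
  Num.min (Num.sqrt s)^-1 s^-1 * gmass n s.
Proof.
move=> s0.
have w1 z : wmin z * gauss s z <= enorm z ^+ 1 * gauss s z.
  rewrite ler_wpM2r ?(ltW (gauss_gt0 _ _))// expr1 /wmin ler_piMr ?enorm_ge0//.
  by rewrite ge_min lexx.
have w2 z : wmin z * gauss s z <= enorm z ^+ 2 * gauss s z.
  rewrite ler_wpM2r ?(ltW (gauss_gt0 _ _))// expr2 /wmin ler_wpM2l ?enorm_ge0//.
  by rewrite ge_min lexx orbT.
have wi : lam.-integrable setT (EFin \o (fun z => wmin z * gauss s z)).
  apply: le_integrable (integrable_moment n 1 s0) => //.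
    by apply: measurable_EFin_cont; apply: rV_contM;
      [exact: continuous_wmin|exact: continuous_gauss].
  move=> z _ /=; rewrite lee_fin ger0_norm; last first.
    by rewrite mulr_ge0 ?wmin_ge0// ltW// gauss_gt0.
  by rewrite (le_trans (w1 z))// ler_norm.
split => //.
have H1 : \int[lam]_z (wmin z * gauss s z) <=
    moment_const n 1 / Num.sqrt s ^+ 1 * gmass n s.
  apply: le_trans (moment_le n 1 s0); apply: le_Rintegral => //.
  exact: integrable_moment.
have H2 : \int[lam]_z (wmin z * gauss s z) <=
    moment_const n 2 / Num.sqrt s ^+ 2 * gmass n s.
  apply: le_trans (moment_le n 2 s0); apply: le_Rintegral => //.
  exact: integrable_moment.
rewrite sqr_sqrtr ?(ltW s0)// in H2; rewrite expr1 in H1.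
have g0 := ltW (gmass_gt0 n s0).
case: (leP (Num.sqrt s)^-1 s^-1) => _.
  rewrite (le_trans H1)// ler_wpM2r// ler_wpM2r ?invr_ge0 ?sqrtr_ge0//.
  by rewrite le_max lexx.
rewrite (le_trans H2)// ler_wpM2r// ler_wpM2r ?invr_ge0 ?(ltW s0)//.
by rewrite le_max lexx orbT.
Qed.

End riesz_weight.

Section riesz_swap.
Context {R : realType} {n : nat}.
Local Notation lam := (lebesgue_borel R n).
Local Notation leb := (@lebesgue_measure R).
Variables (al : R).
Hypothesis al01 : 0 < al < 1.
Local Notation beta := (betac (n := n) al).
Local Notation gap := (gapc al).
Local Notation pw z := (enorm z `^ (n%:R + al + 1)).
Local Notation sw := (sweight (n := n) al).

Lemma beta_gt0 : 0 < beta.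
Proof. by case/andP: al01 => a0 _; rewrite /betac divr_gt0// ltr_wpDl// addr_ge0// ltW. Qed.

Lemma gap_gt0 : 0 < gap.
Proof. by case/andP: al01 => a0 a1; rewrite /gapc divr_gt0// subr_gt0. Qed.

Definition sb_const : R := Num.max (moment_const n 1) (moment_const n 2) * pi `^ (n%:R / 2).

Lemma sb_const_ge0 : 0 <= sb_const.
Proof. by rewrite mulr_ge0 ?powR_ge0// le_max moment_const_ge0. Qed.

(** First moment, for small s: the exponent al/2 - 1 is integrable at 0 because al > 0. *)
Lemma sbound_le1 (s : R) : 0 < s -> sbound (n := n) al s <= sb_const * s `^ (al / 2 - 1).
Proof.
move=> s0; have sp := ltW (gmass_gt0 n s0).
have mx : (0 : R) <= Num.max (moment_const n 1) (moment_const n 2).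
  by rewrite le_max moment_const_ge0.
rewrite /sbound /sweight s0.
apply: (@le_trans _ _ (s `^ (beta - 1) * (Num.max (moment_const n 1) (moment_const n 2) * (Num.sqrt s)^-1 * gmass n s))).
  by rewrite ler_wpM2l ?powR_ge0// ler_wpM2r// ler_wpM2l// ge_min lexx.
rewrite gmass_powR// -powR12_sqrt ?(ltW s0)// -powRN /sb_const.
have -> : al / 2 - 1 = (beta - 1) + (- 2^-1 + - (n%:R / 2)) by rewrite /betac; field.
rewrite !(powRD_gt0 _ _ s0) le_eqVlt; apply/orP; left; apply/eqP; ring.
Qed.

(** Second moment, for large s: the exponent -gap - 1 is integrable at infinity because al < 1. *)
Lemma sbound_le2 (s : R) : 0 < s -> sbound (n := n) al s <= sb_const * s `^ (- gap - 1).
Proof.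
move=> s0; have sp := ltW (gmass_gt0 n s0).
have mx : (0 : R) <= Num.max (moment_const n 1) (moment_const n 2).
  by rewrite le_max moment_const_ge0.
rewrite /sbound /sweight s0.
apply: (@le_trans _ _ (s `^ (beta - 1) * (Num.max (moment_const n 1) (moment_const n 2) * s^-1 * gmass n s))).
  by rewrite ler_wpM2l ?powR_ge0// ler_wpM2r// ler_wpM2l// ge_min lexx orbT.
rewrite gmass_powR// -powR_inv1 ?(ltW s0)// /sb_const.
have -> : - gap - 1 = (beta - 1) + (- 1 + - (n%:R / 2)) by rewrite /betac /gapc; field.
rewrite !(powRD_gt0 _ _ s0) le_eqVlt; apply/orP; left; apply/eqP; ring.
Qed.

Lemma measurable_sw_gauss :
  measurable_fun [set: measurableTypeR R * 'rV[R]_n] (fun p => sw p.1 * gauss p.1 p.2).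
Proof.
apply: measurable_funM.
  by apply: (measurableT_comp _ measurable_fst); exact: measurable_sweight.
rewrite /gauss; apply: measurableT_comp => //; apply: measurable_funN.
apply: measurable_funM; first exact: measurable_fst.
have h := rV_continuous_measurable (@continuous_sqr_enorm R n).
exact: (measurableT_comp h measurable_snd).
Qed.

Lemma measurable_sw_gauss_s (z : 'rV[R]_n) :
  measurable_fun [set: measurableTypeR R] (fun s => sw s * gauss s z).
Proof.
apply: measurable_funM; first exact: measurable_sweight.
rewrite /gauss; apply: measurableT_comp => //; apply: measurable_funN.
by apply: measurable_funM => //; exact: measurable_cst.
Qed.

Lemma measurable_pw : measurable_fun [set: 'rV[R]_n] (fun z => (pw z)^-1).
Proof.
rewrite (_ : (fun z => _) = fun z => (enorm z) `^ (- (n%:R + al + 1))); last first.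
  by apply/funext => z; rewrite powRN.
apply: (measurableT_comp (measurable_powR _)).
by apply: rV_continuous_measurable; exact: continuous_enorm.
Qed.

Lemma wmin0 : wmin (0 : 'rV[R]_n) = 0.
Proof. by rewrite /wmin enorm0 mul0r. Qed.

Let wsw (p : 'rV[R]_n * measurableTypeR R) : \bar R :=
  (wmin p.1 * (sw p.2 * gauss p.2 p.1))%:E.

Let measurable_wsw : measurable_fun setT wsw.
Proof.
apply/measurable_EFinP; apply: measurable_funM.
  apply: (measurableT_comp _ measurable_fst).
  by apply: rV_continuous_measurable; exact: continuous_wmin.
have := measurableT_comp measurable_sw_gauss (@measurable_swap _ _ 'rV[R]_n (measurableTypeR R)).
exact.
Qed.

Let wsw_ge0 p : (0 <= wsw p)%E.
Proof.
by rewrite lee_fin mulr_ge0 ?wmin_ge0// mulr_ge0 ?sweight_ge0 ?(ltW (gauss_gt0 _ _)).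
Qed.

Local Open Scope ereal_scope.

Lemma wmin_weight_swap :
  \int[lam]_z (wmin z / pw z)%:E * (Gamma beta)%:E =
  \int[leb]_s \int[lam]_z (wmin z * (sw s * gauss s z))%:E.
Proof.
rewrite muleC -ge0_integralZl_EFin//; last 3 first.
- by move=> z _; rewrite lee_fin divr_ge0 ?wmin_ge0 ?powR_ge0.
- apply/measurable_EFinP; apply: measurable_funM; last exact: measurable_pw.
  by apply: rV_continuous_measurable; exact: continuous_wmin.
- by rewrite ltW// Gamma_gt0// beta_gt0.
transitivity (\int[lam]_z \int[leb]_s (wmin z * (sw s * gauss s z))%:E).
  apply: eq_integral => z _.
  under eq_integral => s _ do rewrite EFinM.
  rewrite ge0_integralZl_EFin ?wmin_ge0//; last 2 first.
  - by move=> s _; rewrite lee_fin mulr_ge0 ?sweight_ge0 ?(ltW (gauss_gt0 _ _)).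
  - by apply/measurable_EFinP; exact: measurable_sw_gauss_s.
  (* At the origin the representation of the kernel by Gaussians breaks down, but [wmin] vanishes
     there. *)
  have [->|z0] := eqVneq z 0%R; first by rewrite wmin0 mul0r !mul0e mule0.
  by rewrite (integral_sweight_gauss al01 z0) -!EFinM; congr EFin; ring.
exact: (@fubini_tonelli _ _ 'rV[R]_n (measurableTypeR R) R lam leb wsw).
Qed.

(** After the Tonelli swap the s-integral splits at 1 into two power integrals, controlled by
    [sbound_le1] and [sbound_le2]. *)
Lemma wmin_weight_integrable :
  lam.-integrable setT (EFin \o (fun z => wmin z / pw z)%R).
Proof.
apply/integrableP; split.
  apply/measurable_EFinP; apply: measurable_funM; last exact: measurable_pw.
  by apply: rV_continuous_measurable; exact: continuous_wmin.
under eq_integral => z _.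
  rewrite /= ger0_norm; last by rewrite divr_ge0 ?wmin_ge0 ?powR_ge0.
  over.
have G0 : (0 < Gamma beta)%R by rewrite Gamma_gt0// beta_gt0.
(* The factor Gamma(beta) is a positive real, so finiteness of the product forces finiteness of the
   integral. *)
suff H : \int[lam]_z (wmin z / pw z)%:E * (Gamma beta)%:E < +oo.
  have : 0 <= \int[lam]_z (wmin z / pw z)%:E.
    by apply: integral_ge0 => z _; rewrite lee_fin divr_ge0 ?wmin_ge0 ?powR_ge0.
  move: H; set I := (\int[lam]_z _); case: I => [r _ _|H _|_]; rewrite ?ltry//.
  by move: H; rewrite mulyr gtr0_sg// mul1e.
rewrite wmin_weight_swap.
pose X (s : measurableTypeR R) := \int[lam]_z (wmin z * (sw s * gauss s z))%:E.
have mX : measurable_fun setT X.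
  exact: (@measurable_fun_fubini_tonelli_G _ _ 'rV[R]_n (measurableTypeR R) R lam wsw).
have X0 s : 0 <= X s.
  by apply: integral_ge0 => z _; exact: (wsw_ge0 (z, s)).
have XE s : (0 < s)%R -> X s <= (sbound (n := n) al s)%:E.
  move=> s0; have [wi wle] := wmin_gauss_le (n := n) s0.
  have -> : X s = (sw s * \int[lam]_z (wmin z * gauss s z))%:E.
    rewrite /X -RintegralZl// -EFin_Rintegral//; last first.
      exact: (integrableZl measurableT (sw s) wi).
    by apply: eq_integral => z _; congr EFin; ring.
  by rewrite lee_fin /sbound ler_wpM2l ?sweight_ge0.
have -> : \int[leb]_s X s = \int[leb]_(s in `]0%R, +oo[) X s.
  rewrite [RHS]integral_mkcond; apply: (@eq_integral _ (measurableTypeR R) R leb setT) => s _.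
  rewrite patchE; case: ifPn => //; rewrite notin_setE /= in_itv/= andbT => /negP.
  rewrite -leNgt => s0; rewrite /X integral0_eq// => z _.
  by rewrite /sweight ltNge s0/= mul0r mulr0.
rewrite itv0y_split// lte_add_pinfty//.
  apply: (@le_lt_trans _ _ (\int[leb]_(s in `]0%R, 1%R]) (sb_const * s `^ (al / 2 - 1))%:E)).
    apply: ge0_le_integral => //.
    - exact: measurable_funTS.
    - apply/measurable_EFinP; apply: measurable_funTS; exact: measurable_funM.
    move=> s; rewrite /= in_itv/= => /andP[s0 _].
    by rewrite (le_trans (XE s s0))// lee_fin sbound_le1.
  under eq_integral => s _ do rewrite EFinM.
  rewrite ge0_integralZl_EFin ?sb_const_ge0//; last 2 first.
  - by move=> s _; rewrite lee_fin powR_ge0.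
  - exact: measurable_powR_E.
  by rewrite integral_powR01 ?divr_gt0//; [rewrite -EFinM ltry|case/andP: al01].
apply: (@le_lt_trans _ _ (\int[leb]_(s in `]1%R, +oo[) (sb_const * s `^ (- gap - 1))%:E)).
  apply: ge0_le_integral => //.
  - exact: measurable_funTS.
  - apply/measurable_EFinP; apply: measurable_funTS; exact: measurable_funM.
  move=> s; rewrite /= in_itv/= andbT => s1; have s0 := lt_trans ltr01 s1.
  by rewrite (le_trans (XE s s0))// lee_fin sbound_le2.
under eq_integral => s _ do rewrite EFinM.
rewrite ge0_integralZl_EFin ?sb_const_ge0//; last 2 first.
- by move=> s _; rewrite lee_fin powR_ge0.
- exact: measurable_powR_E.
by rewrite integral_powR1y ?gap_gt0// -EFinM ltry.
Qed.

Local Close Scope ereal_scope.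

(** Signed version of the swap, with [wmin_weight_integrable] as the majorant for Fubini. It turns a
    pairing with the kernel into a superposition of Gaussian integrals. *)
Lemma weight_swap (q : 'rV[R]_n -> R) (C : R) : continuous q ->
  (forall z, `|q z| <= C * wmin z) ->
  [/\ lam.-integrable setT (EFin \o (fun z => q z / pw z)),
      leb.-integrable setT (fun s => (sw s * \int[lam]_z (q z * gauss s z))%:E) &
      Gamma beta * \int[lam]_z (q z / pw z) =
      \int[leb]_s (sw s * \int[lam]_z (q z * gauss s z))].
Proof.
move=> cq qC.
have C0 : 0 <= `|C| by [].
have {}qC z : `|q z| <= `|C| * wmin z.
  by rewrite (le_trans (qC z))// ler_wpM2r ?wmin_ge0// ler_norm.
have q0 : q 0 = 0 by apply/eqP; rewrite -normr_le0 (le_trans (qC 0))// wmin0 mulr0.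
have G0 : 0 < Gamma beta by rewrite Gamma_gt0// beta_gt0.
have wi := wmin_weight_integrable.
have mq : measurable_fun setT q by exact: rV_continuous_measurable.
have qi : lam.-integrable setT (EFin \o (fun z => q z / pw z)).
  have := integrableZl measurableT `|C| wi; apply: le_integrable => //.
    by apply/measurable_EFinP; apply: measurable_funM => //; exact: measurable_pw.
  move=> z _ /=; rewrite lee_fin normrM [`|_^-1|]ger0_norm ?invr_ge0 ?powR_ge0//.
  rewrite [leRHS]ger0_norm; last by rewrite mulr_ge0// divr_ge0 ?wmin_ge0 ?powR_ge0.
  by rewrite mulrA ler_wpM2r ?invr_ge0 ?powR_ge0.
pose f (p : measurableTypeR R * 'rV[R]_n) := q p.2 * (sw p.1 * gauss p.1 p.2).
have mf : measurable_fun setT f.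
  apply: measurable_funM; last exact: measurable_sw_gauss.
  exact: (measurableT_comp mq measurable_snd).
have qgi s : 0 < s -> lam.-integrable setT (EFin \o (fun z => q z * gauss s z)).
  move=> s0; have [wgi _] := wmin_gauss_le (n := n) s0.
  have := integrableZl measurableT `|C| wgi; apply: le_integrable => //.
    apply: measurable_EFin_cont; apply: rV_contM => //; exact: continuous_gauss.
  move=> z _ /=; rewrite lee_fin normrM (ger0_norm (ltW (gauss_gt0 _ _))).
  rewrite [leRHS]ger0_norm; last by rewrite mulr_ge0// mulr_ge0 ?wmin_ge0 ?(ltW (gauss_gt0 _ _)).
  by rewrite mulrA ler_wpM2r// ltW// gauss_gt0.
have f1 s : lam.-integrable setT (fun z => (f (s, z))%:E).
  rewrite /f /=; case: (ltP 0 s) => s0; last first.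
    rewrite (_ : (fun z => _) = cst 0%E); first exact: integrable0.
    by apply/funext => z; rewrite /sweight ltNge s0/= mul0r mulr0.
  have := integrableZl measurableT (sw s) (qgi s s0).
  by apply: eq_integrable => // z _; rewrite /= -EFinM; congr EFin; ring.
have sgi (z : 'rV[R]_n) : z != 0 -> leb.-integrable setT (fun s => (sw s * gauss s z)%:E).
  move=> z0; apply/integrableP; split.
    by apply/measurable_EFinP; exact: measurable_sw_gauss_s.
  under eq_integral => s _.
    rewrite /= ger0_norm; last by rewrite mulr_ge0 ?sweight_ge0// ltW// gauss_gt0.
    over.
  by rewrite /= (integral_sweight_gauss al01 z0) ltry.
have f2 z : leb.-integrable setT (fun s => (f (s, z))%:E).
  rewrite /f /=; have [->|z0] := eqVneq z 0.
    rewrite (_ : (fun s => _) = cst 0%E); first exact: integrable0.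
    by apply/funext => s; rewrite q0 mul0r.
  exact: (integrableZl measurableT (q z) (sgi z z0)).
have sE (z : 'rV[R]_n) : z != 0 -> \int[leb]_s (sw s * gauss s z) = Gamma beta / pw z.
  by move=> z0; rewrite /Rintegral (integral_sweight_gauss al01 z0).
pose B (z : 'rV[R]_n) := `|C| * Gamma beta * (wmin z / pw z).
have Bi : lam.-integrable setT (EFin \o B).
  exact: (integrableZl measurableT (`|C| * Gamma beta) wi).
have fB (z : 'rV[R]_n) : \int[leb]_s `|f (s, z)| <= B z.
  rewrite /f /B /=; have [->|z0] := eqVneq z 0.
    rewrite wmin0 mul0r mulr0 q0; under eq_Rintegral do rewrite mul0r normr0.
    by rewrite Rintegral_cst// mul0r.
  under eq_Rintegral => s _.
    rewrite normrM [`|sw s * _|]ger0_norm; last by rewrite mulr_ge0 ?sweight_ge0// ltW// gauss_gt0.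
    over.
  rewrite RintegralZl//=; last exact: sgi.
  rewrite sE//.
  have -> : `|C| * Gamma beta * (wmin z / pw z) = (`|C| * wmin z) * (Gamma beta / pw z).
    by ring.
  by rewrite ler_wpM2r// divr_ge0 ?powR_ge0// ltW.
have [Hs Hz E] := Rintegral_Fubini (m1 := leb) (m2 := lam) mf f1 f2 Bi fB.
have sE' s : \int[lam]_z f (s, z) = sw s * \int[lam]_z (q z * gauss s z).
  rewrite /f /=; case: (ltP 0 s) => s0; last first.
    rewrite /sweight ltNge s0/= mul0r; under eq_Rintegral do rewrite mul0r mulr0.
    by rewrite Rintegral_cst// mul0r.
  rewrite -RintegralZl//; last exact: qgi.
  by apply: eq_Rintegral => z _; ring.
split => //.
  by move: Hs; apply: eq_integrable => // s _; rewrite sE'.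
transitivity (\int[lam]_z \int[leb]_s f (s, z)).
  rewrite -RintegralZl//; apply: eq_Rintegral => z _; rewrite /f /=.
  have [->|z0] := eqVneq z 0.
    rewrite q0 mul0r mulr0; under eq_Rintegral do rewrite mul0r.
    by rewrite Rintegral_cst// mul0r.
  rewrite RintegralZl//; last exact: sgi.
  by rewrite sE//; ring.
by rewrite -E; apply: eq_Rintegral => s _.
Qed.

End riesz_swap.

(** * Correlations and integration by parts against a Gaussian *)

Section correlation.
Context {R : realType} {n : nat}.
Local Notation lam := (lebesgue_borel R n).
Local Notation e_ i := (delta_mx 0 i : 'rV[R]_n).
Implicit Types (u f w : 'rV[R]_n -> R).

Definition corr u f (z : 'rV[R]_n) : R := \int[lam]_x (u x * f (x + z)).

Lemma integrable_bmul u f : measurable_fun setT u -> (forall x, `|u x| <= 1) ->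
  lam.-integrable setT (EFin \o f) ->
  lam.-integrable setT (EFin \o (fun x => u x * f x)).
Proof.
move=> mu u1 fi; apply: le_integrable (fi) => //.
  apply/measurable_EFinP; apply: measurable_funM => //.
  by apply/measurable_EFinP; exact: measurable_int fi.
by move=> x _ /=; rewrite lee_fin normrM ler_piMl.
Qed.

Lemma Rintegral_bmul_le u f : measurable_fun setT u -> (forall x, `|u x| <= 1) ->
  lam.-integrable setT (EFin \o f) ->
  `|\int[lam]_x (u x * f x)| <= \int[lam]_x `|f x|.
Proof.
move=> mu u1 fi; apply: Rintegral_le_abs.
- exact: integrable_bmul.
- exact: integrable_normr.
- by move=> x; rewrite normrM ler_piMl.
Qed.

Lemma corr_le M u f z : measurable_fun setT u -> (forall x, `|u x| <= 1) ->
  continuous f -> bsupp M f -> `|corr u f z| <= \int[lam]_x `|f x|.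
Proof.
move=> mu u1 cf Hf.
apply: le_trans (Rintegral_bmul_le mu u1 (integrable_shift_cc z cf Hf)) _.
rewrite (Rintegral_shift z (f := fun x => `|f x|))//.
by apply: measurableT_comp => //; exact: rV_continuous_measurable.
Qed.

(** The constant depends on f only. This uniformity is what later allows u to be the indicator of a
    set that varies with alpha. *)
Lemma corr_increment M f : Cks 1 f -> bsupp M f ->
  exists2 C : R, 0 <= C & forall u, measurable_fun setT u ->
    (forall x, `|u x| <= 1) ->
    forall z z', `|corr u f z - corr u f z'| <= C * Num.min 1 (enorm (z - z')).
Proof.
move=> Cf Hf; have cf := Cks_continuous Cf.
have [C C0 HC] := C1_L1_increment Cf Hf; exists C => // u mu u1 z z'.
have i1 := integrable_bmul mu u1 (integrable_shift_cc z cf Hf).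
have i2 := integrable_bmul mu u1 (integrable_shift_cc z' cf Hf).
rewrite /corr -RintegralB//.
have di : lam.-integrable setT (EFin \o (fun x => f (x + z) - f (x + z'))).
  exact: (integrableB measurableT (integrable_shift_cc z cf Hf) (integrable_shift_cc z' cf Hf)).
rewrite (_ : \int[lam]_x _ = \int[lam]_x (u x * (f (x + z) - f (x + z')))); last first.
  by apply: eq_Rintegral => x _; rewrite mulrBr.
apply: le_trans (Rintegral_bmul_le mu u1 di) _.
apply: le_trans (HC (z - z')).
rewrite -(Rintegral_shift z' (f := fun x => `|f (x + (z - z')) - f x|)); last first.
  apply: measurableT_comp => //; apply: rV_continuous_measurable.
  apply: rV_contD; first exact: continuous_shift_arg.
  exact: rV_contN.
rewrite le_eqVlt; apply/orP; left; apply/eqP; apply: eq_Rintegral => x _.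
by rewrite -addrA [z' + _]addrC subrK.
Qed.

Lemma corr_continuous M u f : Cks 1 f -> bsupp M f -> measurable_fun setT u ->
  (forall x, `|u x| <= 1) -> continuous (corr u f).
Proof.
move=> Cf Hf mu u1; have [C C0 HC] := corr_increment Cf Hf.
apply/rV_contP => x e e0; exists (e / (C * n%:R + 1)).
  by rewrite divr_gt0// ltr_wpDl// mulr_ge0.
move=> y yx; apply: le_lt_trans (HC u mu u1 x y) _.
apply: (@le_lt_trans _ _ (C * (n%:R * `|y - x|))).
  rewrite ler_wpM2l// (le_trans _ (enorm_le_norm _))// -enormN opprB.
  by rewrite ge_min lexx orbT.
move: yx; rewrite ltr_pdivlMr ?ltr_wpDl ?mulr_ge0// => /le_lt_trans; apply.
by rewrite mulrDr mulr1 mulrA mulrC lerDl.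
Qed.

Lemma corr_Fubini M u f w : measurable_fun setT u -> (forall x, `|u x| <= 1) ->
  continuous f -> bsupp M f -> lam.-integrable setT (EFin \o w) ->
  \int[lam]_z (corr u f z * w z) = \int[lam]_x (u x * \int[lam]_z (f (x + z) * w z)).
Proof.
move=> mu u1 cf Hf wi.
have mf : measurable_fun setT f by exact: rV_continuous_measurable.
have mw : measurable_fun setT w by apply/measurable_EFinP; exact: measurable_int wi.
pose F (p : 'rV[R]_n * 'rV[R]_n) := u p.1 * (f (p.1 + p.2) * w p.2).
have mF : measurable_fun setT F.
  apply: measurable_funM; first exact: (measurableT_comp mu measurable_fst).
  apply: measurable_funM; last exact: (measurableT_comp mw measurable_snd).
  exact: (measurableT_comp mf (@measurable_pair_add R n)).
have [C C0 HC] := bsupp_bounded cf Hf.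
have fwi x : lam.-integrable setT (EFin \o (fun z => f (x + z) * w z)).
  apply: le_integrable (integrableZl measurableT C wi) => //.
    apply/measurable_EFinP; apply: measurable_funM => //.
    apply: rV_continuous_measurable.
    rewrite (_ : (fun z => _) = (fun z => f (z + x))).
      exact: continuous_shift_arg.
    by apply/funext => z; rewrite addrC.
  by move=> z _ /=; rewrite lee_fin !normrM ler_wpM2r// (le_trans (HC _))// ler_norm.
have f1 x : lam.-integrable setT (fun z => (F (x, z))%:E).
  exact: (integrableZl measurableT (u x) (fwi x)).
have ci z := integrable_bmul mu u1 (integrable_shift_cc z cf Hf).
have f2 z : lam.-integrable setT (fun x => (F (x, z))%:E).
  have := integrableZl measurableT (w z) (ci z).
  by apply: eq_integrable => // x _; rewrite /F /= -EFinM; congr EFin; ring.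
pose I := \int[lam]_x `|f x|.
have Bi : lam.-integrable setT (EFin \o (fun z => I * `|w z|)).
  exact: (integrableZl measurableT I (integrable_normr wi)).
have FB z : \int[lam]_x `|F (x, z)| <= I * `|w z|.
  apply: (@le_trans _ _ (\int[lam]_x (`|w z| * `|f (x + z)|))).
    apply: le_Rintegral => //.
    - exact: (integrable_normr (f2 z)).
    - exact: (integrableZl measurableT `|w z| (integrable_normr (integrable_shift_cc z cf Hf))).
    move=> x _; rewrite /F /= !normrM [`|w z| * _]mulrC.
    by apply: ler_piMl; rewrite ?mulr_ge0.
  rewrite RintegralZl//; last exact: (integrable_normr (integrable_shift_cc z cf Hf)).
  rewrite (Rintegral_shift z (f := fun x => `|f x|)) 1?mulrC//.
  exact: measurableT_comp.
have [_ _ E] := Rintegral_Fubini (m1 := lam) (m2 := lam) mF f1 f2 Bi FB.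
transitivity (\int[lam]_z \int[lam]_x F (x, z)).
  apply: eq_Rintegral => z _; rewrite /corr mulrC -RintegralZl//.
  by apply: eq_Rintegral => x _; rewrite /F /=; ring.
rewrite -E; apply: eq_Rintegral => x _.
by rewrite -RintegralZl.
Qed.

Lemma integrable_corr M u f w : measurable_fun setT u -> (forall x, `|u x| <= 1) ->
  Cks 1 f -> bsupp M f -> lam.-integrable setT (EFin \o w) ->
  lam.-integrable setT (EFin \o (fun z => corr u f z * w z)).
Proof.
move=> mu u1 Cf Hf wi; pose I := \int[lam]_x `|f x|.
apply: le_integrable (integrableZl measurableT I wi) => //.
  apply/measurable_EFinP; apply: measurable_funM; last first.
    by apply/measurable_EFinP; exact: measurable_int wi.
  by apply: rV_continuous_measurable; exact: (corr_continuous Cf Hf).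
move=> z _ /=; rewrite lee_fin !normrM ler_wpM2r//.
by rewrite (le_trans (corr_le _ mu u1 (Cks_continuous Cf) Hf))// ler_norm.
Qed.

Lemma is_derive_line0 (g : 'rV[R]_n -> R) (x v : 'rV[R]_n) (c : R) :
  is_derive (0 : R) 1 (fun t : R => g (x + t *: v)) c -> is_derive x v g c.
Proof.
have lineE : (fun t : R => t^-1 *: ((g \o shift x) (t *: v) - g x)) =
    (fun t : R => t^-1 *: (((fun s : R => g (x + s *: v)) \o shift 0) (t *: 1) - g (x + 0 *: v))).
  apply/funext => t /=; congr (_ *: (g _ - g _)); rewrite /shift /=.
    by rewrite addr0 [t *: 1]mulr1 addrC.
  by rewrite scale0r addr0.
case=> D E; split; first by rewrite /derivable lineE.
by rewrite -E /derive lineE.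
Qed.

(** Only a derivative in the direction v is given, so the one-variable chain rule is applied on the
    line x + t v. *)
Lemma is_derive_scalar_comp (h : R -> R) f (x v : 'rV[R]_n) (d d' : R) :
  is_derive (f x) 1 h d' -> is_derive x v f d ->
  is_derive x v (fun y => h (f y)) (d' * d).
Proof.
move=> hd fd; apply: is_derive_line0.
have fl : is_derive (0 : R) 1 (fun t : R => f (x + t *: v)) d.
  by apply: is_derive_line; rewrite scale0r addr0.
apply: (@is_derive1_comp _ h (fun t : R => f (x + t *: v))).
by rewrite scale0r addr0.
Qed.

Lemma is_derive_gauss (s : R) (z : 'rV[R]_n) i :
  is_derive z (e_ i) (gauss s) (- (2 * s) * (z 0 i * gauss s z)).
Proof.
have D : is_derive z (e_ i) (fun z : 'rV[R]_n => - (s * dotp z z)) (- (2 * s * z 0 i)).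
  pose F := \sum_(j < n) (fun z : 'rV[R]_n => z 0 j * z 0 j).
  have FE : (fun z : 'rV[R]_n => - (s * dotp z z)) = - (s *: F).
    by apply/funext => y; rewrite /F /dotp !fctE /GRing.scale/= fct_sumE.
  rewrite FE; apply: is_derive_eq.
    apply: is_deriveN; apply: is_deriveZ; apply: is_derive_sum => j.
    by apply: is_deriveM; exact: is_derive_coor.
  rewrite /= (bigD1 i)//= big1 => [|j ji]; last first.
    by rewrite !mxE eqxx (negbTE ji) !scaler0 addr0.
  by rewrite !mxE !eqxx/= /GRing.scale/=; ring.
rewrite /gauss; apply: is_derive_eq.
  by apply: is_derive_scalar_comp D; exact: is_derive_expR.
by ring.
Qed.

(** After Fubini the integration by parts takes place for fixed x on z -> f(x + z) w(z), which has
    compact support thanks to f; [corr u f] itself is never differentiated. *)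
Lemma corr_parts M u f i (w w' : 'rV[R]_n -> R) : measurable_fun setT u ->
  (forall x, `|u x| <= 1) -> Cks 1 f -> bsupp M f ->
  (forall z, is_derive z (e_ i) w (w' z)) -> continuous w -> continuous w' ->
  lam.-integrable setT (EFin \o w) -> lam.-integrable setT (EFin \o w') ->
  \int[lam]_z (corr u ('D_(e_ i) f) z * w z) = - \int[lam]_z (corr u f z * w' z).
Proof.
move=> mu u1 Cf Hf Dw cw cw' wi w'i; have cf := Cks_continuous Cf.
have cD : continuous ('D_(e_ i) f) by exact: Cks_continuous (Cks_derive i Cf).
have Nw'i : lam.-integrable setT (EFin \o (fun z => - w' z)).
  have := integrableZl measurableT (-1) w'i; apply: eq_integrable => // z _ /=.
  by rewrite EFinN mulN1e.
transitivity (\int[lam]_z (corr u f z * - w' z)); last first.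
  rewrite -[RHS]mulN1r -(RintegralZl (-1) measurableT (integrable_corr mu u1 Cf Hf w'i)).
  by apply: eq_Rintegral => z _; rewrite mulN1r mulrN.
rewrite (corr_Fubini mu u1 cf Hf Nw'i) (corr_Fubini mu u1 cD (bsupp_derive (e_ i) Hf) wi).
apply: eq_Rintegral => x _; congr (_ * _).
have fxz (z : 'rV[R]_n) : is_derive z (e_ i) (fun z => f (x + z)) ('D_(e_ i) f (x + z)).
  rewrite (_ : (fun z => f (x + z)) = fun z => f (z + x)); last first.
    by apply/funext => y; rewrite addrC.
  apply: is_derive_shift_arg; rewrite [x + z]addrC; apply: derivableP.
  exact: C1_derivable.
have cfx (g : 'rV[R]_n -> R) : continuous g -> continuous (fun z => g (x + z)).
  move=> cg; rewrite (_ : (fun z => g (x + z)) = fun z => g (z + x)); last first.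
    by apply/funext => y; rewrite addrC.
  exact: continuous_shift_arg.
have bf (h : 'rV[R]_n -> R) M' : bsupp M' h -> bsupp (M' + `|x|) (fun z => h (x + z)).
  by move=> Hh z Mz; rewrite addrC; exact: (bsupp_shift Hh).
pose g (z : 'rV[R]_n) := f (x + z) * w z.
have Dg (z : 'rV[R]_n) : is_derive z (e_ i) g (f (x + z) * w' z + 'D_(e_ i) f (x + z) * w z).
  apply: is_derive_eq (is_deriveM (fxz z) (Dw z)) _.
  by rewrite /GRing.scale/= [w z * _]mulrC.
have bg : bsupp (M + `|x|) g by move=> z Mz; rewrite /g (bf _ _ Hf)// mul0r.
have c1 : continuous (fun z => f (x + z) * w' z) by apply: rV_contM; [exact: (cfx _ cf)|].
have c2 : continuous (fun z => 'D_(e_ i) f (x + z) * w z).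
  by apply: rV_contM; [exact: (cfx _ cD)|].
have i1 : lam.-integrable setT (EFin \o (fun z => f (x + z) * w' z)).
  by apply: (@cc_integrable _ _ (M + `|x|)) => // z Mz; rewrite (bf _ _ Hf)// mul0r.
have i2 : lam.-integrable setT (EFin \o (fun z => 'D_(e_ i) f (x + z) * w z)).
  apply: (@cc_integrable _ _ (M + 1 + `|x|)) => // z Mz.
  by rewrite (bf _ _ (bsupp_derive (e_ i) Hf))// mul0r.
have DgE : 'D_(e_ i) g = fun z => f (x + z) * w' z + 'D_(e_ i) f (x + z) * w z.
  by apply/funext => z; apply: derive_val.
have := integral_derive0 (f := g) (v := e_ i) (M := M + `|x|).
rewrite DgE => /(_ _ _ _ bg) H.
have : \int[lam]_z (f (x + z) * w' z + 'D_(e_ i) f (x + z) * w z) = 0.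
  apply: H.
  - by apply: rV_contM; [exact: (cfx _ cf)|].
  - by move=> z; have [] := Dg z.
  - exact: rV_contD.
rewrite (RintegralD measurableT i1 i2) => /eqP; rewrite addrC addr_eq0 => /eqP ->.
rewrite -[LHS]mulN1r -(RintegralZl (-1) measurableT i1).
by apply: eq_Rintegral => z _; rewrite mulN1r mulrN.
Qed.

Lemma integrable_coor_gauss i (s : R) : 0 < s ->
  lam.-integrable setT (EFin \o (fun z : 'rV[R]_n => z 0 i * gauss s z)).
Proof.
move=> s0; apply: le_integrable (integrable_moment n 1 s0) => //.
  by apply: measurable_EFin_cont; apply: rV_contM;
    [exact: continuous_coor|exact: continuous_gauss].
move=> z _ /=; rewrite lee_fin !normrM ler_wpM2r//.
by rewrite expr1 (le_trans (coor_le_enorm z i))// ler_norm.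
Qed.

(** [corr_parts] with the Gaussian as w, whose i-th partial derivative is -2 s z_i times itself. *)
Lemma corr_gauss M u f i (s : R) : measurable_fun setT u -> (forall x, `|u x| <= 1) ->
  Cks 1 f -> bsupp M f -> 0 < s ->
  2 * s * \int[lam]_z (corr u f z * (z 0 i * gauss s z)) =
  \int[lam]_z (corr u ('D_(e_ i) f) z * gauss s z).
Proof.
move=> mu u1 Cf Hf s0.
have zgi := integrable_coor_gauss i s0.
have ci := integrable_corr mu u1 Cf Hf zgi.
have cw : continuous (fun z : 'rV[R]_n => - (2 * s) * (z 0 i * gauss s z)).
  apply: rV_contM; first exact: rV_contC.
  by apply: rV_contM; [exact: continuous_coor|exact: continuous_gauss].
rewrite (corr_parts mu u1 Cf Hf (fun z => is_derive_gauss s z i) (@continuous_gauss R n s) cw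
  (integrable_gauss n s0) (integrableZl measurableT (- (2 * s)) zgi)).
transitivity (- \int[lam]_z (- (2 * s) * (corr u f z * (z 0 i * gauss s z)))).
  by rewrite (RintegralZl (- (2 * s)) measurableT ci) mulNr opprK.
by congr (- _); apply: eq_Rintegral => z _; rewrite mulrCA.
Qed.

End correlation.

Section Rintegral_sums.
Context d (T : measurableType d) (R : realType) (mu : {measure set T -> \bar R}).

Lemma integrable_sum_fun (I : Type) (r : seq I) (F : I -> T -> R) :
  (forall i, mu.-integrable setT (EFin \o F i)) ->
  mu.-integrable setT (EFin \o (fun x => \sum_(i <- r) F i x)).
Proof.
move=> Fi; elim: r => [|i r IH].
  under eq_fun do rewrite big_nil; exact: integrable0.
under eq_fun do rewrite big_cons; exact: (integrableD measurableT (Fi i) IH).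
Qed.

Lemma Rintegral_sum (I : Type) (r : seq I) (F : I -> T -> R) :
  (forall i, mu.-integrable setT (EFin \o F i)) ->
  \int[mu]_x (\sum_(i <- r) F i x) = \sum_(i <- r) \int[mu]_x F i x.
Proof.
move=> Fi; elim: r => [|i r IH].
  by rewrite big_nil; under eq_Rintegral do rewrite big_nil; rewrite Rintegral_cst// mul0r.
rewrite big_cons -IH -RintegralD//; last exact: integrable_sum_fun.
by apply: eq_Rintegral => x _; rewrite big_cons.
Qed.

End Rintegral_sums.

Section riesz_representation.
Context {R : realType} {n : nat}.
Local Notation lam := (lebesgue_borel R n).
Local Notation leb := (@lebesgue_measure R).
Local Notation e_ i := (delta_mx 0 i : 'rV[R]_n).
Implicit Types (u : 'rV[R]_n -> R) (phi : 'rV[R]_n -> 'rV[R]_n).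

(** Working notion of test field: the domain and the bound by 1 are dropped, and a radius in the sup
    norm is made explicit. *)
Definition cc_field M phi :=
  forall i, (forall k, Cks k (fun x => phi x 0 i)) /\ bsupp M (fun x => phi x 0 i).

(* int u(x) z . (phi(x + z) - phi(x)) dx, written coordinatewise. *)
Definition moment_diff u phi (z : 'rV[R]_n) : R :=
  \sum_i z 0 i * (corr u (fun x => phi x 0 i) z - corr u (fun x => phi x 0 i) 0).

(** The factor 2 accounts for the two correlations in an increment, each bounded by the L^1 norm of
    the component. *)
Definition mass phi : R := \sum_i 2 * \int[lam]_x `|phi x 0 i|.

Lemma divE M phi : cc_field M phi ->
  div phi = fun x => \sum_i 'D_(e_ i) (fun x => phi x 0 i) x.
Proof.
move=> Hphi; apply/funext => x; apply: eq_bigr => i _.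
rewrite derive_mx ?mxE//; apply/derivable_mxP => a j; rewrite (ord1 a).
exact: (@Cks_derivable R n 0 _ i x ((Hphi j).1 1%N)).
Qed.

Lemma moment_diff_le M phi u z : cc_field M phi -> measurable_fun setT u ->
  (forall x, `|u x| <= 1) -> `|moment_diff u phi z| <= mass phi * enorm z.
Proof.
move=> Hphi mu u1; rewrite /moment_diff /mass mulr_suml.
apply: le_trans (ler_norm_sum _ _ _) _; apply: ler_sum => i _.
have [/(_ 0%N) cf Hf] := Hphi i.
rewrite normrM mulrC ler_pM// ?coor_le_enorm// (le_trans (ler_normB _ _))//.
have := corr_le z mu u1 cf Hf; have := corr_le 0 mu u1 cf Hf; lra.
Qed.

Lemma moment_diff_wmin M phi : cc_field M phi ->
  exists2 C : R, 0 <= C & forall u, measurable_fun setT u ->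
    (forall x, `|u x| <= 1) -> forall z, `|moment_diff u phi z| <= C * wmin z.
Proof.
move=> Hphi.
have H i := corr_increment ((Hphi i).1 1%N) (Hphi i).2.
pose C i := s2val (cid2 (H i)).
have C0 i : 0 <= C i by rewrite /C; case: cid2.
exists (\sum_i C i) => [|u mu u1 z]; first exact: sumr_ge0.
rewrite /moment_diff mulr_suml.
apply: le_trans (ler_norm_sum _ _ _) _; apply: ler_sum => i _.
rewrite normrM /wmin mulrCA ler_pM ?coor_le_enorm//.
rewrite /C; case: cid2 => /= c c0 /(_ u mu u1 z 0).
by rewrite subr0.
Qed.

Lemma moment_diff_continuous M phi u : cc_field M phi -> measurable_fun setT u ->
  (forall x, `|u x| <= 1) -> continuous (moment_diff u phi).
Proof.
move=> Hphi mu u1; apply: rV_cont_sum => i.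
apply: rV_contM; first exact: continuous_coor.
apply: rV_contD; last exact: rV_contC.
exact: (corr_continuous ((Hphi i).1 1%N) (Hphi i).2).
Qed.

(** The values at 0 contribute nothing because z_i times the Gaussian is odd; the rest is
    [corr_gauss] summed over i. The factor 2 s will be absorbed by the weight in s. *)
Lemma moment_diff_gauss M phi u (s : R) : cc_field M phi -> measurable_fun setT u ->
  (forall x, `|u x| <= 1) -> 0 < s ->
  2 * s * \int[lam]_z (moment_diff u phi z * gauss s z) =
  \int[lam]_z (corr u (div phi) z * gauss s z).
Proof.
move=> Hphi mu u1 s0.
have zgi (i : 'I_n) := @integrable_coor_gauss R n i s s0.
have zg0 i : \int[lam]_z (z 0 i * gauss s z) = 0.
  have : \int[lam]_z (z 0 i * gauss s z) = - \int[lam]_z (z 0 i * gauss s z).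
    rewrite -[LHS]Rintegral_opp; last first.
      by apply/measurable_EFinP; exact: measurable_int (zgi i).
    rewrite -mulN1r -RintegralZl//; apply: eq_Rintegral => z _.
    rewrite /gauss mxE !mulNr mul1r; congr (- (_ * expR (- (_ * _)))).
    by rewrite -scaleN1r dotpZl dotpC dotpZl mulrA mulN1r opprK mul1r.
  lra.
have ci i := integrable_corr mu u1 ((Hphi i).1 1%N) (Hphi i).2 (zgi i).
have di i : lam.-integrable setT
    (EFin \o (fun z => corr u ('D_(e_ i) (fun x => phi x 0 i)) z * gauss s z)).
  apply: (integrable_corr mu u1 _ (bsupp_derive (e_ i) (Hphi i).2) (integrable_gauss n s0)).
  exact: Cks_derive ((Hphi i).1 2%N).
have i0 i : lam.-integrable setT
    (EFin \o (fun z : 'rV[R]_n => corr u (fun x => phi x 0 i) 0 * (z 0 i * gauss s z))).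
  exact: (integrableZl measurableT _ (zgi i)).
have E1 : \int[lam]_z (moment_diff u phi z * gauss s z) =
    \sum_i \int[lam]_z (corr u (fun x => phi x 0 i) z * (z 0 i * gauss s z)).
  rewrite (_ : \int[lam]_z _ = \int[lam]_z (\sum_i
    (corr u (fun x => phi x 0 i) z * (z 0 i * gauss s z) -
     corr u (fun x => phi x 0 i) 0 * (z 0 i * gauss s z)))); last first.
    apply: eq_Rintegral => z _; rewrite /moment_diff mulr_suml.
    by apply: eq_bigr => i _; ring.
  rewrite Rintegral_sum//; last first.
    by move=> i; exact: (integrableB measurableT (ci i) (i0 i)).
  apply: eq_bigr => i _; rewrite RintegralB//.
  by rewrite RintegralZl// zg0 mulr0 subr0.
rewrite E1 mulr_sumr.
have E2 : corr u (div phi) = fun z => \sum_i corr u ('D_(e_ i) (fun x => phi x 0 i)) z.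
  apply/funext => z; rewrite (divE Hphi) /corr -Rintegral_sum//.
    by apply: eq_Rintegral => x _; rewrite mulr_sumr.
  move=> i; apply: integrable_bmul => //.
  apply: (integrable_shift_cc z _ (bsupp_derive (e_ i) (Hphi i).2)).
  exact: Cks_continuous (Cks_derive i ((Hphi i).1 1%N)).
rewrite E2; under [RHS]eq_Rintegral do rewrite mulr_suml.
rewrite Rintegral_sum//; apply: eq_bigr => i _.
by rewrite (corr_gauss i mu u1 ((Hphi i).1 1%N) (Hphi i).2).
Qed.

(** The translation y = x + z, performed for the Borel measure, together with the passage from the
    completed measure of the definition. *)
Lemma frac_divE al M phi x : cc_field M phi ->
  frac_div al phi x = frac_const (n := n) al *
    \int[lam]_z (dotp z (phi (x + z) - phi x) / enorm z `^ (n%:R + al + 1)).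
Proof.
move=> Hphi; rewrite /frac_div; congr (_ * _).
have cphi : continuous (fun z => phi (x + z) - phi x).
  apply/continuous_rVP => j.
  rewrite (_ : (fun z => _) = fun z => (fun w => phi w 0 j) (z + x) + - phi x 0 j).
    apply: rV_contD; last exact: rV_contC.
    exact: continuous_shift_arg ((Hphi j).1 0%N).
  by apply/funext => z; rewrite !mxE (addrC z x).
pose g z := dotp z (phi (x + z) - phi x) / enorm z `^ (n%:R + al + 1).
have mg : measurable_fun setT g.
  apply: measurable_funM.
    by apply: rV_continuous_measurable; apply: continuous_dotp => //; exact: rV_cont_id.
  rewrite (_ : (fun z => _) = fun z => (enorm z) `^ (- (n%:R + al + 1))); last first.
    by apply/funext => z; rewrite powRN.
  apply: (measurableT_comp (measurable_powR _)).
  by apply: rV_continuous_measurable; exact: continuous_enorm.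
rewrite -(Rintegral_shift (- x) mg) /Rintegral -integral_lebesgue_borel; last first.
  apply/measurable_EFinP.
  exact: (measurableT_comp mg (measurable_shift (- x))).
congr fine; apply: eq_integral => y _; rewrite /g.
by rewrite [x + (y - x)]addrC subrK.
Qed.

Variable al : R.
Hypothesis al01 : 0 < al < 1.
Local Notation pw z := (enorm z `^ (n%:R + al + 1)).

Lemma corr_diff0 M u f z : measurable_fun setT u -> (forall x, `|u x| <= 1) ->
  continuous f -> bsupp M f ->
  \int[lam]_x (u x * (f (x + z) - f x)) = corr u f z - corr u f 0.
Proof.
move=> mu u1 cf Hf; rewrite /corr -RintegralB//.
- by apply: eq_Rintegral => x _; rewrite addr0 mulrBr.
- exact: (integrable_bmul mu u1 (integrable_shift_cc z cf Hf)).
- exact: (integrable_bmul mu u1 (integrable_shift_cc 0 cf Hf)).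
Qed.

(* Fubini in (x, z): the increments of phi are integrable in x, with norm at
   most C wmin z, which is integrable against the kernel. *)
Lemma frac_div_moment M phi u : cc_field M phi -> measurable_fun setT u ->
  (forall x, `|u x| <= 1) ->
  lam.-integrable setT (EFin \o (fun x => u x * frac_div al phi x)) /\
  \int[lam]_x (u x * frac_div al phi x) =
  frac_const (n := n) al * \int[lam]_z (moment_diff u phi z / pw z).
Proof.
move=> Hphi mu u1.
have wi := wmin_weight_integrable (n := n) al01.
have cphi i : continuous (fun x => phi x 0 i) := (Hphi i).1 0%N.
pose K (p : 'rV[R]_n * 'rV[R]_n) := \sum_i p.2 0 i * (phi (p.1 + p.2) 0 i - phi p.1 0 i).
have KE x z : dotp z (phi (x + z) - phi x) = K (x, z).
  by apply: eq_bigr => i _; rewrite !mxE.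
have mK : measurable_fun setT K.
  apply: measurable_sum => i; apply: measurable_funM.
    exact: (measurableT_comp (measurable_coor i) measurable_snd).
  apply: measurable_funB.
    exact: (measurableT_comp (rV_continuous_measurable (cphi i)) (@measurable_pair_add R n)).
  exact: (measurableT_comp (rV_continuous_measurable (cphi i)) measurable_fst).
have H i := C1_increment_min ((Hphi i).1 1%N) (Hphi i).2.
pose C i := s2val (cid2 (H i)).
have C0 i : 0 <= C i by rewrite /C; case: cid2.
have CH i x z : `|phi (x + z) 0 i - phi x 0 i| <= C i * Num.min 1 (enorm z).
  by rewrite /C; case: cid2 => /= c c0; exact.
have K1 x z : `|K (x, z)| <= (\sum_i C i) * wmin z.
  rewrite /K mulr_suml; apply: le_trans (ler_norm_sum _ _ _) _; apply: ler_sum => i _.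
  by rewrite normrM /wmin mulrCA ler_pM ?coor_le_enorm.
have H' i := C1_L1_increment ((Hphi i).1 1%N) (Hphi i).2.
pose D i := s2val (cid2 (H' i)).
have D0 i : 0 <= D i by rewrite /D; case: cid2.
have DH i z : \int[lam]_x `|phi (x + z) 0 i - phi x 0 i| <= D i * Num.min 1 (enorm z).
  by rewrite /D; case: cid2 => /= c c0; exact.
have di i z := integrable_diff_cc z (cphi i) (Hphi i).2.
have Ki z : lam.-integrable setT (EFin \o (fun x => K (x, z))).
  apply: integrable_sum_fun => i.
  exact: (integrableZl measurableT (z 0 i) (di i z)).
have K2 z : \int[lam]_x `|K (x, z)| <= (\sum_i D i) * wmin z.
  apply: (@le_trans _ _ (\int[lam]_x \sum_i (`|z 0 i| * `|phi (x + z) 0 i - phi x 0 i|))).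
    apply: le_Rintegral => //; first exact: (integrable_normr (Ki z)).
      apply: integrable_sum_fun => i.
      exact: (integrableZl measurableT `|z 0 i| (integrable_normr (di i z))).
    move=> x _; apply: le_trans (ler_norm_sum _ _ _) _.
    by apply: ler_sum => i _; rewrite normrM.
  rewrite Rintegral_sum; last first.
    by move=> i; exact: (integrableZl measurableT `|z 0 i| (integrable_normr (di i z))).
  rewrite mulr_suml; apply: ler_sum => i _.
  rewrite RintegralZl//; last exact: (integrable_normr (di i z)).
  by rewrite /wmin mulrCA ler_pM ?coor_le_enorm// Rintegral_ge0.
pose f p := u p.1 * (K p / pw p.2).
have mf : measurable_fun setT f.
  apply: measurable_funM; first exact: (measurableT_comp mu measurable_fst).
  apply: measurable_funM => //.
  exact: (measurableT_comp (@measurable_pw R n al) measurable_snd).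
have Kzi x : lam.-integrable setT (EFin \o (fun z => K (x, z) / pw z)).
  have := integrableZl measurableT (\sum_i C i) wi; apply: le_integrable => //.
    apply/measurable_EFinP; apply: measurable_funM; last exact: measurable_pw.
    exact: (measurableT_comp mK (measurable_pair1 x)).
  move=> z _ /=; rewrite lee_fin normrM [`|_^-1|]ger0_norm ?invr_ge0 ?powR_ge0//.
  rewrite [leRHS]ger0_norm; last first.
    by rewrite mulr_ge0 ?sumr_ge0// divr_ge0 ?wmin_ge0 ?powR_ge0.
  by rewrite mulrA ler_wpM2r ?invr_ge0 ?powR_ge0.
have f1 x : lam.-integrable setT (fun z => (f (x, z))%:E).
  exact: (integrableZl measurableT (u x) (Kzi x)).
have f2 z : lam.-integrable setT (fun x => (f (x, z))%:E).
  have := integrableZl measurableT (pw z)^-1 (integrable_bmul mu u1 (Ki z)).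
  by apply: eq_integrable => // x _; rewrite /f /= -EFinM; congr EFin; ring.
have Bi := integrableZl measurableT (\sum_i D i) wi.
have fB z : \int[lam]_x `|f (x, z)| <= (\sum_i D i) * (wmin z / pw z).
  apply: (@le_trans _ _ (\int[lam]_x ((pw z)^-1 * `|K (x, z)|))).
    apply: le_Rintegral => //; first exact: (integrable_normr (f2 z)).
      exact: (integrableZl measurableT (pw z)^-1 (integrable_normr (Ki z))).
    move=> x _; rewrite /f /= !normrM [`|_^-1|]ger0_norm ?invr_ge0 ?powR_ge0//.
    by rewrite [X in _ * X]mulrC ler_piMl// mulr_ge0// invr_ge0 powR_ge0.
  rewrite RintegralZl//; last exact: (integrable_normr (Ki z)).
  by rewrite mulrC mulrA ler_wpM2r// invr_ge0 powR_ge0.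
have [F1 F2 E] := Rintegral_Fubini (m1 := lam) (m2 := lam) mf f1 f2 Bi fB.
have E1 x : u x * frac_div al phi x =
    frac_const (n := n) al * \int[lam]_z f (x, z).
  rewrite (frac_divE al x Hphi) mulrCA; congr (_ * _).
  transitivity (u x * \int[lam]_z (K (x, z) / pw z)).
    by congr (_ * _); apply: eq_Rintegral => z _; rewrite KE.
  by rewrite -(RintegralZl (u x) measurableT (Kzi x)).
have E2 : (fun x => u x * frac_div al phi x) =
    fun x => frac_const (n := n) al * \int[lam]_z f (x, z) by apply/funext.
rewrite E2; split; first exact: (integrableZl measurableT _ F1).
rewrite (RintegralZl _ measurableT F1) E; congr (_ * _); apply: eq_Rintegral => z _.
transitivity (\int[lam]_x ((pw z)^-1 * (u x * K (x, z)))).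
  by apply: eq_Rintegral => x _; rewrite /f /=; ring.
rewrite (RintegralZl _ measurableT (integrable_bmul mu u1 (Ki z))).
rewrite mulrC; congr (_ / _); rewrite /moment_diff.
transitivity (\int[lam]_x \sum_i
   (z 0 i * (u x * (phi (x + z) 0 i - phi x 0 i)))).
  apply: eq_Rintegral => x _; rewrite mulr_sumr; apply: eq_bigr => i _.
  by rewrite mulrCA.
rewrite Rintegral_sum; last first.
  by move=> i; exact: (integrableZl measurableT _ (integrable_bmul mu u1 (di i z))).
apply: eq_bigr => i _.
rewrite (RintegralZl _ measurableT (integrable_bmul mu u1 (di i z))).
by congr (_ * _); exact: (corr_diff0 z mu u1 (cphi i) (Hphi i).2).
Qed.

End riesz_representation.

(** * Gaussian averages and the limit alpha -> 1 *)

Section power_tails.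
Context {R : realType}.
Local Notation leb := (@lebesgue_measure R).

Lemma measurable_itvR (i : interval R) : measurable ([set` i] : set (measurableTypeR R)).
Proof. exact: measurable_itv. Qed.

Lemma integrable_powR01 (b : R) : 0 < b ->
  leb.-integrable `]0%R, 1%R] (EFin \o (fun s => s `^ (b - 1))).
Proof.
move=> b0; apply/integrableP; split; first exact: measurable_powR_E.
under eq_integral => s _ do rewrite /= ger0_norm ?powR_ge0//.
by rewrite integral_powR01// ltry.
Qed.

Lemma integrable_powR1y (b : R) : 0 < b ->
  leb.-integrable `]1%R, +oo[ (EFin \o (fun s => s `^ (- b - 1))).
Proof.
move=> b0; apply/integrableP; split; first exact: measurable_powR_E.
under eq_integral => s _ do rewrite /= ger0_norm ?powR_ge0//.
by rewrite integral_powR1y// ltry.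
Qed.

(** The integrals are 1/(1/2 - a) <= 4 over ]0, 1], using a <= 1/4, then 1/a for the constant P and
    1/(a + 1/2) <= 2 over ]1, +oo[. Only P/a blows up as a -> 0, so after multiplication by an
    amplitude of order a only P survives. *)
Lemma power_tail_le (a P C C' : R) (H : R -> R) : 0 < a -> a <= 4^-1 ->
  0 <= C -> 0 <= C' ->
  leb.-integrable `]0%R, +oo[ (EFin \o (fun s => s `^ (- a - 1) * H s)) ->
  (forall s, 0 < s -> s <= 1 -> H s <= C * Num.sqrt s) ->
  (forall s, 1 < s -> H s <= P + C' / Num.sqrt s) ->
  \int[leb]_(s in `]0%R, +oo[) (s `^ (- a - 1) * H s) <= P / a + (4 * C + 2 * C').
Proof.
move=> a0 a4 C0 C'0 Hi H1 H2.
have E : (`]0%R, +oo[%classic : set R) = `]0%R, 1%R] `|` `]1%R, +oo[.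
  rewrite eqEsubset; split => s /=; rewrite !in_itv/= ?andbT.
    by move=> s0; case: (leP s 1) => s1; [left; rewrite s0|right].
  by case=> [/andP[]//|]; apply: lt_trans.
have dj : [disjoint `]0%R, 1%R]%classic & `]1%R, +oo[%classic : set R].
  apply/disj_setPS => s [] /=; rewrite !in_itv/= andbT => /andP[_ s1].
  by rewrite ltNge s1.
have i1 : leb.-integrable `]0%R, 1%R] (EFin \o (fun s => s `^ (- a - 1) * H s)).
  by apply: integrableS Hi => // s; rewrite E; left.
have i2 : leb.-integrable `]1%R, +oo[ (EFin \o (fun s => s `^ (- a - 1) * H s)).
  by apply: integrableS Hi => // s; rewrite E; right.
rewrite E Rintegral_setU//; last by rewrite -E.
have b1 : 0 < 2^-1 - a by lra.
have b2 : 0 < a + 2^-1 by lra.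
have V1 : \int[leb]_(s in `]0%R, 1%R]) (s `^ ((2^-1 - a) - 1)) = (2^-1 - a)^-1.
  by rewrite /Rintegral integral_powR01.
have V2 (b : R) : 0 < b -> \int[leb]_(s in `]1%R, +oo[) (s `^ (- b - 1)) = b^-1.
  by move=> b0; rewrite /Rintegral integral_powR1y.
have J1 := integrableZl (measurable_itvR _) C (integrable_powR01 b1).
have J2 := integrableZl (measurable_itvR _) P (integrable_powR1y a0).
have J3 := integrableZl (measurable_itvR _) C' (integrable_powR1y b2).
have B1 : \int[leb]_(s in `]0%R, 1%R]) (s `^ (- a - 1) * H s) <= C * (2^-1 - a)^-1.
  rewrite -V1 -RintegralZl//; last exact: integrable_powR01.
  apply: le_Rintegral => //.
  move=> s; rewrite /= in_itv/= => /andP[s0 s1].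
  apply: le_trans (ler_wpM2l (powR_ge0 _ _) (H1 s s0 s1)) _.
  rewrite -powR12_sqrt ?(ltW s0)// mulrCA ler_wpM2l// -powRD_gt0//.
  by rewrite le_eqVlt; apply/orP; left; apply/eqP; congr powR; ring.
have B2 : \int[leb]_(s in `]1%R, +oo[) (s `^ (- a - 1) * H s) <=
    P * a^-1 + C' * (a + 2^-1)^-1.
  rewrite -(V2 a)// -(V2 (a + 2^-1))// -!RintegralZl//; [|exact: integrable_powR1y..].
  rewrite -RintegralD//; apply: le_Rintegral => //.
    exact: (integrableD (measurable_itvR _) J2 J3).
  move=> s; rewrite /= in_itv/= andbT => s1; have s0 := lt_trans ltr01 s1.
  apply: le_trans (ler_wpM2l (powR_ge0 _ _) (H2 s s1)) _.
  rewrite -powR12_sqrt ?(ltW s0)// -powRN mulrDr lerD//; first by rewrite mulrC.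
  rewrite mulrCA ler_wpM2l// -powRD_gt0//.
  by rewrite le_eqVlt; apply/orP; left; apply/eqP; congr powR; ring.
apply: le_trans (lerD B1 B2) _; rewrite addrCA lerD2l.
rewrite lerD// 1?mulrC ler_wpM2r// 1?mulrC//.
  by rewrite -[leRHS]invrK lef_pV2 ?posrE ?invr_gt0//; lra.
by rewrite -[leRHS]invrK lef_pV2 ?posrE ?invr_gt0//; lra.
Qed.

End power_tails.

Section heat_formula.
Context {R : realType} {n : nat}.
Local Notation lam := (lebesgue_borel R n).
Local Notation leb := (@lebesgue_measure R).
Implicit Types (u : 'rV[R]_n -> R) (phi : 'rV[R]_n -> 'rV[R]_n).

(* Average of z |-> int u(x) div phi(x + z) dx against the normalized Gaussian
   exp(-s|z|^2): large s means concentration at z = 0. *)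
Definition heat u phi (s : R) : R :=
  (gmass n s)^-1 * \int[lam]_z (corr u (div phi) z * gauss s z).

(* For small s the divergence is moved back to the Gaussian, whose gradient is
   O(sqrt s) in L^1. *)
Lemma heat_le M phi u s : cc_field M phi -> measurable_fun setT u ->
  (forall x, `|u x| <= 1) -> 0 < s ->
  `|heat u phi s| <= 2 * moment_const n 1 * mass phi * Num.sqrt s.
Proof.
move=> Hphi mu u1 s0; rewrite /heat -(moment_diff_gauss Hphi mu u1 s0).
have ss0 : 0 < Num.sqrt s by rewrite sqrtr_gt0.
have g0 := gmass_gt0 n s0.
have mi := integrable_moment n 1 s0.
have mass0 : 0 <= mass phi by apply: sumr_ge0 => i _; rewrite mulr_ge0// Rintegral_ge0.
have qi : lam.-integrable setT (EFin \o (fun z => moment_diff u phi z * gauss s z)).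
  apply: le_integrable (integrableZl measurableT (mass phi) mi) => //.
    by apply: measurable_EFin_cont; apply: rV_contM;
      [exact: (moment_diff_continuous Hphi)|exact: continuous_gauss].
  move=> z _ /=; rewrite lee_fin expr1 !normrM mulrA ler_wpM2r//.
  by rewrite (le_trans (moment_diff_le z Hphi mu u1))// -normrM ler_norm.
have B : `|\int[lam]_z (moment_diff u phi z * gauss s z)| <=
    mass phi * (moment_const n 1 / Num.sqrt s * gmass n s).
  apply: (@le_trans _ _ (\int[lam]_z (mass phi * (enorm z ^+ 1 * gauss s z)))).
    apply: Rintegral_le_abs => //; first exact: (integrableZl measurableT (mass phi) mi).
    move=> z; rewrite expr1 normrM (ger0_norm (ltW (gauss_gt0 _ _))) mulrA.
    by rewrite ler_wpM2r ?(ltW (gauss_gt0 _ _))// (moment_diff_le z Hphi mu u1).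
  by rewrite RintegralZl// ler_wpM2l//; have := moment_le n 1 s0; rewrite !expr1.
rewrite normrM [`|(gmass n s)^-1|]gtr0_norm ?invr_gt0//.
rewrite [`|2 * s * _|]normrM [`|2 * s|]gtr0_norm ?mulr_gt0//.
apply: (@le_trans _ _ ((gmass n s)^-1 * (2 * s *
    (mass phi * (moment_const n 1 / Num.sqrt s * gmass n s))))).
  by apply: ler_wpM2l; [rewrite invr_ge0 ltW|apply: ler_wpM2l; rewrite // mulr_ge0// ltW].
rewrite -{2}(sqr_sqrtr (ltW s0)) le_eqVlt; apply/orP; left; apply/eqP.
by field; rewrite !gt_eqF.
Qed.

Variable al : R.
Hypothesis al01 : 0 < al < 1.
Local Notation a := (gapc al).

(** This is [frac_const] times pi^(n/2) / (2 Gamma(betac)): the Gamma factor comes from the kernel,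
    the power of pi from the Gaussian mass and the 2 from the integration by parts. The dimension
    cancels. *)
Definition riesz_amp (al : R) : R := 2 `^ (al - 1) / Gamma (gapc al).

Lemma frac_div_heat M phi u : cc_field M phi -> measurable_fun setT u ->
  (forall x, `|u x| <= 1) ->
  leb.-integrable `]0%R, +oo[ (EFin \o (fun s => s `^ (- a - 1) * heat u phi s)) /\
  \int[lam]_x (u x * frac_div al phi x) =
  riesz_amp al * \int[leb]_(s in `]0%R, +oo[) (s `^ (- a - 1) * heat u phi s).
Proof.
move=> Hphi mu u1.
have [_ ->] := frac_div_moment al01 Hphi mu u1.
have [C C0 HC] := moment_diff_wmin Hphi.
have [_ Wi WE] := weight_swap al01 (moment_diff_continuous Hphi mu u1) (HC u mu u1).
have G0 : 0 < Gamma (betac (n := n) al) by rewrite Gamma_gt0// beta_gt0.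
have pp0 : 0 < (pi : R) `^ (n%:R / 2) by rewrite powR_gt0// pi_gt0.
pose w (s : R) := sweight (n := n) al s * \int[lam]_z (moment_diff u phi z * gauss s z).
have wE s : 0 < s -> s `^ (- a - 1) * heat u phi s = 2 / pi `^ (n%:R / 2) * w s.
  move=> s0; rewrite /heat /w -(moment_diff_gauss Hphi mu u1 s0) /sweight s0.
  rewrite gmass_powR// (_ : - a - 1 = (betac (n := n) al - 1) + (- 1 + - (n%:R / 2))); last first.
    by rewrite /gapc /betac; field.
  rewrite !(powRD_gt0 _ _ s0) powR_inv1 ?(ltW s0)//.
  by field; rewrite !gt_eqF// powR_gt0.
have Wi' : leb.-integrable `]0%R, +oo[ (EFin \o w).
  by apply: integrableS Wi.
have Wi2 := integrableZl (measurable_itvR _) (2 / pi `^ (n%:R / 2)) Wi'.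
split.
  apply: eq_integrable Wi2 => // s; rewrite inE/= in_itv/= andbT => s0.
  by rewrite -EFinM wE.
transitivity (riesz_amp al * (2 / pi `^ (n%:R / 2) * \int[leb]_(s in `]0%R, +oo[) w s)).
  have -> : \int[leb]_(s in `]0%R, +oo[) w s = \int[leb]_s w s.
    rewrite Rintegral_mkcond; apply: (@eq_Rintegral _ (measurableTypeR R) R leb setT) => s _.
    rewrite patchE; case: ifPn => //; rewrite notin_setE /= in_itv/= andbT => /negP.
    by rewrite -leNgt => s0; rewrite /w /sweight ltNge s0/= mul0r.
  rewrite -WE /frac_const /riesz_amp (_ : (n%:R + al + 1) / 2 = betac (n := n) al)//.
  rewrite (_ : (1 - al) / 2 = a)// powRN.
  rewrite (_ : (2 : R) `^ al = 2 * 2 `^ (al - 1)); last first.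
    by rewrite -{2}(@powRr1 _ (2 : R))// -powRD_gt0//; congr powR; ring.
  have pn : (pi : R) `^ (n%:R / 2) != 0 by rewrite gt_eqF.
  have ga : Gamma a != 0 by exact: lt0r_neq0 (Gamma_gt0 (gap_gt0 al01)).
  move: (Gamma _) (\int[lam]_z _) (Gamma a) (pi `^ _) (_ `^ (al - 1)) ga pn.
  by clear; move=> b I c d e c0 d0; field; rewrite c0 d0.
congr (_ * _); rewrite -(RintegralZl _ (measurable_itvR _) Wi').
by apply: eq_Rintegral => s; rewrite inE/= in_itv/= andbT => s0; rewrite wE.
Qed.

(** Kept one-sided to serve both inequalities: the liminf applies it to u and -u with P the
    classical pairing, the limsup to an indicator with P a bound on a perimeter. For al >= 1/2 the
    exponent [a] is at most 1/4, as [power_tail_le] requires. *)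
Lemma frac_div_le M phi u (P C C' : R) : cc_field M phi -> measurable_fun setT u ->
  (forall x, `|u x| <= 1) -> 2^-1 <= al -> 0 <= C -> 0 <= C' ->
  (forall s, 0 < s -> s <= 1 -> heat u phi s <= C * Num.sqrt s) ->
  (forall s, 1 < s -> heat u phi s <= P + C' / Num.sqrt s) ->
  \int[lam]_x (u x * frac_div al phi x) <=
  riesz_amp al * (P / a + (4 * C + 2 * C')).
Proof.
move=> Hphi mu u1 al2 C0 C'0 H1 H2.
have [Hi ->] := frac_div_heat Hphi mu u1.
apply: ler_wpM2l; first by rewrite divr_ge0 ?powR_ge0// ltW// Gamma_gt0// gap_gt0.
by apply: power_tail_le => //; [exact: gap_gt0|rewrite /gapc; lra].
Qed.

End heat_formula.

Section heat_near.
Context {R : realType} {n : nat}.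
Local Notation lam := (lebesgue_borel R n).
Implicit Types (u : 'rV[R]_n -> R) (phi : 'rV[R]_n -> 'rV[R]_n).

Lemma Cks_div M phi : cc_field M phi -> Cks 1 (div phi) /\ bsupp (M + 1) (div phi).
Proof.
move=> Hphi; rewrite (divE Hphi); split.
  by apply: Cks_sum => i; exact: Cks_derive ((Hphi i).1 2%N).
move=> x Mx; rewrite big1// => i _.
exact: (bsupp_derive _ (Hphi i).2 Mx).
Qed.

Lemma corr0 u f : corr u f 0 = \int[lam]_x (u x * f x).
Proof. by apply: eq_Rintegral => x _; rewrite addr0. Qed.

(** The correlation with [div phi] is Lipschitz in z uniformly in u, and the normalized first
    Gaussian moment is O(1/sqrt s). *)
Lemma heat_near M phi : cc_field M phi -> exists2 C : R, 0 <= C &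
  forall u, measurable_fun setT u -> (forall x, `|u x| <= 1) -> forall s, 0 < s ->
    `|heat u phi s - \int[lam]_x (u x * div phi x)| <= C / Num.sqrt s.
Proof.
move=> Hphi; have [Cd Hd] := Cks_div Hphi.
have [C C0 HC] := corr_increment Cd Hd.
exists (C * moment_const n 1); first by rewrite mulr_ge0 ?moment_const_ge0.
move=> u mu u1 s s0; rewrite -corr0.
have g0 := gmass_gt0 n s0; have gi := integrable_gauss n s0.
have mi := integrable_moment n 1 s0.
have ci := integrable_corr mu u1 Cd Hd gi.
have c0i : lam.-integrable setT (EFin \o (fun z => corr u (div phi) 0 * gauss s z)).
  exact: (integrableZl measurableT (corr u (div phi) 0) gi).
have E : heat u phi s - corr u (div phi) 0 = (gmass n s)^-1 *
    \int[lam]_z ((corr u (div phi) z - corr u (div phi) 0) * gauss s z).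
  transitivity ((gmass n s)^-1 * \int[lam]_z
      (corr u (div phi) z * gauss s z - corr u (div phi) 0 * gauss s z)).
    have E2 : \int[lam]_z (corr u (div phi) 0 * gauss s z) = corr u (div phi) 0 * gmass n s.
      by rewrite -(Rintegral_gauss n s0); exact: (RintegralZl _ measurableT gi).
    have -> := RintegralB measurableT ci c0i.
    rewrite mulrBr /heat; congr (_ - _); rewrite E2.
    by rewrite mulrCA mulVf ?mulr1// gt_eqF.
  by congr (_ * _); apply: eq_Rintegral => z _; rewrite mulrBl.
rewrite E normrM gtr0_norm ?invr_gt0//.
apply: (@le_trans _ _ ((gmass n s)^-1 * (C * (moment_const n 1 / Num.sqrt s * gmass n s)))).
  apply: ler_wpM2l; first by rewrite invr_ge0 ltW.
  apply: (@le_trans _ _ (\int[lam]_z (C * (enorm z ^+ 1 * gauss s z)))).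
    apply: Rintegral_le_abs => //.
    - have := integrableB measurableT ci c0i; apply: eq_integrable => // z _ /=.
      by rewrite mulrBl.
    - exact: (integrableZl measurableT C mi).
    move=> z; rewrite normrM (ger0_norm (ltW (gauss_gt0 _ _))) mulrA.
    apply: ler_wpM2r; first exact: ltW (gauss_gt0 _ _).
    apply: le_trans (HC u mu u1 z 0) _; rewrite subr0 expr1.
    by apply: ler_wpM2l => //; rewrite ge_min lexx orbT.
  by rewrite RintegralZl//; apply: ler_wpM2l => //; have := moment_le n 1 s0; rewrite !expr1.
rewrite mulrCA [_ * gmass n s]mulrC mulrA.
rewrite le_eqVlt; apply/orP; left; apply/eqP.
by field; rewrite !gt_eqF// sqrtr_gt0.
Qed.

Lemma frac_div_near M phi : cc_field M phi -> exists2 C : R, 0 <= C &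
  forall u, measurable_fun setT u -> (forall x, `|u x| <= 1) ->
  forall al, 2^-1 <= al < 1 ->
    `|\int[lam]_x (u x * frac_div al phi x) -
      riesz_amp al / gapc al * \int[lam]_x (u x * div phi x)| <= riesz_amp al * C.
Proof.
move=> Hphi; have [C' C'0 HC'] := heat_near Hphi.
have [Cd Hd] := Cks_div Hphi.
pose C := 2 * moment_const n 1 * mass phi.
have C0 : 0 <= C.
  rewrite mulr_ge0 ?mulr_ge0 ?moment_const_ge0//.
  by apply: sumr_ge0 => i _; rewrite mulr_ge0// Rintegral_ge0.
exists (4 * C + 2 * C'); first by rewrite addr_ge0// mulr_ge0.
(* [heat_le] serves s <= 1 and [heat_near] serves s > 1. The opposite bound follows by replacing u
   with -u. *)
have one u : measurable_fun setT u -> (forall x, `|u x| <= 1) ->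
    forall al, 2^-1 <= al < 1 ->
    \int[lam]_x (u x * frac_div al phi x) - riesz_amp al / gapc al *
      \int[lam]_x (u x * div phi x) <= riesz_amp al * (4 * C + 2 * C').
  move=> mu u1 al /andP[al2 al1].
  have al01 : 0 < al < 1 by rewrite al1 andbT (lt_le_trans _ al2).
  have := frac_div_le al01 (P := \int[lam]_x (u x * div phi x)) Hphi mu u1 al2 C0 C'0.
  move=> /(_ _ _)/le_trans H.
  rewrite lerBlDl; apply: H.
  - by move=> s s0 s1; rewrite (le_trans (ler_norm _))// (heat_le Hphi mu u1 s0).
  - move=> s s1; have := HC' u mu u1 s (lt_trans ltr01 s1).
    by rewrite ler_norml => /andP[_]; rewrite lerBlDl.
  by rewrite mulrDr mulrA mulrAC mulrA.
move=> u mu u1 al al12; rewrite ler_norml one// andbT.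
have al01 : 0 < al < 1 by case/andP: al12 => al2 ->; rewrite (lt_le_trans _ al2).
have mu' : measurable_fun setT (fun x => - u x) by exact: measurable_funN.
have := one (fun x => - u x) mu' _ al al12.
have -> : \int[lam]_x (- u x * frac_div al phi x) = - \int[lam]_x (u x * frac_div al phi x).
  rewrite -[RHS]mulN1r -RintegralZl//; last exact: (frac_div_moment al01 Hphi mu u1).1.
  by apply: eq_Rintegral => x _; rewrite mulN1r mulNr.
have -> : \int[lam]_x (- u x * div phi x) = - \int[lam]_x (u x * div phi x).
  rewrite -[RHS]mulN1r -RintegralZl//; last first.
    exact: integrable_bmul mu u1 (cc_integrable (Cks_continuous Cd) Hd).
  by apply: eq_Rintegral => x _; rewrite mulN1r mulNr.
rewrite mulrN -opprD lerNl; apply => x; by rewrite normrN.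
Qed.

End heat_near.

Section amplitude.
Context {R : realType}.

(** With a = [gapc al], so that 1 - al = 2a, the quotient A/a is p/g with p = 2^(al-1) and g = a
    Gamma(a). Here 1 - 2a <= p <= 1 because ln 2 <= 1, and |g - 1| <= 2a by [Gamma_near0]. Hence |p
    - g| <= 4a and g >= 1/2, which gives 8a = 4(1 - al). *)
Lemma riesz_amp_near (al : R) : 2^-1 <= al < 1 ->
  [/\ `|riesz_amp al / gapc al - 1| <= 4 * (1 - al), 0 <= riesz_amp al &
      riesz_amp al <= 2 * (1 - al)].
Proof.
move=> /andP[al2 al1].
have al01 : 0 < al < 1 by rewrite al1 andbT (lt_le_trans _ al2).
have a0 : 0 < gapc al := gap_gt0 al01.
have a4 : gapc al <= 4^-1 by rewrite /gapc; lra.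
have alE : al = 1 - 2 * gapc al by rewrite /gapc; field.
set a := gapc al in a0 a4 alE *.
have G0 := Gamma_gt0 a0.
have := Gamma_near0 a0; rewrite ler_norml => /(_ _)/andP[|G1 G2]; first by lra.
have p1 : 2 `^ (al - 1) <= 1 :> R.
  rewrite -[leRHS](@powRr0 _ (2 : R)); apply: ler_powR; first by rewrite ler1n.
  by lra.
have p2 : 1 - 2 * a <= 2 `^ (al - 1) :> R.
  rewrite /powR ifF; last by rewrite pnatr_eq0.
  apply: le_trans (expR_ge1Dx _).
  have l2 : ln (2 : R) <= 1.
    by have := @le_ln1Dx R 1; rewrite (_ : 1 + 1 = 2)//; apply; rewrite (lt_trans _ ltr01).
  have l0 : 0 <= ln (2 : R) by rewrite ln_ge0// ler1n.
  have -> : al - 1 = - (2 * a) by rewrite [al in LHS]alE; ring.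
  nra.
have aG : 0 < a * Gamma a by rewrite mulr_gt0.
set p := 2 `^ (al - 1) in p1 p2; set g := a * Gamma a in aG G1 G2.
have rE : riesz_amp al / a = p / g.
  by rewrite /riesz_amp -/a -/p /g; field; rewrite !gt_eqF.
have AE : riesz_amp al = a * (p / g).
  by rewrite -rE mulrCA divff ?mulr1// gt_eqF.
have alE' : 1 - al = 2 * a by rewrite alE; ring.
have r1 : `|p / g - 1| <= 8 * a.
  rewrite -[X in _ - X](@divff _ g) ?gt_eqF// -mulrBl normrM [`|g^-1|]gtr0_norm ?invr_gt0//.
  rewrite ler_pdivrMr//; rewrite ler_norml; apply/andP; split; nra.
rewrite rE alE'; split.
- by rewrite (le_trans r1)//; lra.
- by rewrite divr_ge0 ?powR_ge0 ?ltW.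
rewrite AE; move: r1; rewrite ler_norml => /andP[_ r1].
by have : p / g <= 3; [lra|nra].
Qed.

End amplitude.

(** * The liminf inequality *)

Section test_fields.
Context {R : realType} {n : nat}.
Local Notation lam := (lebesgue_borel R n).
Local Notation L := (lebesgue R n).
Implicit Types (Omega E B : set 'rV[R]_n) (phi : 'rV[R]_n -> 'rV[R]_n).

Lemma lebesgue_borel_open_gt0 (U : set 'rV[R]_n) x : open U -> U x -> (0 < lam U)%E.
Proof.
move=> oU Ux; have [e e0 xU] := open_norm_lt oU Ux.
pose a : 'rV[R]_n := x - const_mx (e / 2); pose b : 'rV[R]_n := x + const_mx (e / 2).
apply: (@lt_le_trans _ _ (lam (obox a b))).
  rewrite lebesgue_borel_obox lte_fin prodr_gt0// => i _.
  rewrite lt_max /a /b !mxE; apply/orP; right; lra.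
apply: le_measure; rewrite ?inE; [exact: measurable_obox|exact: rV_open_measurable|].
move=> y yab; apply: xU; apply: norm_rV_lt => // i; rewrite !mxE ltr_norml.
by have := yab i; rewrite /a /b !mxE => /andP[y1 y2]; apply/andP; split; lra.
Qed.

(** The essential bound becomes pointwise: the set where |phi| > 1 is open, contained in Omega
    because it lies in the support, and null, hence empty. *)
Lemma test_field_cc Omega phi : test_field Omega phi ->
  exists M, [/\ 0 < M, cc_field M phi, forall x, enorm (phi x) <= 1 &
    closure [set x | phi x != 0] `<=` Omega].
Proof.
move=> [[sphi cphi phiO] N1].
have ccc : continuous phi by exact: (sphi 0%N).
have /compact_bounded[C [_ HC]] := cphi.
exists (Num.max C 0 + 2).
have M0 : 0 < Num.max C 0 + 2 by rewrite ltr_wpDl// le_max lexx orbT.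
have supp x : phi x != 0 -> `|x| <= Num.max C 0 + 1.
  move=> px; apply: (HC (Num.max C 0 + 1)); last exact: subset_closure.
  have : C <= Num.max C 0 by rewrite le_max lexx.
  lra.
have Hcc : cc_field (Num.max C 0 + 2) phi.
  move=> i; split; first exact: (proj1 (smooth_coorP phi)).
  move=> x xM; have [->|/supp] := eqVneq (phi x) 0; first by rewrite mxE.
  by move=> xM'; clear N1; exfalso; lra.
split => // x; rewrite leNgt; apply/negP => x1.
pose U := [set y | 1 < enorm (phi y)].
have cn : continuous (fun y => enorm (phi y)).
  by apply: rV_cont_arg => //; exact: continuous_enorm.
have oU : open U.
  rewrite (_ : U = (fun y => enorm (phi y)) @^-1` [set t | 1 < t])//.
  by apply: open_comp; [move=> y _; exact: cn|exact: open_gt].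
have UO : U `<=` Omega.
  move=> y Uy; apply: phiO; apply: subset_closure => /=.
  by rewrite -enorm_gt0 (lt_trans ltr01).
have mU := rV_open_measurable oU.
have lU : (0 < lam U)%E by exact: lebesgue_borel_open_gt0 oU x1.
have lUL : (0 < L U)%E by rewrite lebesgue_borelE.
have LT : (0 < L setT)%E.
  apply: (lt_le_trans lUL); apply: le_measure; rewrite ?inE//.
  exact: borel_lebesgue_measurable.
move: N1; rewrite unlock LT => /ess_supP[N [mN N0 UN]].
have : (L U <= L N)%E.
  apply: le_measure; rewrite ?inE//; first exact: borel_lebesgue_measurable.
  move=> y Uy; apply: UN => /=; apply/negP; rewrite -ltNge patchE mem_set//; last exact: UO.
  by rewrite lte_fin ger0_norm ?enorm_ge0.
by rewrite N0 leNgt lUL.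
Qed.

Lemma test_field_intro Omega (K : set 'rV[R]_n) phi : smooth phi -> compact K ->
  K `<=` Omega -> (forall x, phi x != 0 -> K x) -> (forall x, enorm (phi x) <= 1) ->
  test_field Omega phi.
Proof.
move=> sphi cK KO phiK phi1.
have clK : closure [set x | phi x != 0] `<=` K.
  have /closure_id -> : closed K by apply: compact_closed => //; exact: norm_hausdorff.
  exact: closureS.
split; first split => //.
- by apply: (subclosed_compact _ cK clK); exact: closed_closure.
- exact: subset_trans KO.
rewrite unlock; case: ifPn => // _; apply/ess_supP; apply: aeW => x /=.
rewrite patchE; case: ifPn => _; rewrite lee_fin ger0_norm ?enorm_ge0//.
Qed.

Lemma integral_indic_mul B (f : 'rV[R]_n -> R) : measurable B ->
  lam.-integrable setT (EFin \o f) ->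
  (\int[lam]_(x in B) (f x)%:E)%E = (\int[lam]_x (\1_B x * f x))%:E.
Proof.
move=> mB fi; have mi : measurable_fun setT (\1_B : 'rV[R]_n -> R) by exact: measurable_indic.
rewrite -EFin_Rintegral//; last first.
  apply: integrable_bmul => // x.
  by rewrite indicE; case: (_ \in _); rewrite ?normr1 ?normr0.
rewrite [LHS]integral_mkcond; apply: eq_integral => x _.
by rewrite patchE indicE; case: ifPn => _; rewrite ?mul1r ?mul0r.
Qed.

Definition borel_rep E B := [/\ measurable B, E `<=` B & L.-negligible (B `\` E)].

Lemma integral_borel_rep E B (f : 'rV[R]_n -> R) : lebesgue_measurable E ->
  borel_rep E B -> lam.-integrable setT (EFin \o f) ->
  (\int[L]_(x in E) (f x)%:E)%E = (\int[lam]_x (\1_B x * f x))%:E.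
Proof.
move=> mE [mB EB nB] fi; rewrite (ae_eq_restrict mE mB EB nB).
  exact: integral_indic_mul.
exact: measurable_int fi.
Qed.

Lemma indic_le1 B (x : 'rV[R]_n) : `|\1_B x : R| <= 1.
Proof. by rewrite indicE; case: (_ \in _); rewrite ?normr1 ?normr0. Qed.

Lemma integrable_div M phi : cc_field M phi -> lam.-integrable setT (EFin \o div phi).
Proof. by move=> /Cks_div[Cd Hd]; exact: cc_integrable (Cks_continuous Cd) Hd. Qed.

Lemma integrable_frac_div al M phi : 0 < al < 1 -> cc_field M phi ->
  lam.-integrable setT (EFin \o frac_div al phi).
Proof.
move=> al01 Hphi.
have [||+ _] := @frac_div_moment R n al al01 M phi (cst 1) Hphi.
- exact: measurable_cst.
- by move=> x; rewrite normr1.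
by apply: eq_integrable => // x _ /=; rewrite mul1r.
Qed.

Lemma L1_borel_rep E B F B' (K : set 'rV[R]_n) : lebesgue_measurable E ->
  lebesgue_measurable F -> borel_rep E B -> borel_rep F B' -> measurable K ->
  (\int[L]_(x in K) `|\1_F x - \1_E x|%:E = \int[lam]_(x in K) `|\1_B' x - \1_B x|%:E)%E.
Proof.
move=> mE mF [mB EB nB] [mB' FB' nB'] mK.
have mKL : measurable (K : set (lebesgue_type R n)) by exact: borel_lebesgue_measurable.
have mbb : measurable_fun setT (fun x : 'rV[R]_n => `|\1_B' x - \1_B x|%:E : \bar R).
  apply/measurable_EFinP; apply: measurableT_comp => //.
  by apply: measurable_funB; exact: measurable_indic.
transitivity (\int[L]_(x in K) `|\1_B' x - \1_B x|%:E)%E; last first.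
  rewrite [LHS]integral_mkcond [RHS]integral_mkcond; apply: integral_lebesgue_borel.
  by apply/(measurable_restrictT _ mK); exact: measurable_funTS.
apply: (ae_eq_integral _ _ mKL).
- have m1 : measurable_fun setT (\1_F : lebesgue_type R n -> R) by exact: measurable_indic.
  have m2 : measurable_fun setT (\1_E : lebesgue_type R n -> R) by exact: measurable_indic.
  have m3 := measurableT_comp (@normr_measurable R setT) (measurable_funB m1 m2).
  by apply: measurable_funTS; apply: measurableT_comp m3; exact: EFin_measurable.
- by apply: measurable_funTS; exact: lebesgue_measurable_fun.
have [N [mN N0 NH]] := negligibleU nB nB'.
exists N; split => // x /= /not_implyP[Kx xne]; apply: NH; apply: contrapT => /not_orP[h1 h2].
apply: xne; have iE (A A' : set 'rV[R]_n) : A `<=` A' -> ~ (A' `\` A) x -> \1_A x = \1_A' x :> R.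
  move=> AA' nA; rewrite !indicE; have [A'x|nA'x] := pselect (A' x).
    have Ax : A x by apply: contrapT => nAx; apply: nA.
    by rewrite (mem_set Ax) (mem_set A'x).
  by rewrite !memNset// => /AA'.
by rewrite (iE _ _ EB h1) (iE _ _ FB' h2).
Qed.

End test_fields.

Section liminf.
Context {R : realType} {n : nat}.
Local Notation lam := (lebesgue_borel R n).
Local Notation L := (lebesgue R n).

Lemma near_leftP (p : R) (P : set R) : (\forall x \near p^'-, P x) <->
  exists2 d : R, 0 < d & forall x, p - d < x -> x < p -> P x.
Proof.
split=> [[d /= d0 H]|[d d0 H]].
  exists d => // x xd xp; apply: H => //=; rewrite gtr0_norm; lra.
by exists d => // x /= xd xp; apply: H => //; move: xd; rewrite ltr_distlC => /andP[]; lra.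
Qed.

(** For a fixed test field three errors are made small for alpha near 1: that of [frac_div_near] on
    F al, the deviation of r = A/a from 1, and the L^1 distance between F al and E on the support of
    [div phi]. *)
Lemma liminf_ineq (Omega E : set 'rV[R]_n) (F : R -> set 'rV[R]_n) :
  lebesgue_measurable E -> measurable_family F -> L1loc_cvg F E ->
  (perimeter E Omega <= limf_einf (fun al => frac_perimeter al (F al) Omega) 1^'-)%E.
Proof.
move=> mE mF FE; apply: ge_ereal_sup => _ [phi tphi <-].
have [M [M0 Hphi phi1 _]] := test_field_cc tphi.
have [B HB] := lebesgue_borel_approx mE; have [mB _ _] := HB.
rewrite (integral_borel_rep mE HB (integrable_div Hphi)).
set c := Rintegral _ _ _; apply/lee_subgt0Pr => e e0.
rewrite limf_einfE; apply: le_ereal_sup_tmp.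
(* [limf_einf] is a supremum, over the sets of the filter, of infima; V is the set used as a
   witness. *)
pose V := [set al | ((c - e)%:E <= frac_perimeter al (F al) Omega)%E].
exists (ereal_inf ((fun al => frac_perimeter al (F al) Omega) @` V)); last first.
  by apply: le_ereal_inf_tmp => _ [al Val <-]; rewrite -EFinB.
exists V => //; apply/near_leftP.
have [C C0 HC] := frac_div_near Hphi.
have [Cd Hd] := Cks_div Hphi.
have di := integrable_div Hphi.
have [D D0 HD] := bsupp_bounded (Cks_continuous Cd) Hd.
(* [div phi] vanishes outside this ball, which is the compact set where L^1 convergence is used. *)
pose K := [set x : 'rV[R]_n | `|x| <= M + 1].
have cK : compact K by exact: compact_norm_le.
have mK : measurable K.
  rewrite -[K]setCK; apply: measurableC; apply: rV_open_measurable.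
  by apply: closed_openC; exact: closed_norm_le.
pose I := \int[lam]_x `|div phi x|.
have I0 : 0 <= I by apply: Rintegral_ge0.
(* D bounds |div phi|, so an L^1 distance below this value costs at most e/2; the + 1 avoids a
   division by 0. *)
have eta0 : 0 < e / 2 / (D + 1) by rewrite !divr_gt0// ltr_wpDl.
have : \forall al \near 1^'-, (\int[L]_(x in K) `|\1_(F al) x - \1_E x|%:E < (e / 2 / (D + 1))%:E)%E.
  have := FE K cK => /(_ [set t | (t < (e / 2 / (D + 1))%:E)%E]); apply.
  by apply: open_nbhs_nbhs; split; [exact: open_ereal_lt_ereal|rewrite /= lte_fin].
move=> /near_leftP[d d0 Hd'].
(* 4 I stems from |r - 1| <= 4 (1 - al) and the bound I on the pairing of F al with [div phi]; 2 C
   stems from A <= 2 (1 - al). Together they cost less than e/2. *)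
pose d1 := Num.min (Num.min d 2^-1) (e / 2 / (4 * I + 2 * C + 1)).
have q0 : 0 < 4 * I + 2 * C + 1 by rewrite ltr_wpDl// addr_ge0// mulr_ge0.
have d10 : 0 < d1 by rewrite !lt_min d0 invr_gt0 ltr0n/= !divr_gt0.
exists d1 => // al ald al1; rewrite /V /=.
have ald' : 1 - al < d1 by lra.
move: ald'; rewrite /d1 !lt_min => /andP[/andP[h1 h2] h3].
have al2 : 2^-1 <= al < 1 by rewrite al1 andbT; lra.
have al01 : 0 < al < 1 by rewrite al1 andbT; lra.
have {Hd'} Hal := Hd' al ltac:(lra) al1.
have mFa := mF al al01.
have [Ba HBa] := lebesgue_borel_approx mFa; have [mBa _ _] := HBa.
rewrite (L1_borel_rep mE mFa HB HBa mK) in Hal.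
have fi := integrable_frac_div al01 Hphi.
apply: (@le_trans _ _ (\int[lam]_x (\1_Ba x * frac_div al phi x))%:E); last first.
  rewrite -(integral_borel_rep mFa HBa fi).
  by apply: ereal_sup_ubound; exists phi.
rewrite lee_fin.
have mi : measurable_fun setT (\1_Ba : 'rV[R]_n -> R) by exact: measurable_indic.
have mi' : measurable_fun setT (\1_B : 'rV[R]_n -> R) by exact: measurable_indic.
have := HC _ mi (indic_le1 Ba) al al2.
set h := \int[lam]_x (\1_Ba x * div phi x).
rewrite ler_norml => /andP[+ _].
have [r1 A0 A1] := riesz_amp_near al2.
have hI : `|h| <= I by apply: Rintegral_bmul_le mi (indic_le1 Ba) di.
have i1 := integrable_bmul mi (indic_le1 Ba) di.
have i2 := integrable_bmul mi' (indic_le1 B) di.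
have hc : `|h - c| <= e / 2.
  have mg : measurable_fun setT (fun x : 'rV[R]_n => `|\1_Ba x - \1_B x| : R).
    by apply: measurableT_comp => //; exact: measurable_funB.
  have gi : lam.-integrable setT (EFin \o (fun x => \1_K x * `|\1_Ba x - \1_B x| : R)).
    apply: (@bsupp_integrable _ _ (M + 2) 2).
    - by apply: measurable_funM => //; exact: measurable_indic.
    - move=> x; rewrite normrM normr_id.
      have := indic_le1 K x; have := ler_normB (\1_Ba x) (\1_B x : R).
      have := indic_le1 Ba x; have := indic_le1 B x.
      move: `|\1_K x| `|\1_Ba x - \1_B x| (normr_ge0 (\1_K x : R)) => a b; nra.
    - move=> x xM; rewrite indicE memNset ?mul0r// /K /=; lra.
  apply: (@le_trans _ _ (\int[lam]_x (D * (\1_K x * `|\1_Ba x - \1_B x|)))).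
    rewrite /h /c -RintegralB//.
    apply: Rintegral_le_abs.
    - exact: (integrableB measurableT i1 i2).
    - exact: (integrableZl measurableT D gi).
    move=> x; rewrite -mulrBl normrM [\1_K _]indicE.
    have [xK|xK] := boolP (x \in K); first by rewrite mul1r mulrC ler_wpM2r.
    rewrite mul0r mulr0 Hd ?normr0 ?mulr0//.
    by move/negP: xK => xK; rewrite leNgt; apply/negP => xM; apply: xK; apply/mem_set/ltW.
  rewrite RintegralZl//.
  have : (\int[lam]_(x in K) `|\1_Ba x - \1_B x|%:E)%E =
      (\int[lam]_x (\1_K x * `|\1_Ba x - \1_B x|))%:E.
    rewrite -EFin_Rintegral// [LHS]integral_mkcond; apply: eq_integral => x _.
    by rewrite patchE /= [\1_K _]indicE; case: ifPn => _; rewrite ?mul1r ?mul0r.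
  move=> E'; move: Hal; rewrite E' lte_fin.
  rewrite ltr_pdivlMr; last by rewrite ltr_wpDl.
  set J := \int[lam]_x _.
  have J0 : 0 <= J by apply: Rintegral_ge0 => x _; rewrite mulr_ge0// indicE.
  nra.
move: h3; rewrite ltr_pdivlMr// => h3.
move: r1 hI hc; set r := riesz_amp al / gapc al.
rewrite !ler_norml => /andP[r1 r2] /andP[h1' h2'] /andP[hc1 hc2] H.
have p1 : `|(r - 1) * h| <= 4 * (1 - al) * I.
  by rewrite normrM ler_pM// ler_norml; apply/andP.
have p2 : riesz_amp al * C <= 2 * (1 - al) * C by rewrite ler_wpM2r.
have p3 : - (4 * (1 - al) * I) <= (r - 1) * h by move: p1; rewrite ler_norml => /andP[].
move: H p2 p3 h3; set X := Rintegral _ _ _.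
nra.
Qed.

End liminf.

(** * Sets of finite perimeter near the closure of the domain *)

Section cutoff.
Context {R : realType} {n : nat}.
Local Notation lam := (lebesgue_borel R n).
Local Notation e_ i := (delta_mx 0 i : 'rV[R]_n).

(** Quadratic contact with 0 makes the difference quotient vanish. This handles functions defined by
    cases, such as [sqpos] and [flat_exp]. *)
Lemma is_derive_flat (f : R -> R) (x C : R) : (forall t, `|f (x + t)| <= C * t ^+ 2) ->
  is_derive x 1 f 0.
Proof.
move=> H; have f0 : f x = 0.
  by apply/eqP; rewrite -normr_le0; have := H 0; rewrite addr0 expr0n/= mulr0.
have cv : (fun h : R => h^-1 *: ((f \o shift x) (h *: (1 : R)) - f x)) @ 0^' --> (0 : R).
  apply/cvgrPdist_le => e e0; near=> h.
  have h0 : h != 0 by near: h; exact: nbhs_dnbhs_neq.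
  rewrite sub0r normrN /= f0 subr0 [h *: 1]mulr1 normrM normfV.
  rewrite ler_pdivrMl ?normr_gt0// addrC.
  apply: le_trans (H h) _; rewrite -real_normK ?num_real// expr2 mulrA mulrC.
  rewrite ler_wpM2l// (le_trans (ler_wpM2r _ (ler_norm C)))//.
  have : `|h| < e / (`|C| + 1).
    near: h; apply: nbhs_dnbhs; apply/nbhs_normP; exists (e / (`|C| + 1)).
      by rewrite /= divr_gt0// ltr_wpDl.
    by move=> y /=; rewrite sub0r normrN.
  rewrite ltr_pdivlMr ?ltr_wpDl// => /ltW; apply: le_trans.
  by rewrite mulrC ler_wpM2l// lerDl.
split; first by apply/cvg_ex; exists 0.
exact: (cvg_lim (@Rhausdorff R) cv).
Unshelve. all: by end_near. Qed.

Definition sqpos (t : R) : R := Num.max 0 t ^+ 2.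

Lemma is_derive_sqpos (t : R) : is_derive t 1 sqpos (2 * Num.max 0 t).
Proof.
pose y := Num.max 0 t; pose p := fun s : R => y ^+ 2 + 2 * y * (s - t).
(* The tangent line p approximates [sqpos] up to h^2, whatever the signs of t and t + h. *)
have flat : is_derive t 1 (fun s => sqpos s - p s) 0.
  apply: (@is_derive_flat _ t 1) => h; rewrite mul1r /p /sqpos /y addrAC subrr add0r.
  case: (leP 0 t) => t0; case: (leP 0 (t + h)) => h0; rewrite ler_norml;
    apply/andP; split; nra.
have Dp : is_derive t 1 p (2 * y).
  have -> : p = cst (y ^+ 2 - 2 * y * t) + (2 * y) *: id.
    by apply/funext => s; rewrite /p !fctE /GRing.scale/=; ring.
  apply: is_derive_eq (is_deriveD (is_derive_cst _ _ _) (is_deriveZ (2 * y) (is_derive_id t 1))) _.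
  by rewrite /GRing.scale/= mulr1 add0r.
have := is_deriveD flat Dp; rewrite add0r.
by congr is_derive; apply/funext => s /=; rewrite subrK.
Qed.

Lemma continuous_sqpos : continuous sqpos.
Proof.
move=> t; apply: differentiable_continuous; apply/derivable1_diffP.
by have [] := is_derive_sqpos t.
Qed.

(* (1 - |z|^2/rho^2)_+^2: equal to 1 to second order at 0, so that both
   1 - cutoff = O(|z|^2) and its gradient O(|z|) have Gaussian averages
   O(1/sqrt s) after an integration by parts. *)
Definition cutoff (rho : R) (z : 'rV[R]_n) : R := sqpos (1 - dotp z z / rho ^+ 2).

Definition dcutoff (rho : R) i (z : 'rV[R]_n) : R :=
  2 * Num.max 0 (1 - dotp z z / rho ^+ 2) * (- (2 * z 0 i) / rho ^+ 2).

Lemma cutoff_ge0 rho z : 0 <= cutoff rho z.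
Proof. by rewrite /cutoff /sqpos sqr_ge0. Qed.

Lemma cutoff_le1 rho z : cutoff rho z <= 1.
Proof.
have : 0 <= dotp z z / rho ^+ 2 by rewrite divr_ge0 ?dotp_ge0 ?sqr_ge0.
rewrite /cutoff /sqpos; move: (dotp z z / _) => v v0.
by rewrite expr_le1// ?le_max ?lexx// ge_max ler01; lra.
Qed.

Lemma cutoff_far rho z : 0 < rho -> rho <= enorm z -> cutoff rho z = 0.
Proof.
move=> r0 rz; rewrite /cutoff /sqpos max_l ?expr0n// subr_le0.
by rewrite ler_pdivlMr ?exprn_gt0// mul1r -sqr_enorm lerXn2r ?nnegrE ?enorm_ge0// ltW.
Qed.

Lemma cutoff_near rho z : 1 - cutoff rho z <= 2 / rho ^+ 2 * enorm z ^+ 2.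
Proof.
rewrite sqr_enorm mulrAC -mulrA.
have : 0 <= dotp z z / rho ^+ 2 by rewrite divr_ge0 ?dotp_ge0 ?sqr_ge0.
rewrite /cutoff /sqpos; move: (dotp z z / _) => v v0.
by case: (leP 0 (1 - v)) => h; nra.
Qed.

Lemma dcutoff_le rho i z : `|dcutoff rho i z| <= 4 / rho ^+ 2 * enorm z.
Proof.
have v0 : 0 <= dotp z z / rho ^+ 2 by rewrite divr_ge0 ?dotp_ge0 ?sqr_ge0.
rewrite /dcutoff; move: v0; set v := (dotp z z / _) => v0.
rewrite !normrM normrN normrM normfV (ger0_norm (sqr_ge0 _)) normr_nat.
have m1 : `|Num.max 0 (1 - v)| <= 1.
  rewrite ger0_norm ?le_max ?lexx//.
  by rewrite ge_max ler01; lra.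
have zi := coor_le_enorm z i.
have r0 : 0 <= rho ^- 2 by rewrite invr_ge0 sqr_ge0.
have := ler_pM (normr_ge0 _) (normr_ge0 _) m1 zi; rewrite mul1r.
move: (`|Num.max _ _|) (`|z 0 i|) (enorm z) (rho ^- 2) r0 => a b c r r0 h.
have := ler_wpM2r r0 h; lra.
Qed.

Lemma is_derive_dotp z i : is_derive z (e_ i) (fun z : 'rV[R]_n => dotp z z) (2 * z 0 i).
Proof.
pose F := \sum_(j < n) (fun z : 'rV[R]_n => z 0 j * z 0 j).
have -> : (fun z : 'rV[R]_n => dotp z z) = F.
  by apply/funext => y; rewrite /F /dotp fct_sumE.
apply: is_derive_eq.
  apply: is_derive_sum => j; apply: is_deriveM; exact: is_derive_coor.
rewrite /= (bigD1 i)//= big1 => [|j ji].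
  by rewrite !mxE !eqxx/= /GRing.scale/=; ring.
by rewrite !mxE eqxx (negbTE ji) !scaler0 addr0.
Qed.

Lemma is_derive_cutoff rho z i : is_derive z (e_ i) (cutoff rho) (dcutoff rho i z).
Proof.
apply: (is_derive_scalar_comp (h := sqpos) (f := fun z => 1 - dotp z z / rho ^+ 2)).
  exact: is_derive_sqpos.
have -> : (fun z : 'rV[R]_n => 1 - dotp z z / rho ^+ 2) =
    cst 1 + (- rho ^- 2) *: (fun z : 'rV[R]_n => dotp z z).
  by apply/funext => y; rewrite !fctE /GRing.scale/= mulNr mulrC.
apply: is_derive_eq (is_deriveD (is_derive_cst _ _ _) (is_deriveZ _ (is_derive_dotp z i))) _.
by rewrite add0r /GRing.scale/= mulNr mulrC mulNr.
Qed.

Lemma continuous_cutoff rho : continuous (cutoff rho).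
Proof.
apply: rV_cont_comp; first exact: continuous_sqpos.
apply: rV_contD; first exact: rV_contC.
apply: rV_contN; apply: rV_contM; [exact: continuous_sqr_enorm|exact: rV_contC].
Qed.

Lemma continuous_dcutoff rho i : continuous (dcutoff rho i).
Proof.
apply: rV_contM.
  apply: rV_contM; first exact: rV_contC.
  move=> x; apply: (@continuous_max R _ (fun=> 0) (fun z => 1 - dotp z z / rho ^+ 2) x).
    exact: (@rV_contC R n 0 x).
  move: x; apply: rV_contD; first exact: rV_contC.
  apply: rV_contN; apply: rV_contM; [exact: continuous_sqr_enorm|exact: rV_contC].
apply: rV_contM; last exact: rV_contC.
by apply: rV_contN; apply: rV_contM; [exact: rV_contC|exact: continuous_coor].
Qed.

End cutoff.

(** * Gaussian averages bounded by the perimeter in a larger open set *)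

Section heat_perimeter.
Context {R : realType} {n : nat}.
Local Notation lam := (lebesgue_borel R n).
Local Notation e_ i := (delta_mx 0 i : 'rV[R]_n).
Implicit Types (U B K : set 'rV[R]_n) (u : 'rV[R]_n -> R) (phi : 'rV[R]_n -> 'rV[R]_n).

Lemma cc_field_shift M phi z : cc_field M phi ->
  cc_field (M + `|z|) (fun x => phi (x + z)) /\
  div (fun x => phi (x + z)) = fun x => div phi (x + z).
Proof.
move=> Hphi; have Hz : cc_field (M + `|z|) (fun x => phi (x + z)).
  move=> i; split; last exact: (bsupp_shift (Hphi i).2).
  by move=> k; exact: (Cks_shift z ((Hphi i).1 k)).
split; first exact: Hz.
rewrite (divE Hz) (divE Hphi); apply/funext => x; apply: eq_bigr => i _.
have D : is_derive (x + z) (e_ i) (fun x => phi x 0 i) ('D_(e_ i) (fun x => phi x 0 i) (x + z)).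
  by apply: derivableP; apply: C1_derivable; exact: ((Hphi i).1 1%N).
by have [_ ->] := is_derive_shift_arg D.
Qed.

Lemma test_field_shift U K M phi z : compact K -> cc_field M phi ->
  (forall x, phi x != 0 -> K x) -> (forall x, enorm (phi x) <= 1) ->
  (forall x, K x -> U (x - z)) -> test_field U (fun x => phi (x + z)).
Proof.
move=> cK Hphi phiK phi1 KU.
apply: (@test_field_intro _ _ _ [set x - z | x in K]).
- by apply/smooth_coorP => j k; exact: (((cc_field_shift z Hphi).1 j).1 k).
- apply: continuous_compact => //; apply: continuous_subspaceT; exact: rV_cont_shift.
- by move=> _ [x Kx <-]; exact: KU.
- by move=> x /phiK Kxz; exists (x + z) => //; rewrite addrK.
- by move=> x.
Qed.

(** The first moment comes from the gradient of the cutoff, the third from the gradient of the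
    Gaussian multiplied by 1 - cutoff = O(|z|^2). *)
Definition cutoff_const (rho : R) : R :=
  4 / rho ^+ 2 * (moment_const n 1 + moment_const n 3).

(** For large z the translated field may leave U, so no perimeter bound is available. The divergence
    is moved onto (1 - cutoff) gauss instead; with [g] bounding its partial derivatives, both
    moments yield 1/sqrt s, the factor s of the Gaussian gradient compensating the third moment. *)
Lemma far_gauss_le M phi u (rho s V : R) : cc_field M phi -> measurable_fun setT u ->
  (forall x, `|u x| <= 1) -> 0 < rho -> 0 < s ->
  (forall i, \int[lam]_x `|phi x 0 i| <= V) ->
  \int[lam]_z (corr u (div phi) z * ((1 - cutoff rho z) * gauss s z)) <=
  n%:R * V * (cutoff_const rho / Num.sqrt s * gmass n s).
Proof.
move=> Hphi mu u1 r0 s0 HV.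
pose w (z : 'rV[R]_n) := (1 - cutoff rho z) * gauss s z : R.
pose w' i (z : 'rV[R]_n) := (1 - cutoff rho z) * (- (2 * s) * (z 0 i * gauss s z)) -
  dcutoff rho i z * gauss s z : R.
have cc1 : continuous (fun z : 'rV[R]_n => 1 - cutoff rho z).
  by apply: rV_contD; [exact: rV_contC|apply: rV_contN; exact: continuous_cutoff].
have cw : continuous w by apply: rV_contM => //; exact: continuous_gauss.
have cw' i : continuous (w' i).
  apply: rV_contD.
    apply: rV_contM => //; apply: rV_contM; first exact: rV_contC.
    by apply: rV_contM; [exact: continuous_coor|exact: continuous_gauss].
  by apply: rV_contN; apply: rV_contM; [exact: continuous_dcutoff|exact: continuous_gauss].
have Dw i (z : 'rV[R]_n) : is_derive z (e_ i) w (w' i z).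
  have D1 : is_derive z (e_ i) (fun z => 1 - cutoff rho z) (- dcutoff rho i z).
    have D0 : is_derive z (e_ i) (cst (1 : R)) 0 := is_derive_cst _ _ _.
    by have := is_deriveB D0 (is_derive_cutoff rho z i); rewrite sub0r.
  apply: is_derive_eq (is_deriveM D1 (is_derive_gauss s z i)) _.
  by rewrite /w' /GRing.scale/=; ring.
have c01 (z : 'rV[R]_n) : 0 <= 1 - cutoff rho z <= 1.
  by have := cutoff_ge0 rho z; have := cutoff_le1 rho z; lra.
have wi : lam.-integrable setT (EFin \o w).
  apply: le_integrable (integrable_gauss n s0) => //; first exact: measurable_EFin_cont.
  move=> z _ /=; rewrite lee_fin normrM ler_piMl// ger0_norm; by case/andP: (c01 z).
pose g (z : 'rV[R]_n) := 4 / rho ^+ 2 * (enorm z ^+ 1 * gauss s z) +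
   4 * s / rho ^+ 2 * (enorm z ^+ 3 * gauss s z) : R.
have m1 := integrable_moment n 1 s0; have m3 := integrable_moment n 3 s0.
have i1 : lam.-integrable setT (EFin \o (fun z : 'rV[R]_n => 4 / rho ^+ 2 * (enorm z ^+ 1 * gauss s z))).
  exact: (integrableZl measurableT _ m1).
have i3 : lam.-integrable setT (EFin \o (fun z : 'rV[R]_n => 4 * s / rho ^+ 2 * (enorm z ^+ 3 * gauss s z))).
  exact: (integrableZl measurableT _ m3).
have gi : lam.-integrable setT (EFin \o g) by exact: (integrableD measurableT i1 i3).
have w'g i z : `|w' i z| <= g z.
  rewrite /w' /g; apply: le_trans (ler_normB _ _) _; rewrite addrC; apply: lerD.
    rewrite normrM (ger0_norm (ltW (gauss_gt0 _ _))) mulrA expr1.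
    by apply: ler_wpM2r; [exact: ltW (gauss_gt0 _ _)|exact: dcutoff_le].
  rewrite !normrM (ger0_norm (ltW (gauss_gt0 _ _))) !mulrA.
  apply: ler_wpM2r; first exact: ltW (gauss_gt0 _ _).
  rewrite normrN normrM normr_nat (ger0_norm (ltW s0)).
  have /andP[h0 h1] := c01 z; rewrite (ger0_norm h0).
  have := cutoff_near rho z; have := coor_le_enorm z i.
  have e0 := enorm_ge0 z; have ss := ltW s0.
  move: (1 - cutoff rho z) h0 h1 => c c0 _ a b.
  have := ler_pM c0 (normr_ge0 _) b a; move: (`|z 0 i|) => d h.
  have := ler_wpM2l (mulr_ge0 (ler0n R 2) ss) h.
  by rewrite exprS; move: (rho ^- 2) (enorm z) => r x; nra.
have w'i i : lam.-integrable setT (EFin \o w' i).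
  apply: le_integrable gi => //; first exact: measurable_EFin_cont.
  by move=> z _ /=; rewrite lee_fin (le_trans (w'g i z))// ler_norm.
have Iw' : \int[lam]_z g z <= cutoff_const rho / Num.sqrt s * gmass n s.
  have E : \int[lam]_z g z = 4 / rho ^+ 2 * \int[lam]_z (enorm z ^+ 1 * gauss s z) +
      4 * s / rho ^+ 2 * \int[lam]_z (enorm z ^+ 3 * gauss s z).
    have -> := RintegralD measurableT i1 i3.
    by rewrite (RintegralZl _ measurableT m1) (RintegralZl _ measurableT m3).
  rewrite E; have k1 := moment_le n 1 s0; have k3 := moment_le n 3 s0.
  have r2 : 0 <= 4 / rho ^+ 2 by rewrite divr_ge0// sqr_ge0.
  have r3 : 0 <= 4 * s / rho ^+ 2 by rewrite divr_ge0 ?sqr_ge0// mulr_ge0// ltW.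
  apply: le_trans (lerD (ler_wpM2l r2 k1) (ler_wpM2l r3 k3)) _.
  rewrite /cutoff_const le_eqVlt; apply/orP; left; apply/eqP.
  have q0 : Num.sqrt s != 0 by rewrite gt_eqF// sqrtr_gt0.
  have -> : s = Num.sqrt s ^+ 2 by rewrite sqr_sqrtr// ltW.
  rewrite sqrtr_sqr ger0_norm ?sqrtr_ge0//.
  move: q0; move: (Num.sqrt s) (gmass n _) => q m q0.
  by field; rewrite q0 gt_eqF.
have [Cd Hd] := Cks_div Hphi.
have ci i := integrable_corr mu u1 (Cks_derive i ((Hphi i).1 2%N)) (bsupp_derive (e_ i) (Hphi i).2) wi.
have E1 : \int[lam]_z (corr u (div phi) z * w z) =
    \sum_i \int[lam]_z (corr u ('D_(e_ i) (fun x => phi x 0 i)) z * w z).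
  rewrite -Rintegral_sum//; apply: eq_Rintegral => z _; rewrite -mulr_suml; congr (_ * _).
  rewrite (divE Hphi) /corr -Rintegral_sum//.
    by apply: eq_Rintegral => x _; rewrite mulr_sumr.
  move=> i; apply: integrable_bmul => //.
  apply: (integrable_shift_cc z _ (bsupp_derive (e_ i) (Hphi i).2)).
  exact: Cks_continuous (Cks_derive i ((Hphi i).1 1%N)).
rewrite E1; apply: (@le_trans _ _ (\sum_(i < n) V * (cutoff_const rho / Num.sqrt s * gmass n s))).
  apply: ler_sum => i _.
  rewrite (corr_parts mu u1 ((Hphi i).1 1%N) (Hphi i).2 (Dw i) cw (cw' i) wi (w'i i)).
  apply: le_trans (ler_norm _) _; rewrite normrN.
  have V0 : 0 <= V by apply: le_trans (HV i); exact: Rintegral_ge0.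
  apply: le_trans (ler_wpM2l V0 Iw').
  apply: (@le_trans _ _ (\int[lam]_z (V * g z))); last by rewrite RintegralZl.
  apply: Rintegral_le_abs.
  - exact: integrable_corr mu u1 ((Hphi i).1 1%N) (Hphi i).2 (w'i i).
  - exact: (integrableZl measurableT V gi).
  move=> z; rewrite normrM ler_pM//.
  by apply: le_trans (HV i); exact: corr_le mu u1 ((Hphi i).1 0%N) (Hphi i).2.
by rewrite sumr_const card_ord -[_ *+ n]mulr_natl mulrA.
Qed.

(* Where the cutoff is nonzero, phi(. + z) is a test field of U. *)
Lemma heat_perimeter_le U K M B phi (rho s V P : R) : measurable B -> compact K ->
  0 < rho -> 0 < s -> (forall x z, K x -> enorm z < rho -> U (x - z)) ->
  cc_field M phi -> (forall x, phi x != 0 -> K x) -> (forall x, enorm (phi x) <= 1) ->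
  (forall i, \int[lam]_x `|phi x 0 i| <= V) -> 0 <= P ->
  (forall psi, test_field U psi -> \int[lam]_x (\1_B x * div psi x) <= P) ->
  heat \1_B phi s <= P + n%:R * V * cutoff_const rho / Num.sqrt s.
Proof.
move=> mB cK r0 s0 KU Hphi phiK phi1 HV P0 HP.
have mu : measurable_fun setT (\1_B : 'rV[R]_n -> R) by exact: measurable_indic.
have u1 := indic_le1 (R := R) B.
have g0 := gmass_gt0 n s0; have gi := integrable_gauss n s0.
have [Cd Hd] := Cks_div Hphi.
have thi : lam.-integrable setT (EFin \o (fun z => cutoff rho z * gauss s z)).
  apply: le_integrable gi => //.
    by apply: measurable_EFin_cont; apply: rV_contM; [exact: continuous_cutoff|exact: continuous_gauss].
  by move=> z _ /=; rewrite lee_fin normrM ler_piMl// ger0_norm ?cutoff_ge0 ?cutoff_le1.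
have thi' : lam.-integrable setT (EFin \o (fun z => (1 - cutoff rho z) * gauss s z)).
  have := integrableB measurableT gi thi; apply: eq_integrable => // z _ /=.
  by rewrite mulrBl mul1r.
have c1 := integrable_corr mu u1 Cd Hd thi; have c2 := integrable_corr mu u1 Cd Hd thi'.
have E : \int[lam]_z (corr \1_B (div phi) z * gauss s z) =
    \int[lam]_z (corr \1_B (div phi) z * (cutoff rho z * gauss s z)) +
    \int[lam]_z (corr \1_B (div phi) z * ((1 - cutoff rho z) * gauss s z)).
  have <- := RintegralD measurableT c1 c2.
  by apply: eq_Rintegral => z _; rewrite -mulrDr -mulrDl addrC subrK mul1r.
have B1 : \int[lam]_z (corr \1_B (div phi) z * (cutoff rho z * gauss s z)) <= P * gmass n s.
  rewrite -(Rintegral_gauss n s0) -(RintegralZl P measurableT gi).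
  apply: le_Rintegral => //; first exact: (integrableZl measurableT P gi).
  move=> z _; have [zr|zr] := ltP (enorm z) rho; last first.
    by rewrite cutoff_far// mul0r mulr0 mulr_ge0// ltW// gauss_gt0.
  have hP : corr \1_B (div phi) z <= P.
    have [_ dE] := cc_field_shift z Hphi.
    have := HP _ (test_field_shift cK Hphi phiK phi1 (fun x Kx => KU x z Kx zr)).
    by rewrite dE.
  have tg : 0 <= cutoff rho z * gauss s z.
    by rewrite mulr_ge0 ?cutoff_ge0// ltW// gauss_gt0.
  apply: le_trans (ler_wpM2r tg hP) _; apply: ler_wpM2l => //.
  by rewrite ler_piMl ?cutoff_le1// ltW// gauss_gt0.
have B2 := far_gauss_le Hphi mu u1 r0 s0 HV.
rewrite /heat E -ler_pdivlMl ?invr_gt0// invrK mulrC mulrDl.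
apply: le_trans (lerD B1 B2) _; rewrite lerD2l le_eqVlt; apply/orP; left; apply/eqP.
by rewrite -!mulrA.
Qed.

End heat_perimeter.

Section limsup_bound.
Context {R : realType} {n : nat}.
Local Notation lam := (lebesgue_borel R n).
Implicit Types (K U F Omega : set 'rV[R]_n).

(** Each point of K comes with a neighbourhood and a range ]0, d[ of parameters; the near-covering
    form of compactness makes the range uniform. *)
Lemma compact_uniform_pos K (P : R -> 'rV[R]_n -> Prop) : compact K ->
  (forall x, K x -> exists2 d : R, 0 < d &
     forall y t, `|y - x| < d -> 0 < t -> t < d -> P t y) ->
  exists2 d : R, 0 < d & forall t x, 0 < t -> t < d -> K x -> P t x.
Proof.
move=> cK HP.
have /compact_near_coveringP/(_ R 0^'+ P _) H := cK.
have : \forall t \near (0 : R)^'+, forall x, K x -> P t x.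
  have := H _; apply => x Kx; have [d d0 Hd] := HP x Kx.
  exists ([set y : 'rV[R]_n | `|y - x| < d], [set t : R | 0 < t /\ t < d]) => /=.
    split; first by apply/near_norm_lt; exists d.
    exists d => //= t /=; rewrite sub0r normrN => td t0; split => //.
    by rewrite gtr0_norm in td.
  by move=> [y t] /= [yd [t0 td]]; exact: Hd.
move=> [d /= d0 Hd]; exists d => // t x t0 td; apply: Hd => //=.
by rewrite sub0r normrN gtr0_norm.
Qed.

Lemma compact_open_margin K U : compact K -> open U -> K `<=` U ->
  exists2 rho : R, 0 < rho & forall x z, K x -> enorm z < rho -> U (x - z).
Proof.
move=> cK oU KU.
have [x Kx|d d0 H] := @compact_uniform_pos K
    (fun t y => forall z, enorm z < t -> U (y - z)) cK.
  have [e e0 xU] := open_norm_lt oU (KU x Kx).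
  exists (e / 2); first by rewrite divr_gt0.
  move=> y t yx t0 te z zt; apply: xU; rewrite addrAC.
  have := ler_normB (y - x) z; have := norm_le_enorm z; lra.
exists (d / 2); first by rewrite divr_gt0.
by move=> x z Kx; apply: H => //; lra.
Qed.

Lemma compact_lebesgue_fin K : compact K -> exists V, 0 <= V /\
  forall f : 'rV[R]_n -> R, measurable_fun setT f -> (forall x, `|f x| <= 1) ->
    (forall x, f x != 0 -> K x) -> \int[lam]_x `|f x| <= V.
Proof.
move=> /compact_bounded[C [_ HC]]; pose k := Num.max C 0 + 2.
have k0 : 0 < k by rewrite ltr_wpDl// le_max lexx orbT.
have ii := integrable_indic_cube (n := n) k0.
exists (\int[lam]_x \1_(cube k) x); split.
  by apply: Rintegral_ge0 => x _; rewrite indicE.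
move=> f mf f1 fK.
have Kk x : K x -> cube k x.
  move=> Kx; apply/cubeP => //; have cC : C <= Num.max C 0 by rewrite le_max lexx.
  apply: (@le_lt_trans _ _ (Num.max C 0 + 1)); last by rewrite /k ltrD2l ltr1n.
  by apply: HC => //; rewrite (le_lt_trans cC)// ltrDl.
apply: le_Rintegral => //.
- apply: (@bsupp_integrable _ _ k 1).
  + exact: measurableT_comp.
  + by move=> x; rewrite normr_id.
  + move=> x kx; have [->|/fK/Kk/cubeP-/(_ k0)] := eqVneq (f x) 0; first by rewrite normr0.
    by rewrite ltNge kx.
- move=> x _; rewrite indicE; have [->|fx] := eqVneq (f x) 0; first by rewrite normr0.
  by rewrite mem_set ?f1//; exact: Kk (fK x fx).
Qed.

(** The averages are at most C1 sqrt s for s <= 1, by [heat_le], and at most P + C2 / sqrt s for s >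
    1, by [heat_perimeter_le]. The constant depends on a margin [rho] between the closure of Omega
    and the complement of U and on a volume [V], but neither on alpha nor on the test field. *)
Lemma frac_perimeter_le Omega U F (P : R) : compact (closure Omega) -> open U ->
  closure Omega `<=` U -> lebesgue_measurable F -> 0 <= P ->
  (perimeter F U <= P%:E)%E -> exists2 C : R, 0 <= C & forall al, 2^-1 <= al < 1 ->
    (frac_perimeter al F Omega <= (riesz_amp al * (P / gapc al + C))%:E)%E.
Proof.
move=> cK oU KU mF P0 HP.
have [rho r0 Hrho] := compact_open_margin cK oU KU.
have [V [V0 HV]] := compact_lebesgue_fin cK.
have [B HB] := lebesgue_borel_approx mF; have [mB _ _] := HB.
pose C1 := 2 * moment_const n 1 * (n%:R * (2 * V)).
have C10 : 0 <= C1 by rewrite !mulr_ge0 ?moment_const_ge0.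
pose C2 := n%:R * V * @cutoff_const R n rho.
have C20 : 0 <= C2.
  rewrite !mulr_ge0 ?invr_ge0 ?sqr_ge0//.
  by rewrite addr_ge0 ?moment_const_ge0.
exists (4 * C1 + 2 * C2); first by rewrite addr_ge0// mulr_ge0.
move=> al /andP[al2 al1]; have al01 : 0 < al < 1 by rewrite al1 andbT (lt_le_trans _ al2).
apply: ge_ereal_sup => _ [phi tphi <-].
have [M [M0 Hphi phi1 phiO]] := test_field_cc tphi.
rewrite (integral_borel_rep mF HB (integrable_frac_div al01 Hphi)) lee_fin.
have mu : measurable_fun setT (\1_B : 'rV[R]_n -> R) by exact: measurable_indic.
have phiK x : phi x != 0 -> closure Omega x.
  by move=> px; apply: subset_closure; apply: phiO; exact: subset_closure.
have HVi i : \int[lam]_x `|phi x 0 i| <= V.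
  apply: HV.
  - by apply: rV_continuous_measurable; exact: (Hphi i).1 0%N.
  - by move=> x; rewrite (le_trans (coor_le_enorm _ i)).
  - by move=> x pxi; apply: phiK; apply: contraNN pxi => /eqP ->; rewrite mxE.
have massV : mass phi <= n%:R * (2 * V).
  apply: (@le_trans _ _ (\sum_(i < n) 2 * V)).
    by apply: ler_sum => i _; rewrite ler_wpM2l.
  by rewrite sumr_const card_ord -[leLHS]mulr_natl.
apply: (frac_div_le al01 Hphi mu (indic_le1 B) al2 C10 C20).
- move=> s s0 _; apply: le_trans (ler_norm _) _.
  apply: le_trans (heat_le Hphi mu (indic_le1 B) s0) _.
  by rewrite ler_wpM2r ?sqrtr_ge0// ler_wpM2l// mulr_ge0 ?moment_const_ge0.
- move=> s s1.
  apply: (heat_perimeter_le (U := U) mB cK r0 (lt_trans ltr01 s1) Hrho Hphi phiK phi1 HVi P0).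
  move=> psi tpsi; have [M' [_ Hpsi _ _]] := test_field_cc tpsi.
  rewrite -lee_fin -(integral_borel_rep mF HB (integrable_div Hpsi)).
  by apply: le_trans HP; apply: ereal_sup_ubound; exists psi.
Qed.

Lemma perimeter_ge0 F Omega : lebesgue_measurable F -> (0 <= perimeter F Omega)%E.
Proof.
move=> mF; apply: ereal_sup_ubound; exists (cst 0).
  apply: (@test_field_intro _ _ _ set0) => //.
  - by apply/smooth_coorP => j k; under eq_fun do rewrite mxE; exact: Cks_cst.
  - exact: compact0.
  - by move=> x; rewrite /= eqxx.
  - by move=> x; rewrite enorm0.
rewrite (_ : (fun x => _) = cst 0%E) ?integral0// funeqE => x /=.
rewrite /div big1// => i _.
by rewrite derive_cst mxE.
Qed.

End limsup_bound.

(** * Smooth bumps *)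

Section smooth_bump.
Context {R : realType}.

(* t^-j exp(-1/t), extended by 0: a family stable under differentiation. *)
Definition flat_exp (j : nat) (t : R) : R :=
  if 0 < t then t^-1 ^+ j * expR (- t^-1) else 0.

Lemma flat_exp_le0 j (t : R) : t <= 0 -> flat_exp j t = 0.
Proof. by move=> t0; rewrite /flat_exp ltNge t0. Qed.

Lemma is_derive_flat_exp j (t : R) :
  is_derive t 1 (flat_exp j) (- j%:R * flat_exp j.+1 t + flat_exp j.+2 t).
Proof.
have [t0|t0|->] := ltgtP t 0.
- rewrite !flat_exp_le0 ?ltW// mulr0 addr0.
  apply: (near_eq_is_derive (f := cst 0)).
    near=> s; rewrite flat_exp_le0//; apply: ltW; near: s; exact: lt_nbhsl.
- have tn0 : t != 0 by rewrite gt_eqF.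
  have Dv : is_derive t 1 (fun s : R => s^-1) (- t ^- 2).
    by apply: is_derive_eq (is_deriveV tn0 (is_derive_id t 1)) _; rewrite /GRing.scale/= mulr1.
  have De : is_derive t 1 (fun s : R => expR (- s^-1)) (expR (- t^-1) * t ^- 2).
    apply: is_derive_eq (@is_derive1_comp R expR (fun s => - s^-1) t _ _ (is_derive_expR _) (is_deriveN Dv)) _.
    by rewrite opprK.
  have Dp : is_derive t 1 (fun s : R => s^-1 ^+ j) (- j%:R * t^-1 ^+ j.+1).
    elim: (j) => [|k IH].
      by rewrite oppr0 mul0r; under eq_fun do rewrite expr0; exact: is_derive_cst.
    under eq_fun do rewrite exprS.
    apply: is_derive_eq (is_deriveM Dv IH) _.
    by rewrite /GRing.scale/= -exprVn -natr1 !exprS; ring.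
  have D : is_derive t 1 (fun s : R => s^-1 ^+ j * expR (- s^-1))
      (- j%:R * flat_exp j.+1 t + flat_exp j.+2 t).
    apply: is_derive_eq (is_deriveM Dp De) _.
    by rewrite /flat_exp t0 /GRing.scale/= -exprVn !exprS; ring.
  apply: near_eq_is_derive D.
  near=> s; rewrite /flat_exp ifT//; near: s; exact: lt_nbhsr.
- rewrite !flat_exp_le0// mulr0 addr0.
  (* At 0, the bound (1/h)^(j+2) <= (j+2)! exp(1/h) gives the quadratic contact |flat_exp j h| <=
     (j+2)! h^2. *)
  apply: (@is_derive_flat R _ 0 (j.+2)`!%:R) => h; rewrite add0r.
  rewrite /flat_exp; case: ltP => h0; last by rewrite normr0 mulr_ge0// sqr_ge0.
  have hv0 : 0 <= h^-1 by rewrite invr_ge0 ltW.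
  rewrite ger0_norm; last by rewrite mulr_ge0 ?exprn_ge0 ?expR_ge0.
  have := expR_ge_pow j.+2 hv0; rewrite expRN ler_pdivrMr ?expR_gt0// => H.
  rewrite -(ler_pM2l (exprn_gt0 2 (_ : 0 < h^-1))) ?invr_gt0//.
  rewrite -exprD add2n (le_trans H)// le_eqVlt; apply/orP; left; apply/eqP.
  by move: (expR _) => x; field; rewrite gt_eqF.
Unshelve. all: by end_near. Qed.

Lemma flat_exp0_ge0 (t : R) : 0 <= flat_exp 0 t.
Proof. by rewrite /flat_exp; case: ifP => // _; rewrite expr0 mul1r expR_ge0. Qed.

Lemma flat_exp0_le1 (t : R) : flat_exp 0 t <= 1.
Proof.
rewrite /flat_exp; case: ifP => // t0; rewrite expr0 mul1r -expR0 ler_expR.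
by rewrite oppr_le0 invr_ge0 ltW.
Qed.

Lemma flat_exp0_gt0 (t : R) : 0 < t -> 0 < flat_exp 0 t.
Proof. by move=> t0; rewrite /flat_exp t0 expr0 mul1r expR_gt0. Qed.

End smooth_bump.

Section ball_bump.
Context {R : realType} {n : nat}.
Local Notation e_ i := (delta_mx 0 i : 'rV[R]_n).
Variables (p : 'rV[R]_n) (rho : R).
Hypothesis rho0 : 0 < rho.

Let q (y : 'rV[R]_n) : R := 1 - dotp (y - p) (y - p) / rho ^+ 2.
Let dq i (y : 'rV[R]_n) : R := - (2 / rho ^+ 2) * (y 0 i - p 0 i).

(** Positive exactly on the open Euclidean ball of centre [p] and radius [rho], see [bump_gt0]:
    these are the points that a displacement really moves. *)
Definition bump (y : 'rV[R]_n) : R := flat_exp 0 (q y).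

Let is_derive_q i y : is_derive y (e_ i) q (dq i y).
Proof.
have D : is_derive y (e_ i) (fun y : 'rV[R]_n => dotp (y - p) (y - p)) (2 * (y 0 i - p 0 i)).
  apply: (@is_derive_shift_arg _ _ (fun z => dotp z z)).
  apply: is_derive_eq (is_derive_dotp _ i) _.
  by rewrite !mxE.
have D0 : is_derive y (e_ i) (cst (1 : R)) 0 := is_derive_cst _ _ _.
have -> : q = cst 1 + (- rho ^- 2) *: (fun y : 'rV[R]_n => dotp (y - p) (y - p)).
  by apply/funext => z; rewrite !fctE /GRing.scale/= mulNr mulrC.
apply: is_derive_eq (is_deriveD D0 (is_deriveZ _ D)) _.
by rewrite add0r /GRing.scale/= /dq; ring.
Qed.

Let Cks_dq k i : Cks k (dq i).
Proof.
apply: CksZ; apply: (CksD (Cks_coor k i)); exact: Cks_cst.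
Qed.

Let continuous_q : continuous q.
Proof.
apply: rV_contD; first exact: rV_contC.
apply: rV_contN; apply: rV_contM; last exact: rV_contC.
apply: continuous_dotp; exact: rV_cont_shift.
Qed.

Lemma Cks_flat_bump k j : Cks k (fun y => flat_exp j (q y)).
Proof.
have cq m : continuous (fun y => flat_exp m (q y)).
  apply: rV_cont_comp => // t; apply: differentiable_continuous; apply/derivable1_diffP.
  by have [] := is_derive_flat_exp m t.
elim: k j => [|k IH] j; first exact: cq.
apply/CksSP; split; first exact: cq.
move=> i; exists (fun y => (- j%:R * flat_exp j.+1 (q y) + flat_exp j.+2 (q y)) * dq i y).
  move=> y; exact: (is_derive_scalar_comp (is_derive_flat_exp j (q y)) (is_derive_q i y)).
apply: CksM => //; apply: CksD; last exact: IH.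
by apply: CksZ; exact: IH.
Qed.

Lemma Cks_bump k : Cks k bump.
Proof. exact: Cks_flat_bump. Qed.

Lemma bump_derive i : 'D_(e_ i) bump = fun y => flat_exp 2 (q y) * dq i y.
Proof.
apply/funext => y; have [_ ->] :=
  is_derive_scalar_comp (is_derive_flat_exp 0 (q y)) (is_derive_q i y).
by rewrite oppr0 mul0r add0r.
Qed.

(** Read off an explicit formula in which i and j play the same role. [div_piola] relies on this
    symmetry to cancel second derivatives. *)
Lemma bump_derive_sym i j y :
  'D_(e_ i) ('D_(e_ j) bump) y = 'D_(e_ j) ('D_(e_ i) bump) y.
Proof.
have H k l : 'D_(e_ k) ('D_(e_ l) bump) y =
    flat_exp 2 (q y) * (- (2 / rho ^+ 2) * (k == l)%:R) +
    (- 2 * flat_exp 3 (q y) + flat_exp 4 (q y)) * dq k y * dq l y.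
  rewrite bump_derive; apply: derive_val.
  have D2 := is_derive_scalar_comp (is_derive_flat_exp 2 (q y)) (is_derive_q k y).
  have Dl : is_derive y (e_ k) (dq l) (- (2 / rho ^+ 2) * (k == l)%:R).
    have D0 : is_derive y (e_ k) (cst (p 0 l)) 0 := is_derive_cst _ _ _.
    apply: is_derive_eq (is_deriveZ (- (2 / rho ^+ 2)) (is_deriveB (is_derive_coor y (e_ k) l) D0)) _.
    by rewrite subr0 mxE eqxx/= eq_sym.
  apply: is_derive_eq (is_deriveM D2 Dl) _.
  by rewrite /GRing.scale/=; ring.
refine (etrans (H i j) (etrans _ (esym (H j i)))).
by rewrite [i == j]eq_sym; congr (_ + _); exact: mulrAC.
Qed.

Lemma bump_ge0 y : 0 <= bump y. Proof. exact: flat_exp0_ge0. Qed.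

Lemma bump_le1 y : bump y <= 1. Proof. exact: flat_exp0_le1. Qed.

Let q_gt0 y : (0 < q y) = (enorm (y - p) < rho).
Proof.
rewrite /q subr_gt0 ltr_pdivrMr ?exprn_gt0// mul1r -sqr_enorm.
by rewrite ltr_sqr ?nnegrE ?enorm_ge0// ltW.
Qed.

Lemma bump_gt0 y : (0 < bump y) = (enorm (y - p) < rho).
Proof.
rewrite -q_gt0 /bump; case: (ltP 0 (q y)) => qy; first by rewrite flat_exp0_gt0.
by rewrite flat_exp_le0// ltxx.
Qed.

Lemma bsupp_bump : bsupp (`|p| + rho) bump.
Proof.
move=> y My; apply/eqP; rewrite eq_le bump_ge0 andbT leNgt bump_gt0.
rewrite -leNgt (le_trans _ (norm_le_enorm _))//.
by have := lerB_dist y p; lra.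
Qed.

End ball_bump.

(** * Displacements along an axis *)

Section density.
Context d (T : measurableType d) (R : realType) (mu : {measure set T -> \bar R}).
Variable J : T -> R.
Hypothesis mJ : measurable_fun setT J.
Hypothesis J0 : forall x, 0 <= J x.
Local Open Scope ereal_scope.

Let f : T -> \bar R := EFin \o J.
Let mf : measurable_fun setT f. Proof. exact/measurable_EFinP. Qed.
Let f0 x : 0 <= f x. Proof. by rewrite lee_fin. Qed.

(** The proofs of measurability and positivity are taken as arguments so that the measure structure
    can be inferred from the term. *)
Definition density of measurable_fun setT J & (forall x, 0 <= J x)%R :=
  fun A : set T => \int[mu]_(x in A) (J x)%:E.

Let density0 : density mJ J0 set0 = 0.
Proof. by rewrite /density integral_set0. Qed.

Let density_ge0 A : 0 <= density mJ J0 A.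
Proof. by apply: integral_ge0 => x _; exact: f0. Qed.

Let density_sigma_additive : semi_sigma_additive (density mJ J0).
Proof.
move=> F mF tF mUF; rewrite /density.
rewrite (ge0_integral_bigcup mu mF (measurable_funTS mf) (fun x _ => f0 x) tF).
by apply: is_cvg_ereal_nneg_natsum => n _; apply: integral_ge0 => x _; exact: f0.
Qed.

HB.instance Definition _ := isMeasure.Build _ _ _ (density mJ J0)
  density0 density_ge0 density_sigma_additive.

Import HBNNSimple.

Let integral_density_nnsfun (g : {nnsfun T >-> R}) :
  \int[density mJ J0]_x (g x)%:E = \int[mu]_x ((g x)%:E * f x).
Proof.
under [LHS]eq_integral do rewrite fimfunE -fsumEFin//.
rewrite [LHS]ge0_integral_fsum//; last 2 first.
  - by move=> r; exact/measurable_EFinP/measurableT_comp.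
  - by move=> n x _; rewrite EFinM nnfun_muleindic_ge0.
under [RHS]eq_integral.
  move=> x xD; rewrite fimfunE -fsumEFin// muleC ge0_mule_fsumr; last first.
    by move=> r; rewrite EFinM nnfun_muleindic_ge0.
  over.
rewrite [RHS]ge0_integral_fsum//; last 2 first.
  - move=> r; apply: emeasurable_funM => //.
    by apply/measurable_EFinP; apply: measurable_funM => //; exact: measurable_indic.
  - by move=> n x _; rewrite mule_ge0// EFinM nnfun_muleindic_ge0.
apply: eq_fsbigr => r _.
rewrite integralZl_indic_nnsfun// integral_indic// setIT.
have mr : measurable (g @^-1` [set r]) by [].
have [r0|r0] := ltP r 0%R.
  rewrite (_ : g @^-1` [set r] = set0); last first.
    rewrite -subset0 => x /= gxr; have : (0 <= g x)%R by [].
    by rewrite gxr leNgt r0.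
  rewrite measure0 mule0 integral0_eq// => x _.
  by rewrite indicE in_set0 mulr0 mule0.
transitivity (r%:E * \int[mu]_x ((\1_(g @^-1` [set r]) x)%:E * f x)).
  congr (_ * _); rewrite /density [LHS]integral_mkcond; apply: eq_integral => x _.
  by rewrite patchE indicE; case: ifPn => _; rewrite ?mul1e ?mul0e.
rewrite -ge0_integralZl_EFin//; last 2 first.
- by move=> x _; rewrite mule_ge0// lee_fin indicE.
- by apply: emeasurable_funM => //; apply/measurable_EFinP; exact: measurable_indic.
by apply: eq_integral => x _; rewrite muleA -EFinM muleC.
Qed.

Lemma ge0_integral_density (h : T -> \bar R) : measurable_fun setT h ->
  (forall x, 0 <= h x) -> \int[density mJ J0]_x h x = \int[mu]_x (h x * f x).
Proof.
move=> mh h0; pose h_ := nnsfun_approx measurableT mh.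
have nd x a b : (a <= b)%N -> (h_ a x)%:E <= (h_ b x)%:E.
  by move=> ab; rewrite lee_fin; exact/lefP/nd_nnsfun_approx.
transitivity (limn (fun n => \int[density mJ J0]_x (h_ n x)%:E)).
  rewrite -monotone_convergence//=.
  - apply: eq_integral => x _; apply/esym/cvg_lim => //=.
    by apply: cvg_nnsfun_approx.
  - by move=> n; apply/measurable_EFinP.
  - by move=> n x _; rewrite lee_fin.
  - by move=> x _ a b ab; exact: nd.
rewrite (_ : \int[mu]_x _ = limn (fun n => \int[mu]_x ((h_ n x)%:E * f x))); last first.
  rewrite -monotone_convergence//=.
  - apply: eq_integral => x _; apply/esym/cvg_lim => //=.
    by apply: cvgeZr => //; apply: cvg_nnsfun_approx.
  - move=> n; apply: emeasurable_funM => //; exact/measurable_EFinP.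
  - by move=> n x _; rewrite mule_ge0// lee_fin.
  - by move=> x _ a b ab; apply: lee_wpmul2r => //; exact: nd.
by congr (limn _); apply/funext => n; exact: integral_density_nnsfun.
Qed.

Lemma integral_density (h : T -> R) : measurable_fun setT h ->
  \int[density mJ J0]_x (h x)%:E = \int[mu]_x (h x * J x)%:E.
Proof.
move=> mh; have mhE : measurable_fun setT (EFin \o h) by exact/measurable_EFinP.
rewrite [LHS]integralE [RHS]integralE; congr (_ - _).
  rewrite ge0_integral_density//; last exact: measurable_funepos.
  apply: eq_integral => x _; rewrite !funeposE /f /= -!EFin_max -EFinM.
  by rewrite maxr_pMl// mul0r.
rewrite ge0_integral_density//; last exact: measurable_funeneg.
apply: eq_integral => x _; rewrite !funenegE /f /= -!EFin_max -EFinM.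
by rewrite maxr_pMl// mul0r mulNr.
Qed.

End density.

Section shear_change.
Context {R : realType} {n : nat}.
Local Notation lam := (lebesgue_borel R n.+1).
Local Notation V := 'rV[R]_n.+1.
Local Notation e_ i := (delta_mx 0 i : V).
Variables (A : 'M[R]_n.+1) (zeta : V -> R) (M t : R).
Hypothesis AA : A *m A^T = 1%:M.
Hypothesis Cz : forall k, Cks k zeta.
Hypothesis Hz : bsupp M zeta.

(* The last coordinate of y *m A increases at unit speed along the axis. *)
Definition axis (A : 'M[R]_n.+1) : V := e_ ord_max *m A^T.
Local Notation v := (axis A).

(** Displacement against the axis; its inverse therefore pushes along the axis, which points into
    the domain in the charts. *)
Definition squeeze (y : V) : V := shear (fun y => - (t * zeta y)) v y.
(** Determinant of the differential of [squeeze], a rank-one perturbation of the identity built from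
    t, v and the gradient of zeta. *)
Definition squeeze_jac (y : V) : R := 1 - t * 'D_v zeta y.
Local Notation T := squeeze.
Local Notation J := squeeze_jac.

Hypothesis J0 : forall y, 0 <= J y.

Lemma continuous_squeeze : continuous T.
Proof.
apply: continuous_shear; apply: rV_contN; apply: rV_contM; first exact: rV_contC.
exact: (Cz 0%N).
Qed.

Lemma continuous_dzeta w : continuous ('D_w zeta).
Proof. exact: (Cks_continuous (Cks_deriv_dir w (Cz 1%N))). Qed.

Lemma continuous_jac : continuous J.
Proof.
apply: rV_contD; first exact: rV_contC.
apply: rV_contN; apply: rV_contM; first exact: rV_contC.
exact: continuous_dzeta.
Qed.

Lemma squeeze_far y : M <= `|y| -> T y = y.
Proof. by move=> My; rewrite /T /shear Hz// mulr0 oppr0 scale0r addr0. Qed.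

(* If f is the derivative of g along v, then f - (f o T) J is the derivative
   along v of g - g o T, which has compact support: this is the change of
   variables formula without any differentiation in t. *)
Lemma squeeze_integral0 (f g : V -> R) : continuous f -> continuous g ->
  (forall y, is_derive y v g (f y)) -> \int[lam]_y (f y - f (T y) * J y) = 0.
Proof.
move=> cf cg Dg.
have DgT y : is_derive y v (fun y => g (T y)) (f (T y) * J y).
  apply: is_derive_line0.
  have Dth : is_derive (0 : R) 1 (fun s : R => s - t * zeta (y + s *: v)) (J y).
    have D1 : is_derive (0 : R) 1 (fun s : R => zeta (y + s *: v)) ('D_v zeta y).
      apply: is_derive_line; rewrite scale0r addr0; apply: derivableP.
      exact: C1_derivable (Cz 1%N).
    exact: (is_deriveB (is_derive_id (0 : R) 1) (is_deriveZ t D1)).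
  have D2 : is_derive (- (t * zeta y)) 1 (fun r : R => g (y + r *: v)) (f (T y)).
    by apply: is_derive_line; exact: Dg.
  have -> : (fun s : R => g (T (y + s *: v))) =
      (fun r : R => g (y + r *: v)) \o (fun s : R => s - t * zeta (y + s *: v)).
    by apply/funext => s; rewrite /= /T /shear -addrA -scalerDl.
  apply: is_derive1_comp Dth.
  by rewrite scale0r addr0 sub0r.
pose h y := g y - g (T y).
have Dh y : is_derive y v h (f y - f (T y) * J y) := is_deriveB (Dg y) (DgT y).
have <- := @integral_derive0 R n.+1 M h v.
- by apply: eq_Rintegral => y _; apply/esym; have [] := Dh y.
- by apply: rV_contD => //; apply: rV_contN; exact: rV_cont_arg continuous_squeeze cg.
- by move=> y; have [] := Dh y.
- rewrite (_ : 'D_v h = fun y => f y - f (T y) * J y).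
    apply: rV_contD => //; apply: rV_contN; apply: rV_contM; last exact: continuous_jac.
    exact: rV_cont_arg continuous_squeeze cf.
  by apply/funext => y; have [] := Dh y.
- by move=> y My; rewrite /h squeeze_far// subrr.
Qed.

End shear_change.

Section trapezoid.
Context {R : realType}.

(* Trapezoids approximating indicators of intervals, with an explicit
   antiderivative as required by squeeze_integral0. *)
Definition ramp (k c r : R) : R := k * (Num.max 0 (r - c) - Num.max 0 (r - c - k^-1)).

Definition ramp_int (k c r : R) : R := k / 2 * (sqpos (r - c) - sqpos (r - c - k^-1)).

Lemma ramp_left (k c r : R) : 0 < k -> r <= c -> ramp k c r = 0.
Proof.
move=> k0 rc; have ki : 0 < k^-1 by rewrite invr_gt0.
by rewrite /ramp !max_l ?subrr ?mulr0//; move: (k^-1) ki => x x0; lra.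
Qed.

Lemma ramp_right (k c r : R) : 0 < k -> c + k^-1 <= r -> ramp k c r = 1.
Proof.
move=> k0 rc; have ki : 0 < k^-1 by rewrite invr_gt0.
rewrite /ramp !max_r; [|move: (k^-1) ki rc => x x0; lra..].
rewrite opprB addrC subrK mulfV// gt_eqF//.
Qed.

Lemma ramp01 (k c r : R) : 0 < k -> 0 <= ramp k c r <= 1.
Proof.
move=> k0; have kk : k * k^-1 = 1 by rewrite mulfV// gt_eqF.
have ki : 0 < k^-1 by rewrite invr_gt0.
rewrite /ramp; move: kk ki; move: (k^-1) => x kx x0.
case: (leP 0 (r - c)) => h1; case: (leP 0 (r - c - x)) => h2; apply/andP; split; nra.
Qed.

Lemma is_derive_sqpos_shift (c r : R) :
  is_derive r 1 (fun s => sqpos (s - c)) (2 * Num.max 0 (r - c)).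
Proof.
have D : is_derive r 1 (fun s : R => s - c) 1.
  have D0 : is_derive r 1 (cst c) 0 := is_derive_cst _ _ _.
  by have := is_deriveB (is_derive_id r 1) D0; rewrite subr0.
by have := @is_derive1_comp R sqpos (fun s => s - c) r _ _ (is_derive_sqpos _) D;
  rewrite mulr1.
Qed.

Lemma is_derive_ramp_int (k c r : R) : is_derive r 1 (ramp_int k c) (ramp k c r).
Proof.
have D2 : is_derive r 1 (fun s => sqpos (s - c - k^-1)) (2 * Num.max 0 (r - c - k^-1)).
  rewrite (_ : (fun s => _) = fun s => sqpos (s - (c + k^-1))); last first.
    by apply/funext => s; rewrite opprD addrA.
  by rewrite -addrA -opprD; exact: is_derive_sqpos_shift.
apply: is_derive_eq (is_deriveZ (k / 2) (is_deriveB (is_derive_sqpos_shift c r) D2)) _.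
by rewrite /GRing.scale/= /ramp; field.
Qed.

(** One ramp up over [a, a + 1/k] and one down over [b - 1/k, b]. If 1/k > b - a the second ramp
    comes first and the values are not positive, whence the absolute value in [trap_le1] and the
    margin 1 in [trap_far]. *)
Definition trap (k a b r : R) : R := ramp k a r - ramp k (b - k^-1) r.

Definition trap_int (k a b r : R) : R := ramp_int k a r - ramp_int k (b - k^-1) r.

Lemma is_derive_trap_int (k a b r : R) : is_derive r 1 (trap_int k a b) (trap k a b r).
Proof. exact: (is_deriveB (is_derive_ramp_int k a r) (is_derive_ramp_int k _ r)). Qed.

Lemma trap_le1 (k a b r : R) : 0 < k -> `|trap k a b r| <= 1.
Proof.
move=> k0; rewrite /trap ler_norml.
have /andP[x0 x1] := ramp01 a r k0; have /andP[y0 y1] := ramp01 (b - k^-1) r k0.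
by apply/andP; split; lra.
Qed.

Lemma trap_far (k a b r : R) : 1 <= k -> a < b -> `|a| + `|b| + 1 <= `|r| -> trap k a b r = 0.
Proof.
move=> k1 ab; have k0 : 0 < k by rewrite (lt_le_trans ltr01).
have ki : 0 < k^-1 by rewrite invr_gt0.
have ki1 : k^-1 <= 1 by rewrite invf_le1.
have A1 := ler_norm a; have B1 := ler_norm b.
have A2 := ler_norm (- a); have B2 := ler_norm (- b); rewrite !normrN in A2 B2.
rewrite /trap; case: (ger0P r) => r0 H.
  by rewrite !ramp_right ?subrr//; move: (k^-1) ki ki1 => x x0 x1; lra.
by rewrite !ramp_left ?subrr//; move: (k^-1) ki ki1 => x x0 x1; lra.
Qed.

Lemma continuous_ramp (k c : R) : continuous (ramp k c).
Proof.
have h (d : R) : continuous (fun r : R => Num.max 0 (r - d)).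
  move=> r; apply: (@continuous_max R _ (fun=> 0) (fun r => r - d) r); first exact: cvg_cst.
  by apply: cvgB; [exact: cvg_id|exact: cvg_cst].
move=> r; apply: cvgM; first exact: cvg_cst.
apply: cvgB; first exact: h.
under eq_fun do rewrite -addrA -opprD; rewrite -addrA -opprD; exact: h.
Qed.

Lemma continuous_trap (k a b : R) : continuous (trap k a b).
Proof. by move=> r; apply: cvgB; exact: continuous_ramp. Qed.

Lemma continuous_trap_int (k a b : R) : continuous (trap_int k a b).
Proof.
move=> r; apply: differentiable_continuous; apply/derivable1_diffP.
by have [] := is_derive_trap_int k a b r.
Qed.

(** Equality from some k on, rather than mere convergence. The limit is the open interval because
    both ends of the trapezoid have value 0. *)
Lemma trap_indic (a b r : R) : a < b ->
  \forall k \near \oo, trap k.+1%:R a b r = (a < r < b)%R%:R.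
Proof.
move=> ab.
have small (e : R) : 0 < e -> \forall k \near \oo, k.+1%:R^-1 < e.
  by move=> e0; exact: (near_infty_natSinv_lt (PosNum e0)).
have k0 (k : nat) : 0 < (k.+1%:R : R) by [].
case: (leP r a) => ra.
  have ab0 : 0 < b - a by rewrite subr_gt0.
  rewrite /=; near=> k; have : k.+1%:R^-1 < b - a by near: k; exact: small.
  move=> kb; rewrite /trap !ramp_left ?subrr//.
  by move: (k.+1%:R^-1) kb => x kb; lra.
case: (ltP r b) => rb /=.
  have rb0 : 0 < b - r by rewrite subr_gt0.
  have ra0 : 0 < r - a by rewrite subr_gt0.
  near=> k; have h1 : k.+1%:R^-1 < b - r by near: k; exact: small.
  have h2 : k.+1%:R^-1 < r - a by near: k; exact: small.
  rewrite /trap ramp_right ?ramp_left ?subr0//; move: (k.+1%:R^-1) h1 h2 => x h1 h2; lra.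
have ra0 : 0 < r - a by rewrite subr_gt0.
near=> k; have h2 : k.+1%:R^-1 < r - a by near: k; exact: small.
rewrite /trap !ramp_right ?subrr//; move: (k.+1%:R^-1) h2 => x h2; lra.
Unshelve. all: by end_near. Qed.

End trapezoid.

Section bounded_limit.
Context {R : realType} {n : nat}.
Local Notation lam := (lebesgue_borel R n).

Lemma Rintegral_cvg_bsupp (q : nat -> 'rV[R]_n -> R) (f : 'rV[R]_n -> R) (M C : R) :
  (forall k, measurable_fun setT (q k)) -> measurable_fun setT f ->
  (forall x, q k x @[k --> \oo] --> f x) -> (forall k x, `|q k x| <= C) ->
  (forall k, bsupp M (q k)) -> (\int[lam]_x q k x) @[k --> \oo] --> \int[lam]_x f x.
Proof.
move=> mq mf qf qC qM; pose r := Num.max M 0 + 1.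
have r0 : 0 < r by rewrite ltr_wpDl// le_max lexx orbT.
have gi := integrableZl measurableT C (integrable_indic_cube (n := n) r0).
have [] // := Rintegral_dominated mq mf qf gi => k x.
rewrite indicE; case: (boolP (x \in _)) => [_|]; first by rewrite mulr1.
move=> /negP xM; rewrite qM ?normr0 ?mulr0// leNgt; apply/negP => xM'; apply: xM.
apply/mem_set/cubeP => //; rewrite (lt_le_trans xM')//.
by rewrite (@le_trans _ _ (Num.max M 0)) ?le_max ?lexx// lerDl.
Qed.

End bounded_limit.

Section rV_products.
Context {R : realType} {m : nat}.

Lemma rV_cont_prod (I : Type) (r : seq I) (P : pred I) (F : I -> 'rV[R]_m -> R) :
  (forall i, continuous (F i)) -> continuous (fun x => \prod_(i <- r | P i) F i x).
Proof.
move=> cF; elim: r => [|i r IH].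
  by under eq_fun do rewrite big_nil; exact: rV_contC.
under eq_fun do rewrite big_cons.
by case: (P i) => //; exact: rV_contM.
Qed.

Lemma measurable_continuous_rV n (f : 'rV[R]_m -> 'rV[R]_n) :
  continuous f -> measurable_fun setT f.
Proof.
move=> /continuous_rVP cf; apply: measurable_to_rV => i.
exact: rV_continuous_measurable (cf i).
Qed.

Lemma continuous_mulmx n (B : 'M[R]_(m, n)) : continuous (fun y : 'rV[R]_m => y *m B).
Proof.
apply/continuous_rVP => j; under eq_fun do rewrite mxE.
by apply: rV_cont_sum => i; apply: rV_contM; [exact: continuous_coor|exact: rV_contC].
Qed.

End rV_products.

Section squeeze_measure.
Context {R : realType} {n : nat}.
Local Notation lam := (lebesgue_borel R n.+1).
Local Notation V := 'rV[R]_n.+1.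
Local Notation e_ i := (delta_mx 0 i : V).
Variables (A : 'M[R]_n.+1) (zeta : V -> R) (M t : R).
Hypothesis AA : A *m A^T = 1%:M.
Hypothesis Cz : forall k, Cks k zeta.
Hypothesis Hz : bsupp M zeta.
Local Notation v := (axis A).
Local Notation T := (squeeze A zeta t).
Local Notation J := (squeeze_jac A zeta t).
Hypothesis J0 : forall y, 0 <= J y.

Lemma enorm_orthogonal (y : V) : enorm (y *m A) = enorm y.
Proof.
have dE (x z : V) : dotp x z = (x *m z^T) 0 0.
  by rewrite /dotp !mxE; apply: eq_bigr => i _; rewrite mxE.
by rewrite /enorm !dE trmx_mul mulmxA -(mulmxA y) AA mulmx1.
Qed.

Lemma axis_rot (y : V) (s : R) : (y + s *: v) *m A = y *m A + s *: e_ ord_max.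
Proof.
rewrite mulmxDl -scalemxAl /axis -mulmxA.
by have /mulmx1C -> := AA; rewrite mulmx1.
Qed.

Lemma measurable_rot : measurable_fun setT (fun y : V => y *m A).
Proof. exact: measurable_continuous_rV (@continuous_mulmx R n.+1 n.+1 A). Qed.

Lemma measurable_squeeze : measurable_fun setT T.
Proof. exact: measurable_continuous_rV (continuous_squeeze Cz). Qed.

Lemma measurable_jac : measurable_fun setT J.
Proof. exact: rV_continuous_measurable (continuous_jac Cz). Qed.

Lemma jac_bounded : exists2 C : R, 0 <= C & forall y, `|J y| <= C.
Proof.
have [C C0 HC] := bsupp_bounded (continuous_dzeta Cz (w := v)) (bsupp_derive v Hz).
exists (1 + `|t| * C); first by rewrite addr_ge0// mulr_ge0.
move=> y; rewrite /squeeze_jac (le_trans (ler_normB _ _))// normr1 lerD2l normrM.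
by rewrite ler_wpM2l.
Qed.

(** [squeeze_integral0] is applied to products of trapezoids in the rotated coordinates. They have
    an explicit antiderivative along v because only the last coordinate varies in that direction.
    Letting k tend to infinity replaces them by the indicator of the rotated box. *)
Lemma squeeze_obox (a b : V) :
  lam ((fun y : V => y *m A) @^-1` obox a b) =
  (\int[lam]_(y in (fun y => T y *m A) @^-1` obox a b) (J y)%:E)%E.
Proof.
pose B := (fun y : V => y *m A) @^-1` obox a b.
have -> : (fun y => T y *m A) @^-1` obox a b = T @^-1` B by [].
rewrite -/B.
have mB : measurable B.
  by rewrite -[B]setTI; apply: measurable_rot => //; exact: measurable_obox.
have mTB : measurable (T @^-1` B).
  by rewrite -[_ @^-1` _]setTI; exact: measurable_squeeze.
have [ab|/existsNP[j /negP]] := pselect (forall j, a 0 j < b 0 j); last first.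
  rewrite -leNgt => ba.
  have B0 : B = set0.
    rewrite -subset0 => y /(_ j) /andP[h1 h2].
    by have := lt_trans h1 h2; rewrite ltNge ba.
  by rewrite B0 preimage_set0 integral_set0 measure0.
(* Beyond the radius M' the map T is the identity and [f k] vanishes: the rotation preserves the
   Euclidean norm, and [n.+1] is the cost of comparing it with the sup norm. *)
pose c := `|a| + `|b| + 1; pose M' := Num.max M (n.+1%:R * c).
pose f (k : nat) (y : V) := \prod_j trap k.+1%:R (a 0 j) (b 0 j) ((y *m A) 0 j).
pose g (k : nat) (y : V) := trap_int k.+1%:R (a 0 ord_max) (b 0 ord_max) ((y *m A) 0 ord_max) *
   \prod_(j | j != ord_max) trap k.+1%:R (a 0 j) (b 0 j) ((y *m A) 0 j).
have crot j : continuous (fun y : V => (y *m A) 0 j).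
  exact: ((continuous_rVP _).1 (@continuous_mulmx R n.+1 n.+1 A) j).
have cf k : continuous (f k).
  by apply: rV_cont_prod => j; apply: rV_cont_comp (crot j); exact: continuous_trap.
have cg k : continuous (g k).
  apply: rV_contM; first by apply: rV_cont_comp (crot _); exact: continuous_trap_int.
  by apply: rV_cont_prod => j; apply: rV_cont_comp (crot j); exact: continuous_trap.
have Dg k y : is_derive y v (g k) (f k y).
  apply: is_derive_line0.
  pose P := \prod_(j | j != ord_max) trap k.+1%:R (a 0 j) (b 0 j) ((y *m A) 0 j).
  pose r := (y *m A) 0 ord_max.
  have -> : (fun s : R => g k (y + s *: v)) =
      P *: (fun s : R => trap_int k.+1%:R (a 0 ord_max) (b 0 ord_max) (r + s)).
    apply/funext => s; rewrite /g axis_rot.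
    rewrite (_ : (P *: _) s = P * trap_int k.+1%:R (a 0 ord_max) (b 0 ord_max) (r + s))//.
    rewrite mulrC; congr (_ * _).
      by apply: eq_bigr => j jm; rewrite !mxE eqxx/= (negbTE jm) mulr0 addr0.
    by rewrite /r !mxE !eqxx mulr1.
  have D1 : is_derive (0 : R) 1 (fun s : R => r + s) 1.
    have D0 : is_derive (0 : R) 1 (cst r) 0 := is_derive_cst _ _ _.
    by have := is_deriveD D0 (is_derive_id (0 : R) 1); rewrite add0r.
  have D2 : is_derive (r + 0) 1 (trap_int k.+1%:R (a 0 ord_max) (b 0 ord_max))
      (trap k.+1%:R (a 0 ord_max) (b 0 ord_max) r).
    by rewrite addr0; exact: is_derive_trap_int.
  apply: is_derive_eq (is_deriveZ P (is_derive1_comp D2 D1)) _.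
  by rewrite mulr1 /f (bigD1 ord_max)//= mulrC.
have k1 (k : nat) : 1 <= (k.+1%:R : R) by rewrite ler1n.
have fC k y : `|f k y| <= 1.
  by rewrite /f normr_prod; apply: prodr_ile1 => j; rewrite normr_ge0 trap_le1.
have fM k : bsupp (n.+1%:R * c) (f k).
  move=> y My; apply/eqP; rewrite /f prodf_seq_eq0; apply/hasP; apply: contrapT => H.
  have Hj j : `|(y *m A) 0 j| < c.
    rewrite ltNge; apply/negP => cj; apply: H; exists j; first by rewrite mem_index_enum.
    apply/eqP; apply: trap_far => //; apply: le_trans cj.
    by rewrite /c lerD2r lerD// coor_le_norm.
  have c0 : 0 < c by rewrite /c ltr_wpDl// addr_ge0.
  have : `|y *m A| < c by exact: norm_rV_lt c0 Hj.
  rewrite -(ltr_pM2l (ltr0Sn R n)) => /(le_lt_trans (enorm_le_norm _)).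
  by rewrite enorm_orthogonal => /(le_lt_trans (norm_le_enorm _)); rewrite ltNge My.
have fB y : \forall k \near \oo, f k y = \1_B y.
  have : \forall k \near \oo, forall j, trap k.+1%:R (a 0 j) (b 0 j) ((y *m A) 0 j) =
      (a 0 j < (y *m A) 0 j < b 0 j)%R%:R.
    by apply: filter_forall => j; exact: trap_indic.
  apply: filterS => k Hk; rewrite /f (eq_bigr _ (fun j _ => Hk j)) indicE.
  have [yB|yB] := pselect (B y).
    by rewrite mem_set// big1// => j _; rewrite (yB j).
  rewrite memNset//; move/existsNP: yB => [j /negP/negbTE yj].
  by rewrite (bigD1 j)//= yj mul0r.
have [CJ CJ0 HCJ] := jac_bounded.
have m1B : measurable_fun setT (\1_B : V -> R) by exact: measurable_indic.
pose q k y := f k y - f k (T y) * J y.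
pose h y := \1_B y - \1_B (T y) * J y.
have cq k : continuous (q k).
  apply: rV_contD => //; apply: rV_contN; apply: rV_contM; last exact: continuous_jac.
  by apply: (rV_cont_arg (T := T)) => //; exact: continuous_squeeze.
have mh : measurable_fun setT h.
  apply: measurable_funB => //; apply: measurable_funM; last exact: measurable_jac.
  exact: (measurableT_comp m1B measurable_squeeze).
have fTM k : bsupp M' (fun y => f k (T y) * J y).
  move=> y; rewrite /M' ge_max => /andP[yM yc].
  by rewrite (squeeze_far A t Hz yM) fM// mul0r.
have qh y : q k y @[k --> \oo] --> h y.
  apply: cvg_near_cst; near=> k; rewrite /q /h; congr (_ - _ * _).
    by near: k; exact: fB.
  by near: k; exact: fB.
have := @Rintegral_cvg_bsupp R n.+1 q h M' (1 + CJ)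
  (fun k => rV_continuous_measurable (cq k)) mh qh.
have -> : (fun k => \int[lam]_x q k x) = cst 0.
  apply/funext => k; exact: (squeeze_integral0 t Cz Hz (cf k) (cg k) (Dg k)).
move=> /(_ _ _)/(cvg_unique _ (cvg_cst 0)) H.
have h0 : 0 = \int[lam]_x h x.
  apply: H => //.
  - move=> k y; rewrite /q (le_trans (ler_normB _ _))// lerD// normrM.
    by rewrite -[leRHS]mul1r ler_pM.
  - move=> k y My; rewrite /q fTM// fM ?subrr//.
    by rewrite (le_trans _ My)// /M' le_max lexx orbT.
have iB : lam.-integrable setT (EFin \o (\1_B : V -> R)).
  apply: (@bsupp_integrable _ _ (n.+1%:R * c) 1) => //; first by move=> x; exact: indic_le1.
  move=> y My; have [k _ Hk] := fB y; rewrite -(Hk k)//=.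
  exact: fM.
have iTB : lam.-integrable setT (EFin \o (fun y => \1_B (T y) * J y)).
  apply: (@bsupp_integrable _ _ M' CJ).
  - apply: measurable_funM; last exact: measurable_jac.
    exact: (measurableT_comp m1B measurable_squeeze).
  - by move=> x; rewrite normrM -[leRHS]mul1r ler_pM// indic_le1.
  - move=> y My; have [k _ Hk] := fB (T y); rewrite -(Hk k)//=.
    exact: fTM.
have /eqP := h0; rewrite eq_sym (RintegralB measurableT iB iTB) subr_eq0 => /eqP E.
transitivity (\int[lam]_x (\1_B x)%:E)%E; first by rewrite integral_indic// setIT.
rewrite (EFin_Rintegral measurableT iB) E -(EFin_Rintegral measurableT iTB).
rewrite [RHS]integral_mkcond; apply: eq_integral => y _.
by rewrite patchE indicE; case: ifPn => [/set_mem yT|/negP yT];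
  [rewrite mem_set// mul1r|rewrite memNset ?mul0r// => yB; apply: yT; exact/mem_set].
Unshelve. all: by end_near. Qed.

(** Both sides, as functions of the rotated set, are measures that agree on boxes by [squeeze_obox];
    they are finite there because rotated boxes are bounded. *)
Lemma squeeze_measure (D : set V) : measurable D ->
  lam D = (\int[lam]_(y in T @^-1` D) (J y)%:E)%E.
Proof.
move=> mD; have mTA : measurable_fun setT (fun y => T y *m A).
  exact: (measurableT_comp measurable_rot measurable_squeeze).
pose m1 := measure_function_pushforward__canonical__measure_function_Measure lam measurable_rot.
pose m2 := measure_function_pushforward__canonical__measure_function_Measure
  (density lam measurable_jac J0) mTA.
pose B := (fun w : V => w *m A^T) @^-1` D.
have mB : measurable B.
  rewrite -[B]setTI; apply: (measurable_continuous_rV (@continuous_mulmx R n.+1 n.+1 A^T)) => //.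
have AE (y : V) : y *m A *m A^T = y by rewrite -mulmxA AA mulmx1.
have -> : D = (fun y : V => y *m A) @^-1` B by apply/funext => y; rewrite /B /preimage/= AE.
suff E a b : m1 (obox a b) = m2 (obox a b).
  apply: (rV_measure_unique E) => // a b.
  rewrite /m1 /= /pushforward; apply: (@le_lt_trans _ _ (lam (cube (n.+1%:R * (`|a| + `|b| + 1) + 1)))); last exact: cube_lty.
  apply: le_measure; rewrite ?inE//.
  - rewrite -[_ @^-1` _]setTI; apply: measurable_rot => //; exact: measurable_obox.
  - exact: measurable_obox.
  have c0 : 0 < `|a| + `|b| + 1 by rewrite ltr_wpDl// addr_ge0.
  move=> y yab; apply/cubeP; first by rewrite ltr_wpDl// mulr_ge0// ltW.
  have yA : `|y *m A| <= `|a| + `|b| + 1.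
    apply: norm_rV_le; first exact: ltW.
    move=> j; have /andP[y1 y2] := yab j; rewrite ler_norml.
    have := coor_le_norm a j; have := coor_le_norm b j; rewrite !ler_norml.
    move=> /andP[b1 b2] /andP[a1 a2]; have := normr_ge0 a; have := normr_ge0 b.
    by move=> *; apply/andP; split; lra.
  apply: le_lt_trans (norm_le_enorm y) _; rewrite -enorm_orthogonal.
  apply: le_lt_trans (enorm_le_norm _) _.
  by rewrite (le_lt_trans (ler_wpM2l _ yA))// ltrDl.
exact: squeeze_obox.
Qed.

End squeeze_measure.

Section gradient.
Context {R : realType} {n : nat}.
Local Notation V := 'rV[R]_n.
Local Notation e_ i := (delta_mx 0 i : V).
Implicit Types (zeta : V -> R) (y v : V).

Definition grad zeta y : V := \row_i 'D_(e_ i) zeta y.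

Lemma derive_grad zeta v y : Cks 1 zeta -> 'D_v zeta y = dotp v (grad zeta y).
Proof. by move=> Cz; rewrite C1_deriveE//; apply: eq_bigr => i _; rewrite mxE. Qed.

Lemma grad_bounded M zeta : Cks 1 zeta -> bsupp M zeta ->
  exists2 L : R, 0 <= L & forall y, enorm (grad zeta y) <= L.
Proof.
move=> Cz Hz.
have H i := bsupp_bounded (Cks_continuous (Cks_derive i Cz)) (bsupp_derive (e_ i) Hz).
pose C i := s2val (cid2 (H i)).
have C0 i : 0 <= C i by rewrite /C; case: cid2.
have DC i x : `|'D_(e_ i) zeta x| <= C i by rewrite /C; case: cid2.
exists (n%:R * \sum_i C i); first by rewrite mulr_ge0// sumr_ge0.
move=> y; apply: le_trans (enorm_le_norm _) _; rewrite ler_wpM2l//.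
apply: norm_rV_le; first exact: sumr_ge0.
move=> i; rewrite mxE (le_trans (DC i y))// (bigD1 i)//= lerDl.
by apply: sumr_ge0.
Qed.

Lemma derive_dir_sym zeta v i y : (forall k, Cks k zeta) ->
  (forall i j y, 'D_(e_ i) ('D_(e_ j) zeta) y = 'D_(e_ j) ('D_(e_ i) zeta) y) ->
  is_derive y (e_ i) ('D_v zeta) ('D_v ('D_(e_ i) zeta) y).
Proof.
move=> Cz sym; have C1D j : Cks 1 ('D_(e_ j) zeta) by exact: Cks_derive (Cz 2%N).
have -> : 'D_v zeta = \sum_j (v 0 j *: 'D_(e_ j) zeta).
  apply/funext => x; rewrite C1_deriveE; last exact: (Cz 1%N).
  by rewrite fct_sumE.
rewrite C1_deriveE// (eq_bigr (fun j => v 0 j *: 'D_(e_ i) ('D_(e_ j) zeta) y)); last first.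
  by move=> j _; rewrite sym.
apply: is_derive_sum => j; apply: is_deriveZ; apply: derivableP.
exact: C1_derivable.
Qed.

End gradient.

(** * Inverse displacements and the perimeter of preimages *)

Section squeeze_inverse.
Context {R : realType} {n : nat}.
Local Notation lam := (lebesgue_borel R n.+1).
Local Notation V := 'rV[R]_n.+1.
Local Notation e_ i := (delta_mx 0 i : V).
Variables (A : 'M[R]_n.+1) (zeta : V -> R) (M L t : R).
Hypothesis AA : A *m A^T = 1%:M.
Hypothesis Cz : forall k, Cks k zeta.
Hypothesis sym : forall i j y,
  'D_(e_ i) ('D_(e_ j) zeta) y = 'D_(e_ j) ('D_(e_ i) zeta) y.
Hypothesis Hz : bsupp M zeta.
Hypothesis z01 : forall y, 0 <= zeta y <= 1.
Hypothesis HL : forall y, enorm (grad zeta y) <= L.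
Hypothesis t0 : 0 <= t.
Hypothesis tL : t * L <= 2^-1.
Local Notation v := (axis A).
Local Notation T := (squeeze A zeta t).
Local Notation J := (squeeze_jac A zeta t).

Lemma enorm_axis : enorm v = 1.
Proof.
have := enorm_orthogonal AA (0 + 1 *: v).
rewrite axis_rot// mul0mx add0r !scale1r add0r => <-.
rewrite /enorm /dotp (bigD1 ord_max)//= big1 ?addr0 => [|j /negbTE jm].
  by rewrite mxE !eqxx mulr1 sqrtr1.
by rewrite mxE jm andbF mul0r.
Qed.

Lemma derive_axis_le y : `|'D_v zeta y| <= L.
Proof.
rewrite derive_grad; last exact: (Cz 1%N).
by rewrite (le_trans (cauchy_schwarz _ _))// enorm_axis mul1r.
Qed.

Lemma jac_bounds y : 0 <= J y <= 1 + t * L.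
Proof.
have := derive_axis_le y; rewrite ler_norml => /andP[D1 D2].
rewrite /squeeze_jac; have := ler_wpM2l t0 D1; have := ler_wpM2l t0 D2.
by move: tL; rewrite mulrN => *; apply/andP; split; lra.
Qed.

Lemma jac_ge0 y : 0 <= J y. Proof. by case/andP: (jac_bounds y). Qed.

Lemma zeta_lipschitz x y : `|zeta x - zeta y| <= L * enorm (x - y).
Proof.
have fd z : derivable zeta z (x - y) by apply: C1_derivable; exact: (Cz 1%N).
have [c _] := mean_value_dir y 1 fd.
rewrite scale1r mul1r [y + _]addrC subrK => ->.
rewrite derive_grad; last exact: (Cz 1%N).
by rewrite (le_trans (cauchy_schwarz _ _))// mulrC ler_wpM2r// enorm_ge0.
Qed.

(* T x - T y differs from x - y by at most half its norm. *)
Lemma squeeze_expand x y : enorm (x - y) <= 2 * enorm (T x - T y).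
Proof.
have E : x - y = (T x - T y) + (t * (zeta x - zeta y)) *: v.
  by apply/rowP => j; rewrite /squeeze /shear !mxE; ring.
have := enormD (T x - T y) ((t * (zeta x - zeta y)) *: v).
rewrite -E enormZ enorm_axis mulr1 normrM (ger0_norm t0).
have := ler_wpM2l t0 (zeta_lipschitz x y); rewrite mulrA.
have := ler_wpM2r (enorm_ge0 (x - y)) tL; lra.
Qed.

(** T moves points along v only, so a preimage of x is x + s v with s a root of a scalar equation.
    The signs at 0 and t, due to 0 <= zeta <= 1, give it by the intermediate value theorem. *)
Lemma squeeze_solve x : exists s : R, 0 <= s <= t /\ s = t * zeta (x + s *: v).
Proof.
pose f s := s - t * zeta (x + s *: v).
have cf : continuous f.
  move=> s; apply: differentiable_continuous; apply/derivable1_diffP.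
  have D1 : is_derive s 1 (fun s : R => zeta (x + s *: v)) ('D_v zeta (x + s *: v)).
    apply: is_derive_line; apply: derivableP; exact: C1_derivable (Cz 1%N).
  by have [] := is_deriveB (is_derive_id s 1) (is_deriveZ t D1).
have f0 : f 0 <= 0.
  by rewrite /f sub0r oppr_le0 mulr_ge0//; case/andP: (z01 (x + 0 *: v)).
have ft : 0 <= f t.
  by rewrite /f subr_ge0 ler_piMr//; case/andP: (z01 (x + t *: v)).
have [|s] := @IVT R f 0 t 0 t0 (continuous_subspaceT cf).
  by rewrite ge_min f0/= le_max ft orbT.
rewrite in_itv/= => st /eqP; rewrite subr_eq0 => /eqP E.
by exists s.
Qed.

Definition squeeze_inv x : V := x + projT1 (cid (squeeze_solve x)) *: v.
Local Notation S := squeeze_inv.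

Lemma squeeze_invE x : S x = x + (t * zeta (S x)) *: v.
Proof.
have [_ E] := projT2 (cid (squeeze_solve x)).
by rewrite {1}/squeeze_inv; congr (_ + _ *: _); exact: E.
Qed.

Lemma squeeze_invK x : T (S x) = x.
Proof. by rewrite /squeeze /shear {1}squeeze_invE scaleNr addrK. Qed.

Lemma squeezeK y : S (T y) = y.
Proof.
apply/eqP; rewrite -subr_eq0; have := squeeze_expand (S (T y)) y.
by rewrite squeeze_invK subrr enorm0 mulr0; apply: contraTT; rewrite -enorm_gt0 -ltNge.
Qed.

Lemma continuous_squeeze_inv : continuous S.
Proof.
apply/rV_contP => x e e0; exists (e / (2 * n.+1%:R)); first by rewrite divr_gt0.
move=> y yx; apply: le_lt_trans (norm_le_enorm _) _.
have := squeeze_expand (S x) (S y); rewrite !squeeze_invK => /le_lt_trans; apply.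
rewrite -ltr_pdivlMl//; apply: le_lt_trans (enorm_le_norm _) _.
by move: yx; rewrite distrC ltr_pdivlMr ?mulr_gt0//; lra.
Qed.

Lemma squeeze_inv_near x : enorm (S x - x) <= t.
Proof.
rewrite {1}squeeze_invE addrAC subrr add0r enormZ enorm_axis mulr1.
have /andP[z0 z1] := z01 (S x).
by rewrite ger0_norm ?mulr_ge0// ler_piMr.
Qed.

Lemma measurable_squeeze_inv : measurable_fun setT S.
Proof. exact: measurable_continuous_rV continuous_squeeze_inv. Qed.

(** [squeeze_measure] applied to the preimage of D by S, since S o T is the identity. *)
Lemma squeeze_inv_density (D : set V) : measurable D ->
  lam (S @^-1` D) = (\int[lam]_(y in D) (J y)%:E)%E.
Proof.
move=> mD; have mSD : measurable (S @^-1` D).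
  by rewrite -[_ @^-1` _]setTI; exact: measurable_squeeze_inv.
rewrite (squeeze_measure AA Cz Hz jac_ge0 mSD) -comp_preimage.
by rewrite (_ : S \o T = id)//; apply/funext => y; exact: squeezeK.
Qed.

Lemma squeeze_inv_measure_le (D : set V) : measurable D ->
  (lam (S @^-1` D) <= (1 + 2 * (t * L))%:E * lam D)%E.
Proof.
move=> mD; rewrite squeeze_inv_density// -integral_cst//.
have tL0 : 0 <= t * L by rewrite mulr_ge0// (le_trans (enorm_ge0 _) (HL 0)).
apply: ge0_le_integral => //.
- by move=> y _; rewrite lee_fin jac_ge0.
- by apply/measurable_EFinP; apply: measurable_funTS; exact: measurable_jac.
- by move=> y _; rewrite lee_fin; case/andP: (jac_bounds y) => _ h; lra.
Qed.

Section piola.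
Variables (M' : R) (phi : V -> V).
Hypothesis Hphi : cc_field M' phi.

(* Pull-back of phi by T (the cofactor matrix of DT applied to phi o T), whose
   divergence is J (div phi) o T; this uses the symmetry of the second
   derivatives of zeta. *)
Definition piola y : V := J y *: phi (T y) + (t * dotp (grad zeta y) (phi (T y))) *: v.

Let Czt k : Cks k (fun y => - (t * zeta y)).
Proof.
rewrite (_ : (fun y => _) = fun y => - t * zeta y); first exact: CksZ.
by apply/funext => y; rewrite mulNr.
Qed.

Let CphiT k i : Cks k (fun y => phi (T y) 0 i).
Proof. exact: (Cks_shear_comp v Czt ((Hphi i).1 k)). Qed.

Let CJ k : Cks k J.
Proof.
rewrite (_ : J = cst 1 \+ (fun y => - t * 'D_v zeta y)).
  by apply: CksD; [exact: Cks_cst|apply: CksZ; exact: Cks_deriv_dir (Cz k.+1)].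
by apply/funext => y; rewrite /squeeze_jac /= mulNr.
Qed.

Let W y := t * \sum_i ('D_(e_ i) zeta y * phi (T y) 0 i).

Let CW k : Cks k W.
Proof.
apply: CksZ; apply: Cks_sum => i; apply: CksM; last exact: CphiT.
exact: Cks_derive (Cz k.+1).
Qed.

Let piolaE y k : piola y 0 k = J y * phi (T y) 0 k + W y * v 0 k.
Proof.
rewrite /piola !mxE; congr (_ + _ * _ * _).
by apply: eq_bigr => i _; rewrite mxE.
Qed.

Lemma cc_piola : cc_field (Num.max M M') piola.
Proof.
move=> i; split => [k|y].
  under eq_fun do rewrite piolaE.
  apply: CksD; first exact: CksM.
  by apply: CksM => //; exact: Cks_cst.
rewrite ge_max => /andP[My M'y]; rewrite piolaE /W (squeeze_far A t Hz My).
rewrite (Hphi i).2// mulr0 add0r big1 ?mulr0 ?mul0r// => j _.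
by rewrite (Hphi j).2// mulr0.
Qed.

(** All correction terms cancel: D_v W, with W the coefficient of v, produces t J D_k zeta D_v phi_k
    and t phi_k D_v D_k zeta, which compensate those coming from the derivative of T and from the
    derivative of J. *)
Lemma div_piola y : div piola y = J y * div phi (T y).
Proof.
rewrite (divE cc_piola) (divE Hphi).
have Dz w : 'D_w (fun y => - (t * zeta y)) y = - (t * 'D_w zeta y).
  have D1 : is_derive y w zeta ('D_w zeta y) by apply: derivableP; exact: C1_derivable (Cz 1%N).
  by have [_ ->] := is_deriveN (is_deriveZ t D1).
have DT i w : is_derive y w (fun y => phi (T y) 0 i)
    ('D_w (fun x => phi x 0 i) (T y) - t * 'D_w zeta y * 'D_v (fun x => phi x 0 i) (T y)).
  have := is_derive_shear_comp v y w ((Hphi i).1 1%N) (Czt 1%N).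
  by rewrite Dz mulNr.
have DTv i : is_derive y v (fun y => phi (T y) 0 i) (J y * 'D_v (fun x => phi x 0 i) (T y)).
  by apply: is_derive_eq (DT i v) _; rewrite /squeeze_jac mulrBl mul1r.
have DJ k : is_derive y (e_ k) J (- (t * 'D_v ('D_(e_ k) zeta) y)).
  have D0 : is_derive y (e_ k) (cst (1 : R)) 0 := is_derive_cst _ _ _.
  apply: is_derive_eq (is_deriveB D0 (is_deriveZ t (derive_dir_sym v k y Cz sym))) _.
  by rewrite sub0r.
have DW : 'D_v W y = t * \sum_i ('D_(e_ i) zeta y * (J y * 'D_v (fun x => phi x 0 i) (T y)) +
     phi (T y) 0 i * 'D_v ('D_(e_ i) zeta) y).
  have -> : W = t *: \sum_i ('D_(e_ i) zeta * (fun y => phi (T y) 0 i)).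
    by apply/funext => x; rewrite /W [in RHS]/GRing.scale/= fct_sumE.
  have Di i : is_derive y v ('D_(e_ i) zeta) ('D_v ('D_(e_ i) zeta) y).
    by apply: derivableP; apply: C1_derivable; exact: Cks_derive (Cz 2%N).
  have Ds := is_derive_sum (fun i : 'I_n.+1 => is_deriveM (Di i) (DTv i)).
  by have [_ ->] := is_deriveZ t Ds.
have Dk k : is_derive y (e_ k) (fun x => piola x 0 k)
    (J y * ('D_(e_ k) (fun x => phi x 0 k) (T y) -
       t * 'D_(e_ k) zeta y * 'D_v (fun x => phi x 0 k) (T y)) -
     phi (T y) 0 k * (t * 'D_v ('D_(e_ k) zeta) y) + v 0 k * 'D_(e_ k) W y).
  have D1 := is_deriveM (DJ k) (DT k (e_ k)).
  have D2 : is_derive y (e_ k) W ('D_(e_ k) W y).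
    by apply: derivableP; exact: C1_derivable (CW 1).
  have -> : (fun x => piola x 0 k) = J * (fun y => phi (T y) 0 k) + v 0 k *: W.
    by apply/funext => x; rewrite piolaE [W x * _]mulrC.
  apply: is_derive_eq (is_deriveD D1 (is_deriveZ (v 0 k) D2)) _.
  by rewrite /GRing.scale/= mulrN.
rewrite (eq_bigr _ (fun k _ => @derive_val _ _ _ _ _ _ _ (Dk k))) big_split/=.
rewrite -C1_deriveE ?DW; last exact: CW.
rewrite [t * _]mulr_sumr -big_split mulr_sumr; apply: eq_bigr => k _ /=.
move: (J y) ('D_(e_ k) _ _) ('D_v _ (T y)) ('D_(e_ k) zeta y) (phi _ _ _) ('D_v _ y) => a b c d e f.
ring.
Qed.

(** One t L comes from the Jacobian, the other from the term along v. *)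
Lemma enorm_piola y : enorm (piola y) <= (1 + 2 * (t * L)) * enorm (phi (T y)).
Proof.
have /andP[j0 j1] := jac_bounds y.
apply: le_trans (enormD _ _) _; rewrite !enormZ enorm_axis mulr1 (ger0_norm j0).
rewrite normrM (ger0_norm t0).
have e0 := enorm_ge0 (phi (T y)).
have : `|dotp (grad zeta y) (phi (T y))| <= L * enorm (phi (T y)).
  by apply: le_trans (cauchy_schwarz _ _) _; rewrite ler_wpM2r.
move/(ler_wpM2l t0); have := ler_wpM2r e0 j1; rewrite mulrA; lra.
Qed.

End piola.

Lemma div_scale M' (phi : V -> V) (c : R) : cc_field M' phi ->
  cc_field M' (fun x => c *: phi x) /\ div (fun x => c *: phi x) = fun x => c * div phi x.
Proof.
move=> Hphi; have Hc : cc_field M' (fun x => c *: phi x).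
  move=> i; split=> [k|x Mx]; last by rewrite mxE (Hphi i).2// mulr0.
  by under eq_fun do rewrite mxE; apply: CksZ; exact: ((Hphi i).1 k).
split; first exact: Hc.
apply/funext => x; rewrite (divE Hc) (divE Hphi) mulr_sumr; apply: eq_bigr => i _.
have D : is_derive x (e_ i) (fun x => phi x 0 i) ('D_(e_ i) (fun x => phi x 0 i) x).
  by apply: derivableP; exact: C1_derivable ((Hphi i).1 1%N).
have -> : (fun x => (c *: phi x) 0 i) = c *: (fun x => phi x 0 i).
  by apply/funext => y; rewrite mxE.
by have [_ ->] := is_deriveZ c D.
Qed.

Lemma borel_rep_self (E : set V) : measurable E -> borel_rep E E.
Proof. by move=> mE; split => //; rewrite setDv; exact: negligible_set0. Qed.

(** The pull-back [psi] of phi / c is a test field of O: its norm is at most 1 by [enorm_piola], and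
    it is supported in the image by S of the support of phi. The density of the pushforward by S
    turns the integral of div phi over the preimage of E into c times that of div psi over E. *)
Lemma squeeze_perimeter (E O : set V) : measurable E ->
  (perimeter (S @^-1` E) (S @^-1` O) <= (1 + 2 * (t * L))%:E * perimeter E O)%E.
Proof.
move=> mE; set c := 1 + 2 * (t * L).
have c0 : 0 < c.
  by rewrite /c ltr_pwDl// mulr_ge0// mulr_ge0// (le_trans (enorm_ge0 _) (HL 0)).
have mSE : measurable (S @^-1` E).
  by rewrite -[_ @^-1` _]setTI; exact: measurable_squeeze_inv.
apply: ge_ereal_sup => _ [phi tphi <-].
have [M' [M'0 Hphi phi1 phiO]] := test_field_cc tphi.
have [Hc divc] := div_scale c^-1 Hphi.
pose psi := piola (fun x => c^-1 *: phi x).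
have Hpsi := cc_piola Hc.
have tpsi : test_field O psi.
  have cK : compact (S @` closure [set x | phi x != 0]).
    apply: continuous_compact; last by case: tphi => [[]].
    by apply: continuous_subspaceT; exact: continuous_squeeze_inv.
  apply: (test_field_intro _ cK).
  - by apply/smooth_coorP => j k; exact: ((Hpsi j).1 k).
  - by move=> _ [x /phiO Ox <-].
  - move=> y psi0; exists (T y); last exact: squeezeK.
    apply: subset_closure => /=; apply: contraNN psi0 => /eqP py.
    rewrite /psi /piola py scaler0 scaler0 add0r.
    by rewrite dotpC dotp0l mulr0 scale0r.
  move=> y; apply: le_trans (enorm_piola _ y) _; rewrite -/c enormZ.
  by rewrite gtr0_norm ?invr_gt0// mulrA mulfV ?mul1r// gt_eqF.
have di := integrable_div Hphi.
rewrite (integral_borel_rep (borel_lebesgue_measurable mSE) (borel_rep_self mSE) di).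
have m1E : measurable_fun setT (\1_E : V -> R) by exact: measurable_indic.
pose g y := \1_E y * div phi (T y).
have mdiv : measurable_fun setT (div phi).
  by apply/measurable_EFinP; exact: measurable_int di.
have mg : measurable_fun setT g.
  exact: (measurable_funM m1E (measurableT_comp mdiv (measurable_squeeze A t Cz))).
have -> : (\int[lam]_x (\1_(S @^-1` E) x * div phi x))%:E =
    (c * \int[lam]_x (\1_E x * div psi x))%:E.
  have cdi := integrableZl measurableT c (integrable_bmul m1E (indic_le1 E) (integrable_div Hpsi)).
  rewrite -RintegralZl//; last exact: (integrable_bmul m1E (indic_le1 E) (integrable_div Hpsi)).
  rewrite -(EFin_Rintegral measurableT cdi).
  have m1SE : measurable_fun setT (\1_(S @^-1` E) : V -> R) by exact: measurable_indic.
  rewrite -(EFin_Rintegral measurableT (integrable_bmul m1SE (indic_le1 _) di)).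
  transitivity (\int[lam]_x (g (S x))%:E)%E.
    by apply: eq_integral => x _; rewrite /g squeeze_invK.
  rewrite -(measurable_integral_pushforward measurable_squeeze_inv lam (f := EFin \o g)); last first.
    exact/measurable_EFinP.
  transitivity (\int[density lam (measurable_jac A t Cz) jac_ge0]_y (g y)%:E)%E.
    apply: eq_measure_integral => [|mS D mD _]; first exact: measurable_squeeze_inv.
    exact: squeeze_inv_density.
  rewrite integral_density//; apply: eq_integral => y _.
  rewrite (div_piola Hc) divc /g; congr EFin.
  by field; rewrite gt_eqF.
rewrite EFinM; apply: lee_wpmul2l; first by rewrite lee_fin ltW.
rewrite -(integral_borel_rep (borel_lebesgue_measurable mE) (borel_rep_self mE) (integrable_div Hpsi)).
by apply: ereal_sup_ubound; exists psi.
Qed.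

End squeeze_inverse.

(** * Pushing the closure of a Lipschitz domain into the domain *)

Section charts.
Context {R : realType} {n : nat}.
Local Notation lam := (lebesgue_borel R n.+1).
Local Notation V := 'rV[R]_n.+1.
Variable Omega : set V.
Hypothesis oO : open Omega.

(** Centre, orthogonal matrix and radius. *)
Definition chart : Type := (V * 'M[R]_n.+1 * R)%type.

Definition chart_ball (c : chart) (y : V) : Prop := enorm (y - c.1.1) < c.2.

(** The radius is doubled because a displacement that ends in the chart ball may start outside of
    it, at distance less than one more radius. *)
Definition chart_ok (c : chart) : Prop :=
  [/\ c.1.2 *m c.1.2^T = 1%:M, 0 < c.2 &
   forall y s, enorm (y - c.1.1) < 2 * c.2 -> 0 <= s < c.2 ->
     (Omega y -> Omega (y + s *: axis c.1.2)) /\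
     (closure Omega y -> 0 < s -> Omega (y + s *: axis c.1.2))].

Lemma lipschitz_rV_continuous m (g : 'rV[R]_m -> R) : lipschitz g -> continuous g.
Proof.
move=> [K [_ HK]]; have KK : K < `|K| + 1 by rewrite (le_lt_trans (ler_norm K))// ltrDl.
have {}HK := HK _ KK.
have K0 : 0 < `|K| + 1 by rewrite ltr_wpDl.
apply/rV_contP => x e e0; exists (e / (`|K| + 1)); first by rewrite divr_gt0.
move=> y yx; have := HK (x, y) (conj I I); rewrite /= => /le_lt_trans; apply.
by rewrite distrC mulrC -ltr_pdivlMr.
Qed.

Lemma col'_axis (A : 'M[R]_n.+1) (y : V) (s : R) : A *m A^T = 1%:M ->
  col' ord_max ((y + s *: axis A) *m A) = col' ord_max (y *m A) /\
  ((y + s *: axis A) *m A) 0 ord_max = (y *m A) 0 ord_max + s.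
Proof.
move=> AA; rewrite axis_rot//; split; last by rewrite !mxE !eqxx mulr1.
apply/rowP => j; rewrite !mxE eqxx/= (_ : (lift ord_max j == ord_max) = false) ?mulr0 ?addr0//.
by apply/negbTE; rewrite eq_sym neq_lift.
Qed.

Lemma chart_exists x : lipschitz_boundary Omega -> (closure Omega `\` Omega) x ->
  exists c : chart, c.1.1 = x /\ chart_ok c.
Proof.
move=> lip [clx nOx].
have [|A [g [AA lg nx]]] := lip x.
  by split => //; move=> /interior_subset.
have [e e0 He] := (near_norm_lt _ _).1 nx.
have cg := lipschitz_rV_continuous lg.
(* With radius e/4, a start within 2 (e/4) and a displacement below e/4 stay in the e-ball where
   Omega is an epigraph. *)
exists (x, A, e / 4); split => //; split => //=; first by rewrite divr_gt0.
(* By continuity of g the closure of Omega lies in the closed epigraph there, so any positive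
   displacement along the axis enters the open one. *)
have closed_le y : `|y - x| < e -> closure Omega y ->
    g (col' ord_max (y *m A)) <= (y *m A) 0 ord_max.
  move=> ye cly; rewrite leNgt; apply/negP => lt.
  have ch : continuous (fun z : V => (z *m A) 0 ord_max - g (col' ord_max (z *m A))).
    apply: rV_contD; first exact: ((continuous_rVP _).1 (@continuous_mulmx R n.+1 n.+1 A) ord_max).
    apply: rV_contN; apply: rV_cont_arg => //; apply/continuous_rVP => j.
    under eq_fun do rewrite mxE.
    exact: ((continuous_rVP _).1 (@continuous_mulmx R n.+1 n.+1 A) (lift ord_max j)).
  have d0 : 0 < g (col' ord_max (y *m A)) - (y *m A) 0 ord_max by rewrite subr_gt0.
  have [d d1 Hd] := (rV_contP _).1 ch y _ d0.
  have : nbhs y [set z | `|z - y| < Num.min d (e - `|y - x|)].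
    apply/near_norm_lt; exists (Num.min d (e - `|y - x|)) => //.
    by rewrite lt_min d1 subr_gt0.
  move=> /cly[z [Oz]] /=; rewrite lt_min => /andP[zd ze].
  have zx : `|z - x| < e.
    have := ler_normD (z - y) (y - x); rewrite addrA subrK; lra.
  have := (He z zx).1 Oz; have := Hd z zd.
  by rewrite ltr_norml => /andP[h1 h2] h3; move: h1 h2 h3; clear; lra.
move=> y s yr /andP[s0 sr].
have yx : `|y - x| < e.
  by apply: le_lt_trans (norm_le_enorm _) _; lra.
have ysx : `|y + s *: axis A - x| < e.
  apply: le_lt_trans (norm_le_enorm _) _; rewrite addrAC.
  apply: le_lt_trans (enormD _ _) _; rewrite enormZ enorm_axis// mulr1 ger0_norm//.
  lra.
have [E1 E2] := col'_axis y s AA.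
split=> [Oy|cly sp].
  apply: (He _ ysx).2; rewrite E1 E2.
  by have := (He _ yx).1 Oy; lra.
apply: (He _ ysx).2; rewrite E1 E2.
by have := closed_le y yx cly; lra.
Qed.

(* What is kept along compositions of the maps squeeze_inv: points of the
   closure satisfying [hit] are sent into Omega. *)
Definition push (C t : R) (hit : V -> Prop) (S : V -> V) : Prop :=
  [/\ continuous S,
      forall x, enorm (S x - x) <= C * t,
      forall D, measurable D -> (lam (S @^-1` D) <= (1 + C * t)%:E * lam D)%E,
      forall E, measurable E ->
        (perimeter (S @^-1` E) (S @^-1` Omega) <= (1 + C * t)%:E * perimeter E Omega)%E &
      [/\ forall x, Omega x -> Omega (S x),
          forall x, closure Omega x -> closure Omega (S x) &
          forall x, closure Omega x -> hit x -> Omega (S x)]].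

(* The margin r absorbs the displacements of the other maps. *)
Definition near_chart (l : seq chart) (r : R) (x : V) : Prop :=
  exists2 c, c \in l & forall y, enorm (y - x) <= r -> chart_ball c y.

(** Induction on the list. The displacement of the new chart is applied before the composition S of
    the others; this is why [push] records that Omega and its closure are preserved. *)
Lemma push_exists (l : seq chart) : (forall c, c \in l -> chart_ok c) ->
  exists C : R, 0 <= C /\ exists2 t0 : R, 0 < t0 &
    forall t, 0 < t -> t < t0 -> exists S, push C t (near_chart l (C * t)) S.
Proof.
elim: l => [_|c l IH Hl].
  exists 0; split => //; exists 1 => // t _ _; exists id; split.
  - exact: rV_cont_id.
  - by move=> x; rewrite subrr enorm0 mul0r.
  - by move=> D _; rewrite mul0r addr0 mul1e preimage_id.
  - by move=> E _; rewrite mul0r addr0 mul1e !preimage_id.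
  - by split => // x _ [].
have [|C [C0 [t0 t00 HS]]] := IH; first by move=> c' c'l; apply: Hl; rewrite inE c'l orbT.
have [AA r0 Hc] := Hl c (mem_head _ _).
case: c AA r0 Hc Hl => -[p A] r /= AA r0 Hc Hl.
pose z := bump p r.
have Cz k : Cks k z by exact: Cks_bump.
have Hz : bsupp (`|p| + r) z by exact: bsupp_bump.
have z01 y : 0 <= z y <= 1 by rewrite bump_ge0 bump_le1.
have [L L0 HL] := grad_bounded (Cz 1%N) Hz.
(* C + 1 bounds the sum of the two displacements, and (1 + 2tL)(1 + Ct) is at most 1 + (C + 2L +
   2LC) t since t <= 1. *)
pose C' := C + 2 * L + 1 + C * (2 * L).
have CL0 : 0 <= C * (2 * L) by rewrite !mulr_ge0.
have C'0 : 0 <= C' by rewrite /C'; lra.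
exists C'; split => //.
(* t0 serves the induction, 1 the product above, r the validity of the chart, and 1/(2(L + 1)) the
   condition t L <= 1/2. *)
exists (Num.min (Num.min t0 1) (Num.min r (2 * (L + 1))^-1)).
  by rewrite !lt_min t00 r0 ltr01/= invr_gt0 mulr_gt0// ltr_wpDl.
move=> t tp; rewrite !lt_min => /andP[/andP[tt0 t1] /andP[tr tL1]].
have [S [cS nS mS pS [OS clS hitS]]] := HS t tp tt0.
have tL : t * L <= 2^-1.
  have : t * (2 * (L + 1)) < 1.
    by rewrite -ltr_pdivlMr ?div1r// mulr_gt0// ltr_wpDl.
  by move: tp; clear; lra.
have t0' := ltW tp.
have sym := @bump_derive_sym R n.+1 p r.
pose Sc := squeeze_inv A Cz z01 t0'.
have cSc : continuous Sc by exact: (continuous_squeeze_inv AA HL tL).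
have ScE x : Sc x = x + (t * z (Sc x)) *: axis A by exact: squeeze_invE.
have nSc x : enorm (Sc x - x) <= t by exact: (squeeze_inv_near AA Cz z01 t0' x).
have ct : C' * t = C * t + (2 * L) * t + t + (C * (2 * L)) * t by rewrite /C'; ring.
have prod_le : (1 + 2 * (t * L)) * (1 + C * t) <= 1 + C' * t.
  rewrite ct; have : t * (t * (C * (2 * L))) <= 1 * (t * (C * (2 * L))).
    by rewrite ler_wpM2r ?mulr_ge0// ltW.
  lra.
have tC0 : 0 <= 1 + C * t by rewrite addr_ge0// mulr_ge0.
have tLL0 : 0 <= 1 + 2 * (t * L) by rewrite addr_ge0// !mulr_ge0.
(* If the bump vanishes at Sc x, then x is fixed. Otherwise Sc x lies in the chart ball, hence x in
   the double ball, and [chart_ok] applies to the displacement from x to Sc x. *)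
have step x : [/\ Omega x -> Omega (Sc x), closure Omega x -> closure Omega (Sc x) &
    closure Omega x -> 0 < z (Sc x) -> Omega (Sc x)].
  have [z0|zp] := eqVneq (z (Sc x)) 0.
    have E : Sc x = x by rewrite ScE z0 mulr0 scale0r addr0.
    by split; [rewrite E|rewrite E|rewrite z0 ltxx].
  have zp' : 0 < z (Sc x) by rewrite lt_neqAle eq_sym zp; case/andP: (z01 (Sc x)).
  have zle : z (Sc x) <= 1 by case/andP: (z01 (Sc x)).
  have : enorm (Sc x - p) < r by rewrite -bump_gt0.
  move=> Sp; have xp : enorm (x - p) < 2 * r.
    have := enormD (x - Sc x) (Sc x - p); rewrite addrA subrK -[x - Sc x]opprB enormN.
    have := nSc x; lra.
  have sr : 0 <= t * z (Sc x) < r.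
    rewrite mulr_ge0//; last exact: ltW.
    by apply: le_lt_trans tr; rewrite ler_piMr.
  have [H1 H2] := Hc x _ xp sr.
  rewrite -ScE in H1 H2.
  have sp : 0 < t * z (Sc x) by rewrite mulr_gt0.
  split => [//|clx|clx _]; last exact: H2.
  by apply: subset_closure; exact: H2.
exists (S \o Sc); split.
- by move=> x; apply: continuous_comp; [exact: cSc|exact: cS].
- move=> x; have := enormD (S (Sc x) - Sc x) (Sc x - x); rewrite addrA subrK => /le_trans; apply.
  apply: le_trans (lerD (nS (Sc x)) (nSc x)) _.
  by rewrite ct; have := mulr_ge0 L0 t0'; have := mulr_ge0 CL0 t0'; clear; lra.
- move=> D mD; rewrite -[(S \o Sc) @^-1` D]/(Sc @^-1` (S @^-1` D)).
  have mSD : measurable (S @^-1` D).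
    by rewrite -[_ @^-1` _]setTI; exact: (measurable_continuous_rV cS).
  apply: le_trans (squeeze_inv_measure_le AA Cz Hz z01 HL t0' tL mSD) _.
  apply: le_trans (lee_wpmul2l _ (mS D mD)) _; first by rewrite lee_fin.
  by rewrite muleA -EFinM; apply: lee_wpmul2r => //; rewrite lee_fin.
- move=> E mE.
  rewrite -[(S \o Sc) @^-1` E]/(Sc @^-1` (S @^-1` E)) -[(S \o Sc) @^-1` Omega]/(Sc @^-1` (S @^-1` Omega)).
  have mSE : measurable (S @^-1` E).
    by rewrite -[_ @^-1` _]setTI; exact: (measurable_continuous_rV cS).
  apply: le_trans (squeeze_perimeter AA Cz sym Hz z01 HL t0' tL _ mSE) _.
  apply: le_trans (lee_wpmul2l _ (pS E mE)) _; first by rewrite lee_fin.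
  rewrite muleA -EFinM; apply: lee_wpmul2r; last by rewrite lee_fin.
  by apply: perimeter_ge0; exact: borel_lebesgue_measurable.
split=> [x Ox|x clx|x clx [c' c'l Hx]].
- by apply: OS; have [H _ _] := step x; exact: H.
- by apply: clS; have [_ H _] := step x; exact: H.
have dist y : enorm (y - Sc x) <= C * t -> enorm (y - x) <= C' * t.
  move=> ySc; have := enormD (y - Sc x) (Sc x - x); rewrite addrA subrK => /le_trans; apply.
  apply: le_trans (lerD ySc (nSc x)) _.
  by rewrite ct; have := mulr_ge0 L0 t0'; have := mulr_ge0 CL0 t0'; clear; lra.
have [_ stepcl stephit] := step x.
(* A point hit by the new chart enters Omega under Sc and S keeps it there. Otherwise the margin C'
   t at x leaves a margin C t at Sc x for the chart c' of the list. *)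
move: c'l; rewrite inE => /orP[/eqP c'E|c'l].
  apply: OS; apply: stephit => //; rewrite bump_gt0//.
  have := Hx (Sc x); rewrite c'E /chart_ball /=; apply; apply: dist.
  by rewrite subrr enorm0 mulr_ge0.
apply: hitS; first exact: stepcl.
by exists c' => // y yS; apply: Hx; exact: dist.
Qed.

Lemma compact_closure_bounded : bounded_set Omega -> compact (closure Omega).
Proof.
move=> [K [_ HK]].
have KK : K < `|K| + 1 by rewrite (le_lt_trans (ler_norm K))// ltrDl.
have {}HK := HK _ KK.
apply: (subclosed_compact _ (@compact_norm_le R n.+1 (`|K| + 1))); first exact: closed_closure.
have /closure_id -> := @closed_norm_le R n.+1 (`|K| + 1).
by apply: closureS => x Ox; exact: HK.
Qed.

(** Finitely many chart balls cover the compact boundary, and for small t every boundary point lies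
    in one of them with margin C t. A point of the closure is then either in Omega, which is
    preserved, or on the boundary, which is hit. *)
Lemma push_into : bounded_set Omega -> lipschitz_boundary Omega ->
  exists C : R, 0 <= C /\ exists2 t0 : R, 0 < t0 &
    forall t, 0 < t -> t < t0 -> exists S, push C t setT S.
Proof.
move=> bO lip; have ccl := compact_closure_bounded bO.
pose bd := closure Omega `\` Omega.
have cbd : compact bd.
  apply: (subclosed_compact _ ccl); last by move=> x [].
  by apply: closedI; [exact: closed_closure|exact: open_closedC].
(* The triple (x, 0, 1) is a default value off the boundary; [chP] concerns boundary points only. *)
pose ch x : chart := if pselect (bd x) is left h then projT1 (cid (chart_exists lip h)) else (x, 0, 1).
have chP x : bd x -> (ch x).1.1 = x /\ chart_ok (ch x).
  by move=> bx; rewrite /ch; case: pselect => // h; case: cid.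
have ballO c : open (chart_ball c).
  rewrite (_ : chart_ball c = (fun y => enorm (y - c.1.1)) @^-1` [set r | r < c.2])//.
  have ce : continuous (fun y : V => enorm (y - c.1.1)).
    by apply: continuous_shift_arg; exact: continuous_enorm.
  by apply: open_comp; [move=> y _; exact: ce|exact: open_lt].
have := cbd; rewrite compact_cover => /(_ _ bd (fun x => chart_ball (ch x))) [].
- by move=> x _; exact: ballO.
- move=> x bx; exists x => //; have [E [_ r0 _]] := chP x bx.
  by rewrite /chart_ball E subrr enorm0.
move=> D Dbd Dcov.
pose l := [seq ch x | x <- finmap.enum_fset D].
have [|C [C0 [t0 t00 HS]]] := @push_exists l.
  move=> c /mapP[x xD ->]; apply: (chP x _).2.
  by apply/set_mem; exact: Dbd.
have [x bx|d d0 Hd] := @compact_uniform_pos R n.+1 bd (fun t x => near_chart l (C * t) x) cbd.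
  have [y yD yx] := Dcov x bx.
  pose r := (ch y).2 - enorm (x - (ch y).1.1).
  have r0 : 0 < r by rewrite subr_gt0.
  have D0 : 0 < n.+1%:R + C + 1 by rewrite ltr_wpDl// addr_ge0.
  (* [n.+1] converts the sup norm into the Euclidean norm, C accounts for the margin C t, and 1
     makes the final inequality strict. *)
  pose del := r / (n.+1%:R + C + 1); have del0 : 0 < del by rewrite divr_gt0.
  have delE : del * (n.+1%:R + C + 1) = r by rewrite divfK// gt_eqF.
  exists del => // w t wx tp tr; exists (ch y); first by apply/mapP; exists y.
  move=> u uw; rewrite /chart_ball.
  have := enormD (u - w) (w - (ch y).1.1); rewrite addrA subrK => /le_lt_trans; apply.
  have := enormD (w - x) (x - (ch y).1.1); rewrite addrA subrK => h1.
  have h2 := enorm_le_norm (w - x).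
  have h3 := ler_wpM2l (ler0n R n.+1) (ltW wx).
  have h4 := ler_wpM2l C0 (ltW tr).
  move: delE; rewrite /r !mulrDr mulr1 => delE.
  move: uw h1 h2 h3 h4 delE del0; clear.
  by rewrite [del * n.+1%:R]mulrC [del * C]mulrC; lra.
exists C; split => //; exists (Num.min t0 d); first by rewrite lt_min t00.
move=> t tp; rewrite lt_min => /andP[tt0 td].
have [S [cS nS mS pS [OS clS hitS]]] := HS t tp tt0.
exists S; split => //; split => // x clx _.
have [Ox|nOx] := pselect (Omega x); first exact: OS.
by apply: hitS => //; exact: Hd.
Qed.

End charts.

(** * The recovery family *)

Section L1_convergence.
Context {R : realType} {n : nat}.
Local Notation lam := (lebesgue_borel R n).
Local Notation V := 'rV[R]_n.
Variables (S : nat -> V -> V) (eps : nat -> R).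
Hypothesis cS : forall k, continuous (S k).
Hypothesis eps0 : eps k @[k --> \oo] --> 0.
Hypothesis nS : forall k x, enorm (S k x - x) <= eps k.
Hypothesis mS : forall k D, measurable D ->
  (lam (S k @^-1` D) <= (1 + eps k)%:E * lam D)%E.

Definition sym_diff (A B : set V) : set V := (A `\` B) `|` (B `\` A).

(** Local convergence in measure of the preimages of A to A, phrased as a property of A so that a
    monotone class argument applies. *)
Definition small (A : set V) : Prop := forall r e : R, 0 < r -> 0 < e ->
  \forall k \near \oo, (lam (cube r `&` sym_diff (S k @^-1` A) A) <= e%:E)%E.

Lemma measurable_preS k (A : set V) : measurable A -> measurable (S k @^-1` A).
Proof. by move=> mA; rewrite -[_ @^-1` _]setTI; exact: (measurable_continuous_rV (@cS k)). Qed.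

Lemma measurable_sym_diff k (A : set V) r : measurable A ->
  measurable (cube r `&` sym_diff (S k @^-1` A) A).
Proof.
move=> mA; have mSA := measurable_preS k mA.
apply: measurableI; first exact: measurable_obox.
by apply: measurableU; exact: measurableD.
Qed.

Lemma eps_small (d : R) : 0 < d -> \forall k \near \oo, eps k < d.
Proof.
move=> d0; have /cvgrPdist_lt/(_ d d0) := eps0; apply: filterS => k.
by rewrite sub0r normrN; exact: le_lt_trans (ler_norm _).
Qed.

(* The symmetric difference lies between two concentric boxes. *)
Lemma small_obox a b : small (obox a b).
Proof.
move=> r e r0 e0.
pose F (d : R) := \prod_(i < n) Num.max 0 (b 0 i - a 0 i + d).
have cF : continuous F.
  rewrite /F; elim: (index_enum _) => [|i s IH].
    under eq_fun do rewrite big_nil; move=> x; exact: cvg_cst.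
  under eq_fun do rewrite big_cons; move=> x; apply: cvgM; last exact: IH.
  apply: (@continuous_max R _ (fun=> 0) (fun d => b 0 i - a 0 i + d) x); first exact: cvg_cst.
  by apply: cvgD; [exact: cvg_cst|exact: cvg_id].
have e20 : 0 < e / 2 by rewrite divr_gt0.
have /cvgrPdist_lt/(_ _ e20)[d /= d0 Hd] := cF 0.
have d40 : 0 < d / 4 by rewrite divr_gt0.
have Fe x : `|x| < d -> `|F 0 - F x| < e / 2.
  by move=> xd; apply: Hd; rewrite /= sub0r normrN.
have := eps_small d40; apply: filterS => k ek.
pose O := obox (a - const_mx (d / 4)) (b + const_mx (d / 4)) : set V.
pose I := obox (a + const_mx (d / 4)) (b - const_mx (d / 4)) : set V.
have mO : measurable O by exact: measurable_obox.
have mI : measurable I by exact: measurable_obox.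
have IO : I `<=` O by move=> x /= H i; have := H i; rewrite !mxE => /andP[h1 h2]; apply/andP; split; lra.
have FO : lam O = (F (d / 2))%:E.
  rewrite lebesgue_borel_obox /F; congr EFin; apply: eq_bigr => i _.
  by rewrite !mxE; congr Num.max; field.
have FI : lam I = (F (- (d / 2)))%:E.
  rewrite lebesgue_borel_obox /F; congr EFin; apply: eq_bigr => i _.
  by rewrite !mxE; congr Num.max; field.
have close x i : `|S k x 0 i - x 0 i| < d / 4.
  apply: le_lt_trans ek; apply: le_trans (nS k x).
  by have := coor_le_enorm (S k x - x) i; rewrite !mxE.
apply: (@le_trans _ _ (lam (O `\` I))).
  apply: le_measure; rewrite ?inE.
  - by apply: measurable_sym_diff; exact: measurable_obox.
  - exact: measurableD.
  move=> x [_ sx].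
  have Ox : O x.
    case: sx => -[h _] i; have := h i; rewrite !mxE; have := close x i.
      by rewrite ltr_norml => /andP[h1 h2] /andP[h3 h4]; apply/andP; split; lra.
    by move=> _ /andP[h3 h4]; apply/andP; split; lra.
  split => // Ix; case: sx => -[h1 h2].
    by apply: h2 => i; have := Ix i; rewrite !mxE => /andP[h3 h4]; apply/andP; split; lra.
  apply: h2 => i; have := Ix i; rewrite !mxE; have := close x i.
  by rewrite ltr_norml => /andP[h3 h4] /andP[h5 h6]; apply/andP; split; lra.
rewrite measureD//=; last by rewrite FO ltry.
rewrite (_ : O `&` I = I); last exact: setIidr.
rewrite FO FI -EFinB lee_fin.
have hd : `|d / 2| < d by rewrite ger0_norm ?divr_ge0 ?ltW//; lra.
have hd' : `|- (d / 2)| < d by rewrite normrN.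
have := Fe _ hd; have := Fe _ hd'; rewrite !ltr_norml => /andP[h1 h2] /andP[h3 h4]; lra.
Qed.

Lemma small_setD A B : measurable A -> measurable B -> small A -> small B -> small (A `\` B).
Proof.
move=> mA mB sA sB r e r0 e0; have e20 : 0 < e / 2 by rewrite divr_gt0.
have := sB r _ r0 e20; have := sA r _ r0 e20; apply: filterS2 => k hA hB.
apply: (@le_trans _ _ (lam ((cube r `&` sym_diff (S k @^-1` A) A) `|`
    (cube r `&` sym_diff (S k @^-1` B) B)))).
  apply: le_measure; rewrite ?inE.
  - by apply: measurable_sym_diff; exact: measurableD.
  - by apply: measurableU; exact: measurable_sym_diff.
  move=> x [Qx [[[Sx nSx]]|[[Ax nBx]]]].
    move=> /not_andP[nAx|nnBx]; first by left; split => //; left.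
    by right; split => //; right; split => //; exact: contrapT.
  move=> /not_andP[nSx|nnSx]; first by left; split => //; right.
  by right; split => //; left; split => //; exact: contrapT.
apply: le_trans (measureU2 _ _ _) _; [exact: measurable_sym_diff..|].
by rewrite (splitr e) EFinD; exact: leeD.
Qed.

(* The tails A `\` F m are controlled uniformly in k by the bound on the
   measure of preimages. *)
Lemma small_bigcup (F : nat -> set V) : (forall i, measurable (F i)) ->
  nondecreasing_seq F -> (forall i, small (F i)) -> small (\bigcup_i F i).
Proof.
move=> mF ndF sF r e r0 e0; pose A := \bigcup_i F i.
have mA : measurable A by exact: bigcup_measurable.
have e40 : 0 < e / 4 by rewrite divr_gt0.
have r10 : 0 < r + 1 by rewrite addr_gt0.
(* Eventually S k moves points by less than 1, so it sends the cube of radius r into this larger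
   one. *)
pose Q := cube (r + 1) : set V.
have mQ : measurable Q by exact: measurable_obox.
have Qoo : (lam Q < +oo)%E by exact: cube_lty.
pose T m := (A `\` F m) `&` Q.
have mT m : measurable (T m) by apply: measurableI => //; exact: measurableD.
have T0 : (lam \o T) m @[m --> \oo] --> 0%E.
  rewrite (_ : 0%E = lam (\bigcap_m T m)); last first.
    rewrite (_ : \bigcap_m T m = set0) ?measure0// -subset0 => x H.
    have [[[i _ Fx] _] _] := H 0%N I.
    by have [[_ nF] _] := H i I; exact: nF.
  apply: nonincreasing_cvg_mu => //.
  - apply: (@le_lt_trans _ _ (lam Q)) => //; apply: le_measure; rewrite ?inE//.
    by move=> x [].
  - exact: bigcap_measurable.
  - move=> i j ij; apply/subsetPset => x [[Ax nFx] Qx]; split => //; split => // Fx.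
    by apply: nFx; have /subsetPset := ndF _ _ ij; exact.
have [m Tm] : exists m, (lam (T m) <= (e / 4)%:E)%E.
  have /(_ [set y | (y < (e / 4)%:E)%E]) := T0.
  move=> /(_ _)[|m _ Hm].
    by apply: open_nbhs_nbhs; split; [exact: open_ereal_lt_ereal|rewrite /= lte_fin].
  by exists m; apply: ltW; exact: (Hm m (leqnn m)).
have h1 := sF m r _ r0 e40; have h2 := eps_small ltr01.
near=> k.
have hk : (lam (cube r `&` sym_diff (S k @^-1` F m) (F m)) <= (e / 4)%:E)%E by near: k.
have ek : eps k < 1 by near: k.
apply: (@le_trans _ _ (lam ((cube r `&` sym_diff (S k @^-1` F m) (F m)) `|`
   (S k @^-1` T m `|` T m)))).
  apply: le_measure; rewrite ?inE.
  - exact: measurable_sym_diff.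
  - apply: measurableU; first exact: measurable_sym_diff.
    by apply: measurableU => //; exact: measurable_preS.
  move=> x [Qx sx].
  have xr : `|x| < r by apply/cubeP.
  have xQ : Q x by apply/cubeP => //; rewrite (lt_trans xr)// ltrDl.
  have SxQ : Q (S k x).
    apply/cubeP => //; have := ler_normD (S k x - x) x; rewrite subrK => /le_lt_trans; apply.
    have := nS k x; have := norm_le_enorm (S k x - x); lra.
  case: sx => -[Sx nAx].
    have nFx : ~ F m x by move=> Fx; apply: nAx; exists m.
    have [FSx|nFSx] := pselect (F m (S k x)); first by left; split => //; left.
    by right; left; split.
  have nFSx : ~ F m (S k x) by move=> Fx; apply: nAx; exists m.
  have [Fx|nFx] := pselect (F m x); first by left; split => //; right.
  by right; right; split.
apply: le_trans (measureU2 _ _ _) _.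
- exact: measurable_sym_diff.
- by apply: measurableU => //; exact: measurable_preS.
(* The factor 2 bounds 1 + eps k: preimages at most double the measure of the tail. *)
have hT : (lam (S k @^-1` T m `|` T m) <= (2 * (e / 4) + e / 4)%:E)%E.
  apply: le_trans (measureU2 _ _ _) _ => //; first exact: measurable_preS.
  rewrite EFinD; apply: leeD => //; apply: le_trans (mS k (mT m)) _.
  rewrite EFinM; apply: lee_pmul => //.
    by rewrite lee_fin addr_ge0// (le_trans (enorm_ge0 _) (nS k 0)).
  by rewrite lee_fin; lra.
apply: le_trans (leeD hk hT) _; rewrite -EFinD lee_fin; lra.
Unshelve. all: by end_near. Qed.

(** The Borel sets with this property form a lambda-system containing the boxes, a pi-system that
    generates the Borel sets. *)
Lemma small_borel A : measurable A -> small A.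
Proof.
rewrite measurable_rV_oboxes => mA.
have [] // := @lambda_system_subset V [set obox p.1 p.2 | p in [set: V * V]] _ setT
  [set A | measurable A /\ small A] _ _ _ A mA.
- by move=> _ _ [p _ <-] [q _ <-]; rewrite oboxI; eexists (_, _).
- split => //=.
  + split => // r e r0 e0; apply: nearW => k.
    rewrite (_ : sym_diff _ _ = set0) ?setI0 ?measure0 ?lee_fin ?ltW//.
    by rewrite -subset0 => x [[]|[]].
  + by move=> B C _ [mB sB] [mC sC]; split; [exact: measurableD|exact: small_setD].
  + move=> F ndF HF; split; first by apply: bigcup_measurable => i _; exact: (HF i).1.
    by apply: small_bigcup => // i; [exact: (HF i).1|exact: (HF i).2].
- by move=> _ [p _ <-]; split; [exact: measurable_obox|exact: small_obox].
Qed.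

Lemma L1_small A (K : set V) (e : R) : measurable A -> compact K -> measurable K -> 0 < e ->
  \forall k \near \oo, (\int[lam]_(x in K) `|\1_(S k @^-1` A) x - \1_A x|%:E <= e%:E)%E.
Proof.
move=> mA /compact_bounded[C [_ HC]] mK e0.
pose r := `|C| + 2; have r0 : 0 < r by rewrite ltr_wpDl.
have Kr : K `<=` cube r.
  move=> x Kx; apply/cubeP => //; apply: (@le_lt_trans _ _ (`|C| + 1)); last by rewrite ltrD2l ltr1n.
  by apply: HC => //; rewrite (le_lt_trans (ler_norm C))// ltrDl.
have := small_borel mA r0 e0; apply: filterS => k; apply: le_trans.
have mSA := measurable_preS k mA.
have mQ := measurable_sym_diff k r mA.
rewrite -[X in (_ <= lam X)%E]setIT -(integral_indic lam measurableT mQ) [leLHS]integral_mkcond.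
apply: ge0_le_integral => //.
- by move=> x _; rewrite patchE; case: ifPn => _; rewrite ?lee_fin.
- apply/(measurable_restrictT _ mK); apply: measurable_funTS; apply/measurable_EFinP.
  by apply: measurableT_comp => //; apply: measurable_funB; exact: measurable_indic.
- by apply/measurable_EFinP; exact: measurable_indic.
move=> x _; rewrite patchE; case: ifPn => [/set_mem Kx|_]; last by rewrite lee_fin.
rewrite lee_fin !indicE.
have [SA|SA] := pselect ((S k @^-1` A) x); have [Ax|Ax] := pselect (A x).
- by rewrite (mem_set SA) (mem_set Ax) subrr normr0.
- rewrite (mem_set SA) (memNset Ax) subr0 normr1 mem_set//.
  by split; [exact: Kr|left].
- rewrite (memNset SA) (mem_set Ax) sub0r normrN normr1 mem_set//.
  by split; [exact: Kr|right].
- by rewrite (memNset SA) (memNset Ax) subrr normr0.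
Qed.

End L1_convergence.

Section recovery.
Context {R : realType} {n : nat}.
Local Notation lam := (lebesgue_borel R n.+1).
Local Notation L := (lebesgue R n.+1).
Local Notation V := 'rV[R]_n.+1.
Implicit Types (Omega E B K : set V).

Lemma perimeter_borel_rep E B Omega : lebesgue_measurable E -> borel_rep E B ->
  perimeter E Omega = perimeter B Omega.
Proof.
move=> mE HB; have [mB _ _] := HB; rewrite /perimeter; congr ereal_sup.
apply/seteqP; split => _ [phi tphi <-]; exists phi => //;
  have [M [_ Hphi _ _]] := test_field_cc tphi; have di := integrable_div Hphi;
  by rewrite (integral_borel_rep mE HB di)
    (integral_borel_rep (borel_lebesgue_measurable mB) (borel_rep_self mB) di).
Qed.

Lemma limf_esup_le (f : R -> \bar R) (p : R) :
  (forall e : R, 0 < e -> \forall al \near 1^'-, (f al <= (p + e)%:E)%E) ->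
  (limf_esup f 1^'- <= p%:E)%E.
Proof.
move=> H; apply/lee_addgt0Pr => e e0; rewrite limf_esupE.
apply: (@le_trans _ _ (ereal_sup (f @` [set al | (f al <= (p + e)%:E)%E]))).
  by apply: ereal_inf_lbound; exists [set al | (f al <= (p + e)%:E)%E] => //; exact: H.
by apply: ge_ereal_sup => _ [al fal <-].
Qed.

(** Here k is fixed before alpha tends to 1, so the constant [Ck] of [frac_perimeter_le] and the
    range d of alpha may depend on k. *)
Lemma recovery_sequence Omega E (p : R) : open Omega -> bounded_set Omega ->
  lipschitz_boundary Omega -> lebesgue_measurable E -> perimeter E Omega = p%:E ->
  exists F : nat -> set V,
  [/\ forall k, lebesgue_measurable (F k),
      forall K (e : R), compact K -> 0 < e ->
        \forall k \near \oo, (\int[L]_(x in K) `|\1_(F k) x - \1_E x|%:E <= e%:E)%E &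
      forall e : R, 0 < e -> \forall k \near \oo, exists2 d : R, 0 < d &
        forall al, 1 - d < al -> al < 1 -> (frac_perimeter al (F k) Omega <= (p + e)%:E)%E].
Proof.
move=> oO bO lip mE pE.
have [B HB] := lebesgue_borel_approx mE; have [mB _ _] := HB.
have p0 : 0 <= p by rewrite -lee_fin -pE; exact: perimeter_ge0.
have [C [C0 [t0 t00 HS]]] := push_into oO bO lip.
(* [k.+2] makes t k < t0 strict for k = 0 as well. *)
pose t (k : nat) := t0 / k.+2%:R.
have tP k : 0 < t k < t0.
  rewrite /t divr_gt0//= ltr_pdivrMr// ltr_pMr// ltr1n//.
have HSk k : exists S, push Omega C (t k) setT S.
  by have /andP[h1 h2] := tP k; exact: HS.
pose S k := projT1 (cid (HSk k)).
have SP k : push Omega C (t k) setT (S k) by rewrite /S; case: cid.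
have cS k : continuous (S k) by have [] := SP k.
pose eps k := C * t k.
have eps0 : eps k @[k --> \oo] --> 0.
  rewrite -[X in _ --> X](mulr0 C); apply: cvgM; first exact: cvg_cst.
  rewrite -[X in _ --> X](mulr0 t0); apply: cvgM; first exact: cvg_cst.
  by have := @cvg_harmonic R; rewrite -cvg_shiftS.
have nS k x : enorm (S k x - x) <= eps k by have [_ h _ _ _] := SP k; exact: h.
have mS k D : measurable D -> (lam (S k @^-1` D) <= (1 + eps k)%:E * lam D)%E.
  by have [_ _ h _ _] := SP k; exact: h.
have mSB k : measurable (S k @^-1` B) by exact: measurable_preS.
exists (fun k => S k @^-1` B); split.
- by move=> k; exact: borel_lebesgue_measurable.
- move=> K e cK e0.
  have mK : measurable K.
    rewrite -[K]setCK; apply: measurableC; apply: rV_open_measurable; apply: closed_openC.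
    by apply: compact_closed => //; exact: norm_hausdorff.
  have := L1_small cS eps0 nS mS mB cK mK e0; apply: filterS => k.
  by rewrite (L1_borel_rep mE (borel_lebesgue_measurable (mSB k)) HB (borel_rep_self (mSB k)) mK).
move=> e e0; have e20 : 0 < e / 2 by rewrite divr_gt0.
(* Below this value of eps k, the perimeter bound (1 + eps k) p exceeds p by at most e/2; the + 1
   covers p = 0. *)
have d0 : 0 < e / 2 / (p + 1) by rewrite divr_gt0// ltr_wpDl.
have := eps_small eps0 d0; apply: filterS => k ek.
have [_ _ _ pS [OS _ hitS]] := SP k.
pose pk := (1 + eps k) * p.
have eps_ge0 : 0 <= eps k by rewrite mulr_ge0//; case/andP: (tP k) => /ltW.
have pk0 : 0 <= pk by rewrite mulr_ge0// addr_ge0.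
have pkE : (perimeter (S k @^-1` B) (S k @^-1` Omega) <= pk%:E)%E.
  by rewrite /pk EFinM -pE (perimeter_borel_rep Omega mE HB); exact: pS.
have oU : open (S k @^-1` Omega) by apply: open_comp => // x _; exact: cS.
have clU : closure Omega `<=` S k @^-1` Omega by move=> x clx; exact: hitS.
have [Ck Ck0 HCk] := frac_perimeter_le (compact_closure_bounded bO) oU clU
  (borel_lebesgue_measurable (mSB k)) pk0 pkE.
(* 4 pk and 2 Ck come from the bounds on A/a - 1 and on A in [riesz_amp_near]. *)
have q0 : 0 < 4 * pk + 2 * Ck + 1 by rewrite ltr_wpDl// addr_ge0// mulr_ge0.
exists (Num.min 2^-1 (e / 2 / (4 * pk + 2 * Ck + 1))).
  by rewrite lt_min invr_gt0 ltr0n/= divr_gt0.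
move=> al ald al1.
have : 1 - al < Num.min 2^-1 (e / 2 / (4 * pk + 2 * Ck + 1)) by lra.
rewrite lt_min => /andP[h1]; rewrite ltr_pdivlMr// => h2.
have al2 : 2^-1 <= al < 1 by rewrite al1 andbT; lra.
apply: le_trans (HCk al al2) _; rewrite lee_fin mulrDr mulrCA.
have [r1 A0 A1] := riesz_amp_near al2.
move: r1; rewrite ler_norml => /andP[_]; set r := riesz_amp al / gapc al => r1.
have ek' : eps k * (p + 1) < e / 2 by rewrite -ltr_pdivlMr// ltr_wpDl.
have b1 : pk * r <= pk * (1 + 4 * (1 - al)) by rewrite ler_wpM2l//; lra.
have b2 : riesz_amp al * Ck <= 2 * (1 - al) * Ck by rewrite ler_wpM2r.
have pkE' : pk = p + eps k * p by rewrite /pk; ring.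
apply: le_trans (lerD b1 b2) _.
have al10 : 0 <= 1 - al by lra.
move: h2 ek' b1 b2 al10 pkE' eps_ge0; clear; move: (eps k) => x.
move=> h2 ek' _ _ al10 pkE' x0; nra.
Qed.

(* K al is the largest admissible index below 1 / (1 - al). *)
Lemma diagonal_index (d : nat -> R) : (forall m, 0 < d m) ->
  exists K : R -> nat, forall m0 : nat, exists2 e : R, 0 < e &
    forall al, 1 - e < al -> al < 1 -> (m0 <= K al)%N /\ 1 - al < d (K al).
Proof.
move=> d0; pose N (al : R) := Num.bound (1 - al)^-1.
exists (fun al => \max_(m < N al | 1 - al < d m) m) => m0.
exists (Num.min (d m0) m0.+1%:R^-1); first by rewrite lt_min d0 invr_gt0 ltr0n.
move=> al ald al1.
have : 1 - al < Num.min (d m0) m0.+1%:R^-1.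
  by move: ald; move: (Num.min _ _) => x; lra.
rewrite lt_min => /andP[h1 h2].
have al0 : 0 < 1 - al by rewrite subr_gt0.
have mN : (m0 < N al)%N.
  rewrite -(ltr_nat R); apply: lt_trans (archi_boundP _); last by rewrite invr_ge0 ltW.
  apply: (@lt_trans _ _ m0.+1%:R); first by rewrite ltr_nat.
  by rewrite -[ltLHS]invrK ltf_pV2// posrE invr_gt0.
(* [m0] is itself admissible, so the maximum is at least m0 and is attained at an admissible
   index. *)
split; first by apply: (@leq_bigmax_cond _ (fun m : 'I_(N al) => 1 - al < d m) (fun m => nat_of_ord m) (Ordinal mN)).
have [|i iP ->] := @eq_bigmax_cond _ (fun m : 'I_(N al) => 1 - al < d m) (fun m => nat_of_ord m); last by [].
by apply/card_gt0P; exists (Ordinal mN).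
Qed.

Lemma cvg_left_ge0 (f : R -> \bar R) : (forall al, (0 <= f al)%E) ->
  (forall e : R, 0 < e -> \forall al \near 1^'-, (f al <= e%:E)%E) ->
  f al @[al --> 1^'-] --> 0%E.
Proof.
move=> f0 H; apply/fine_cvgP; split.
  apply: filterS (H 1 ltr01) => al fal; rewrite ge0_fin_numE//.
  exact: le_lt_trans fal (ltry _).
apply/cvgrPdist_le => e e0; apply: filterS (H e e0) => al fal.
have ffin : f al \is a fin_num by rewrite ge0_fin_numE// (le_lt_trans fal (ltry _)).
rewrite sub0r normrN ger0_norm; last exact: fine_ge0.
by rewrite -lee_fin fineK.
Qed.

Lemma limsup_recovery Omega E : open Omega -> bounded_set Omega ->
  lipschitz_boundary Omega -> lebesgue_measurable E ->
  exists F, [/\ measurable_family F, L1loc_cvg F E &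
    (limf_esup (fun al => frac_perimeter al (F al) Omega) 1^'- <= perimeter E Omega)%E].
Proof.
move=> oO bO lip mE.
case pE : (perimeter E Omega) => [p| |]; last 2 first.
(* For infinite perimeter the upper bound is void and the constant family suffices. *)
- exists (fun=> E); split => [al _ //|K cK|]; last exact: leey.
  apply: cvg_left_ge0 => [al|e e0]; first exact: integral_ge0.
  apply: nearW => al; rewrite integral0_eq ?lee_fin ?ltW// => x _.
  by rewrite subrr normr0.
- by have := perimeter_ge0 Omega mE; rewrite pE.
have [F [mF FL1 Fp]] := recovery_sequence oO bO lip mE pE.
(* k m >= m preserves the L^1 convergence along the diagonal. The range of alpha attached to m may
   shrink arbitrarily fast, which [diagonal_index] compensates by letting the index grow slowly
   enough. *)
have Hm (m : nat) : exists k, (m <= k)%N /\ exists2 d : R, 0 < d &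
    forall al, 1 - d < al -> al < 1 -> (frac_perimeter al (F k) Omega <= (p + m.+1%:R^-1)%:E)%E.
  have m0 : 0 < (m.+1%:R^-1 : R) by rewrite invr_gt0.
  have [N _ HN] := Fp _ m0; exists (maxn m N); split; first exact: leq_maxl.
  by apply: HN; exact: leq_maxr.
pose k m := projT1 (cid (Hm m)).
have kP m : (m <= k m)%N /\ exists2 d : R, 0 < d & forall al, 1 - d < al -> al < 1 ->
    (frac_perimeter al (F (k m)) Omega <= (p + m.+1%:R^-1)%:E)%E by rewrite /k; case: cid.
pose d m := s2val (cid2 (kP m).2).
have d0 m : 0 < d m by rewrite /d; case: cid2.
have dP m al : 1 - d m < al -> al < 1 ->
    (frac_perimeter al (F (k m)) Omega <= (p + m.+1%:R^-1)%:E)%E.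
  by rewrite /d; case: cid2 => /= x _; exact.
have [K HK] := diagonal_index d0.
exists (fun al => F (k (K al))); split.
- by move=> al _; exact: mF.
- move=> Q cQ; apply: cvg_left_ge0 => [al|e e0]; first exact: integral_ge0.
  have [N _ HN] := FL1 Q e cQ e0; have [x x0 Hx] := HK N.
  apply/near_leftP; exists x => // al alx al1; apply: HN => /=.
  have [NK _] := Hx al alx al1; exact: leq_trans NK (kP _).1.
apply: limf_esup_le => e e0.
have [N NE] : exists N : nat, N.+1%:R^-1 < e.
  have [N _ HN] := near_infty_natSinv_lt (PosNum e0); exists N; exact: (HN N (leqnn N)).
have [x x0 Hx] := HK N; apply/near_leftP; exists x => // al alx al1.
have [NK alK] := Hx al alx al1.
apply: le_trans (dP _ _ _ al1) _; first by move: alK; move: (d _) => y; lra.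
rewrite lee_fin lerD2l (le_trans _ (ltW NE))// lef_pV2 ?posrE ?ltr0n//.
by rewrite ler_nat ltnS.
Qed.

End recovery.

Theorem theorem4p16 (R : realType) (n : nat) (Omega : set 'rV[R]_n.+1)
    (hOmega_open : open Omega) (hOmega_bounded : bounded_set Omega)
    (hOmega_lip : lipschitz_boundary Omega)
    (E : set 'rV[R]_n.+1) (hE : lebesgue_measurable E) :
  is_Gamma_limit (fun alpha F => frac_perimeter alpha F Omega) E
    (perimeter E Omega).
Proof.
split=> [F mF FE|]; first exact: liminf_ineq.
exact: limsup_recovery.
Qed.
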